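(* Fix $h$. Then the problem $(\mathrm{McC}_{hh})$ has a convex feasible set that is bounded in $U\times\mathbb{R}^{N_h}\times\mathbb{R}^{N_h}$, and $(\mathrm{McC}_{hh})$ admits a minimizer. If $(u_{hh},w_h^1,\dots,w_h^{N_h},z_h^1,\dots,z_h^{N_h})$ is feasible for $(\mathrm{McC}_{hh})$ and $w_h:=\sum_{i=1}^{N_h}w_h^i\chi_{Q_h^i}$, then $(u_{hh},w_h,z_h^1,\dots,z_h^{N_h})$ is feasible for $(\mathrm{McC}_h)$. If $(u_h,w_h,z_h^1,\dots,z_h^{N_h})$ is feasible for $(\mathrm{McC}_h)$, then $(u_h,w_h^1,\dots,w_h^{N_h},z_h^1,\dots,z_h^{N_h})$ with $w_h^i:=(P_hw_h)|_{Q_h^i}$, $i\in\{1,\dots,N_h\}$, is feasible for $(\mathrm{McC}_{hh})$. Moreover, let $m_{\mathrm{McC}_{hh}}$ denote the infimum of $(\mathrm{McC}_{hh})$, let $\bar w_h$ be (the control component of) a minimizer of $(\mathrm{McC}_h)$, and let $\bar u_h\in U$ be the corresponding solution of $A\bar u_h+(P_h\bar u_h)(P_h\bar w_h)=f$. Then $$j(\bar u_h,\bar w_h)+\alpha\,\mathrm{TV}(\bar w_h)\ \ge\ m_{\mathrm{McC}_{hh}}-L_w\|w_u-w_\ell\|_{L^\infty}^{1/2}\,(\sqrt d)^{1/2}\,\mathrm{TV}(\bar w_h)^{1/2}\,h^{1/2},$$ where $L_w$ is the Lipschitz constant of $j$ with respect to its second argument on $C$. Moreover, if $m_{\mathrm{OCP}}$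 is the infimum of $(\mathrm{OCP})$, $(\bar u,\bar w)$ is a minimizer of $(\mathrm{OCP})$, and now $\bar u_h\in U$ denotes the solution of $A\bar u_h+(P_h\bar u_h)(P_h\bar w)=f$, then $$m_{\mathrm{OCP}}\ \ge\ m_{\mathrm{McC}_{hh}}-L_u\|\bar u-\bar u_h\|_U-L_w\|w_u-w_\ell\|_{L^\infty}^{1/2}\,(\sqrt d)^{1/2}\,\mathrm{TV}(\bar w)^{1/2}\,h^{1/2},$$ where $L_u$ is the Lipschitz constant of $j$ with respect to its first argument on the feasible set of $(\mathrm{McC}_{hh})$.
   Context: Setting. $\Omega\subset\mathbb{R}^d$ is a bounded domain, $H:=L^2(\Omega)$, and the control space is $W:=BV(\Omega)$; $\mathrm{TV}$ is the total variation seminorm, with $\mathrm{TV}(w)=+\infty$ if $w\in L^1(\Omega)\setminus BV(\Omega)$. $U$ is a reflexive Banach space compactly embedded into $H$; identifying $H\cong H^*$ one has compact embeddings $U\hookrightarrow H\cong H^*\hookrightarrow U^*$. $A:U\to U^*$ is linear and bounded with bounded inverse, $f\in U^*$, $\alpha>0$, $j:U\times H\to\mathbb{R}$ is Lipschitz continuous on bounded sets, and $C\subset H$ is nonempty, bounded, closed and convex. For all $(u,w)\in U\times W$ the product $uw$ is a measurable function that is also an element of $U^*$. The state equation $Au+uw=f$ is assumed to have a unique solution $u\in U$ for a given control $w\in C\cap W$. $(\mathrm{OCP})$: minimize $j(u,w)+\alpha\,\mathrm{TV}(w)$ over states $u\in U$ and controls $w\in C$ (the control space being $W$) subject to $Au+uw=f$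 in $U^*$. Bounds. There are $u_\ell,u_u\in H$ and $w_\ell,w_u\in L^\infty(\Omega)$ such that $u_\ell\le u\le u_u$ and $w_\ell\le w\le w_u$ a.e. for all $(u,w)\in U\times W$ with $Au+uw=f$ and $w\in C$. Partitions and averaging. For each $h$ from a sequence of mesh sizes, $\mathcal{Q}_h=\{Q_h^1,\dots,Q_h^{N_h}\}$ is a partition of $\Omega$ into intervals ($d=1$), squares ($d=2$), cubes ($d=3$), and so on, with mesh size (maximal edge length) $h$, and $P_hg:=\sum_{i=1}^{N_h}\frac{1}{|Q_h^i|}\int_{Q_h^i}g\,dx\;\chi_{Q_h^i}$ for $g\in L^1(\Omega)$. It is assumed that: (a) for every $w\in BV(\Omega)$ with $w_\ell\le w\le w_u$ a.e. the equation $Au+(P_hu)(P_hw)=f$ has a unique solution $u\in U$; (b) there are real numbers $u_\ell^i,u_u^i,w_\ell^i,w_u^i$ (depending on $h$ and $i$) such that $u_\ell^i\le(P_hu)|_{Q_h^i}\le u_u^i$ and $w_\ell^i\le(P_hw)|_{Q_h^i}\le w_u^i$ for all $i$ and for all $w\in C$ with $w_\ell\le w\le w_u$ a.e. and $u\in U$ that solve $Au+(P_hu)(P_hw)=f$; (c) there is a sequence of approximations $(\mathrm{TV}_h)_h$ of $\mathrm{TV}$ such that, for all $h$, $\mathrm{TV}_h:L^1(\Omega)\to[0,\infty]$ is lower semicontinuous, $\mathrm{TV}_h\circ P_h\le\mathrm{TV}$ and $\mathrm{TV}_h\circ P_h\le\mathrm{TV}_h$. $(\mathrm{McC}_h)$: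 minimize $j(u,w)+\alpha\,\mathrm{TV}(w)$ over $u\in U$, $w\in C$ with $w_\ell\le w\le w_u$ a.e., and $(z_1,\dots,z_{N_h})\in\mathbb{R}^{N_h}$, subject to $Au+\sum_{i=1}^{N_h}z_i\chi_{Q_h^i}=f$ in $U^*$ and, for every $i\in\{1,\dots,N_h\}$, on $Q_h^i$ (where $P_hu,P_hw$ are constant): $z_i\ge u_\ell^iP_hw+(P_hu)w_\ell^i-u_\ell^iw_\ell^i$, $z_i\ge u_u^iP_hw+(P_hu)w_u^i-u_u^iw_u^i$, $z_i\le u_u^iP_hw+(P_hu)w_\ell^i-u_u^iw_\ell^i$, $z_i\le u_\ell^iP_hw+(P_hu)w_u^i-u_\ell^iw_u^i$, $u_\ell^i\le P_hu\le u_u^i$. $(\mathrm{McC}_{hh})$: minimize $j(u,w)+\alpha\,\mathrm{TV}_h(w)$ over $u\in U$, $(w_1,\dots,w_{N_h})\in\mathbb{R}^{N_h}$, $(z_1,\dots,z_{N_h})\in\mathbb{R}^{N_h}$, where $w=\sum_{i}w_i\chi_{Q_h^i}$ must satisfy $w\in C$ and $w_\ell\le w\le w_u$ a.e., subject to $Au+\sum_iz_i\chi_{Q_h^i}=f$ in $U^*$ and the same inequalities on $Q_h^i$ for every $i$ as in $(\mathrm{McC}_h)$ with $P_hw$ replaced by $w_i$.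
   Formalization: It is additionally assumed that P_h maps C into C (otherwise (McC_hh) may be infeasible), and L_u is a Lipschitz constant of j in its first argument on the states feasible for (McC_hh) together with the point ū, uniformly for controls in C; L_u and L_w are taken nonnegative. *)

(* Defs.v *)
From HB Require Import structures.
From mathcomp Require Import all_boot all_order all_algebra.
From mathcomp Require Import all_classical all_reals all_analysis.
Set Implicit Arguments.
Unset Strict Implicit.
Unset Printing Implicit Defensive.
Import Order.TTheory GRing.Theory Num.Theory numFieldNormedType.Exports.
Local Open Scope classical_set_scope.
Local Open Scope ring_scope.

(* Borel sigma-algebra on matrices, in particular on row vectors 'rV[R]_n. *)
HB.instance Definition _ (R : realType) (m n : nat) :=
  @isMeasurable.Build (sigma_display (@open 'M[R]_(m, n))) 'M[R]_(m, n)
    <<s @open 'M[R]_(m, n) >> (@sigma_algebra0 _ setT (@open 'M[R]_(m, n)))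
    (@sigma_algebraC 'M[R]_(m, n) (@open 'M[R]_(m, n)))
    (@sigma_algebra_bigcup _ setT (@open 'M[R]_(m, n))).

Section borel_rV.
Context {R : realType}.

Lemma open_measurable_rV m n (A : set 'M[R]_(m, n)) : open A -> measurable A.
Proof. by move=> oA; apply: sub_sigma_algebra. Qed.

Lemma measurable_coord n (i : 'I_n) :
  measurable_fun setT (fun x : 'rV[R]_n => x 0 i).
Proof.
apply: (measurability _ (measurable_realfun.RGenOpens.measurableE R)) => _ [_ [a [b ->] <-]].
rewrite setTI; apply: open_measurable_rV.
apply: open_comp; last exact: interval_open.
by move=> x _; exact: coord_continuous.
Qed.

Lemma open_rV_bigcup n (A : set 'rV[R]_n) : open A ->
  A = \bigcup_(p in [set p : 'rV[rat]_n * nat |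
        ball (map_mx ratr p.1 : 'rV[R]_n) p.2.+1%:R^-1 `<=` A])
      ball (map_mx ratr p.1 : 'rV[R]_n) p.2.+1%:R^-1.
Proof.
move=> oA; apply/seteqP; split=> [x Ax|x [p /= pA xp]]; last exact: pA.
have /nbhs_ballP[e /= e0 eA] : nbhs x A by exact: open_nbhs_nbhs.
have [k ke] : exists k : nat, k.+1%:R^-1 < e / 2.
  have [k] := @ltr_add_invr R 0 (e / 2) (divr_gt0 e0 (ltr0Sn _ _)).
  by rewrite add0r => ?; exists k.
have k0 : 0 < k.+1%:R^-1 :> R by rewrite invr_gt0.
have /choice[q qP] i : exists q : rat, `|x 0 i - ratr q| < k.+1%:R^-1.
  have lt_x : x 0 i - k.+1%:R^-1 < x 0 i + k.+1%:R^-1.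
    by rewrite ltrBlDr -addrA ltrDl addr_gt0.
  have [q] := rat_in_itvoo lt_x.
  rewrite in_itv/= => /andP[q1 q2]; exists q.
  by rewrite distrC ltr_distl q1.
have qx : ball (map_mx ratr (\row_i q i) : 'rV[R]_n) k.+1%:R^-1 x.
  split=> // i j; rewrite !mxE ord1 /ball/= distrC; exact: qP.
exists (\row_i q i, k) => //= y qy; apply: eA.
apply: (@le_ball _ _ _ (k.+1%:R^-1 + k.+1%:R^-1)).
  by rewrite [leRHS]splitr lerD// ltW.
by apply: ball_triangle qy; exact: ball_sym.
Qed.

Lemma measurable_rV d (T : measurableType d) n (f : T -> 'rV[R]_n) :
  (forall i, measurable_fun setT (fun x => f x 0 i)) -> measurable_fun setT f.
Proof.
move=> mf; apply: (@measurability _ _ _ _ _ _ (@open 'rV[R]_n)) => //.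
move=> _ [A oA <-]; rewrite setTI (open_rV_bigcup oA) preimage_bigcup bigcup_mkcond.
apply: countable_bigcupT_measurable => [|p]; first exact: countableP.
case: ifPn => // _.
have p0 : 0 < p.2.+1%:R^-1 :> R by rewrite invr_gt0.
rewrite (_ : _ @^-1` _ = \bigcap_(i in [set: 'I_n])
  (fun x => f x 0 i) @^-1` (ball (ratr (p.1 0 i) : R) p.2.+1%:R^-1)); last first.
  apply/seteqP; split=> [x /= [_ +] i _|x /= +]; first by move=> /(_ 0 i); rewrite !mxE.
  by move=> fx; split=> // i j; rewrite !mxE ord1; exact: fx.
apply: fin_bigcap_measurable; first exact: finite_finset.
by move=> i _; rewrite -[X in measurable X]setTI; apply: mf => //; exact: measurable_realfun.measurable_ball.
Qed.

End borel_rV.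

Section lebesgue_rV.
Context (R : realType).

Definition rV_cons n (p : R * 'rV[R]_n) : 'rV[R]_n.+1 :=
  \row_i oapp (p.2 0) p.1 (unlift ord0 i).
Definition rV_uncons n (x : 'rV[R]_n.+1) : R * 'rV[R]_n :=
  (x 0 ord0, \row_i x 0 (lift ord0 i)).

Lemma rV_consK n : cancel (@rV_cons n) (@rV_uncons n).
Proof.
move=> [a v]; rewrite /rV_uncons /rV_cons !mxE unlift_none; congr (_, _).
by apply/rowP => i; rewrite !mxE liftK.
Qed.

Local Notation T1 n := (measurableTypeR R * 'rV[R]_n)%type.

Lemma measurable_rV_cons n :
  measurable_fun [set: T1 n] (@rV_cons n : T1 n -> 'rV[R]_n.+1).
Proof.
apply: measurable_rV => i; under eq_fun do rewrite mxE.
case: unliftP => [j|] _ /=; last exact: measurable_fst.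
by apply: (measurableT_comp (measurable_coord j)); exact: measurable_snd.
Qed.

Lemma measurable_rV_uncons n :
  measurable_fun setT (@rV_uncons n : 'rV[R]_n.+1 -> T1 n).
Proof.
apply/measurable_fun_pairP; split; first exact: measurable_coord.
apply: measurable_rV => i; under eq_fun do rewrite /= mxE.
exact: measurable_coord.
Qed.

Section step.
Variables (n : nat) (m : {sigma_finite_measure set 'rV[R]_n -> \bar R}).

Definition lebesgue_rV_step : set 'rV[R]_n.+1 -> \bar R :=
  pushforward (@lebesgue_measure R \x m)%E (@rV_cons n : T1 n -> 'rV[R]_n.+1).

HB.instance Definition _ := Measure.copy lebesgue_rV_step
  (measure_function_pushforward__canonical__measure_function_Measure
    (@lebesgue_measure R \x m)%E (@measurable_rV_cons n)).

Let step_sigma_finite : sigma_finite setT lebesgue_rV_step.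
Proof.
have /sigma_finiteP[F [FT ndF Foo]] := sigma_finiteT (@lebesgue_measure R).
have /sigma_finiteP[G [GT ndG Goo]] := sigma_finiteT m.
exists (fun k => (@rV_uncons n : _ -> T1 n) @^-1` (F k `*` G k)).
  rewrite -preimage_bigcup; apply/esym; rewrite -subTset => x _ /=.
  have [i _ Fi] : (\bigcup_i F i) (x 0 ord0) by rewrite -FT.
  have [k _ Gk] : (\bigcup_i G i) (rV_uncons x).2 by rewrite -GT.
  exists (maxn i k) => //; split=> /=.
    by move: Fi; exact/subsetPset/ndF/leq_maxl.
  by move: Gk; exact/subsetPset/ndG/leq_maxr.
move=> k; have [mF Fk] := Foo k; have [mG Gk] := Goo k; split.
  rewrite -[X in measurable X]setTI; apply: measurable_rV_uncons => //.
  exact: measurableX.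
rewrite /lebesgue_rV_step /pushforward -comp_preimage.
rewrite (_ : _ \o _ = id) ?preimage_id; last by apply/funext; exact: rV_consK.
by rewrite product_measure1E// lte_mul_pinfty// ge0_fin_numE.
Qed.

HB.instance Definition _ :=
  Measure_isSigmaFinite.Build _ _ _ lebesgue_rV_step step_sigma_finite.
End step.

(* n-fold product of the Lebesgue measure, transported to row vectors. *)
Fixpoint lebesgue_rV n : {sigma_finite_measure set 'rV[R]_n -> \bar R} :=
  if n is n'.+1 then lebesgue_rV_step (lebesgue_rV n')
  else dirac (0 : 'rV[R]_0).

Lemma measurable_rV_box n (a b : 'rV[R]_n) :
  measurable [set x : 'rV[R]_n | forall i, a 0 i <= x 0 i <= b 0 i].
Proof.
rewrite (_ : mkset _ = \bigcap_(i in [set: 'I_n])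
  (fun x : 'rV[R]_n => x 0 i) @^-1` `[a 0 i, b 0 i]).
  apply: fin_bigcap_measurable => // i _.
  by rewrite -[X in measurable X]setTI; apply: measurable_coord => //; exact: measurable_itv.
apply/seteqP; split=> [x /= xab i _|x xab i]; rewrite /= ?in_itv//=.
by have := xab i I; rewrite /= in_itv.
Qed.

Lemma lebesgue_rV_box n (a b : 'rV[R]_n) : (forall i, a 0 i <= b 0 i) ->
  lebesgue_rV n [set x | forall i, a 0 i <= x 0 i <= b 0 i] =
  (\prod_(i < n) (b 0 i - a 0 i))%:E.
Proof.
elim: n a b => [|n IH] a b ab.
  rewrite big_ord0/= diracE mem_set// => i; by case: i.
rewrite big_ord_recl EFinM.
rewrite (eq_bigr (fun i => (rV_uncons b).2 0 i - (rV_uncons a).2 0 i)); last first.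
  by move=> i _; rewrite !mxE.
rewrite -IH; last by move=> i; rewrite !mxE.
have mI : measurable (`[a 0 ord0, b 0 ord0]%classic : set (measurableTypeR R)).
  exact: measurable_itv.
have <- : @lebesgue_measure R `[a 0 ord0, b 0 ord0]%classic =
    (b 0 ord0 - a 0 ord0)%:E.
  by rewrite lebesgue_measure_itv/= lte_fin; case: ltgtP (ab ord0) => // -> _; rewrite subrr.
rewrite -product_measure1E//; last exact: measurable_rV_box.
rewrite /= /lebesgue_rV_step /pushforward; congr (_ _).
apply/seteqP; split=> [[x v] /= xab|[x v] [/= xab vab] i].
  split=> /=; first by have := xab ord0; rewrite mxE unlift_none in_itv.
  by move=> i; have := xab (lift ord0 i); rewrite !mxE liftK.
rewrite mxE; case: unliftP => [k ->|->] /=; last by move: xab; rewrite in_itv.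
by have := vab k; rewrite !mxE.
Qed.
End lebesgue_rV.

Section measure_preliminaries.
Context {R : realType} {d : nat} (mu : {measure set 'rV[R]_d -> \bar R}).
Implicit Types f g w : 'rV[R]_d -> R.

Definition L2norm f : R := fine 'N[mu]_2%:E[EFin \o f].

Definition L1norm f : R := fine 'N[mu]_1[EFin \o f].

Definition divergence (phi : 'rV[R]_d -> 'rV[R]_d) (x : 'rV[R]_d) : R :=
  \sum_(i < d) ('D_(delta_mx 0 i) phi x) 0 i.

(* Elements of C_c^1(D; R^d) whose pointwise Euclidean norm is at most 1 (the
   norm `|_| of row vectors is the sup norm, hence the explicit sum). *)
Definition TV_test (D : set 'rV[R]_d) : set ('rV[R]_d -> 'rV[R]_d) :=
  [set phi : 'rV[R]_d -> 'rV[R]_d |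
              [/\ (forall x, differentiable phi x),
                 (forall v, continuous ('D_v phi)),
                 (exists K : set 'rV[R]_d, [/\ compact K, K `<=` D &
                    forall x, ~ K x -> phi x = 0]) &
                 (forall x, \sum_(i < d) (phi x 0 i) ^+ 2 <= 1)]].

Definition TV (D : set 'rV[R]_d) w : \bar R :=
  ereal_sup [set (\int[mu]_x (w x * divergence phi x))%:E | phi in TV_test D].

Definition BV (D : set 'rV[R]_d) : set ('rV[R]_d -> R) :=
  [set w | w \in Lfun mu 1 /\ (TV D w < +oo)%E].

End measure_preliminaries.

(* U^* is represented by the bounded linear functionals U -> R. *)
Section dual_space.
Context {R : realType} {U : normedModType R}.

Definition dual_space : set (U -> R) :=
  [set phi | (forall (a : R) (u v : U), phi (a *: u + v) = a * phi u + phi v) /\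
             (exists M : R, forall v, `|phi v| <= M * `|v|)].

Definition dual_norm (phi : U -> R) : R :=
  sup [set `|phi v| | v in [set v : U | `|v| <= 1]].

Definition reflexive_normed : Prop :=
  forall Phi : (U -> R) -> R,
    (forall (a : R) phi psi, dual_space phi -> dual_space psi ->
       Phi (fun v => a * phi v + psi v) = a * Phi phi + Phi psi) ->
    (exists M : R, forall phi, dual_space phi -> `|Phi phi| <= M * dual_norm phi) ->
    exists u : U, forall phi, dual_space phi -> Phi phi = phi u.

Definition bounded_isomorphism (A : U -> U -> R) : Prop :=
  [/\ (forall (a : R) (u v : U), A (a *: u + v) = fun x => a * A u x + A v x),
      (forall u, dual_space (A u)),
      (exists M : R, forall u, dual_norm (A u) <= M * `|u|),
      (forall phi, dual_space phi -> exists! u, A u = phi) &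
      (exists M : R, forall u, `|u| <= M * dual_norm (A u))].

End dual_space.

(* Elements of H = L^2(Omega) are functions on R^d that are measurable and
   square integrable for the Lebesgue measure restricted to Omega; equality in H
   is equality almost everywhere. *)
Record ocp (R : realType) (d : nat) (U : completeNormedModType R) := Ocp {
  Omega : set 'rV[R]_d ;
  Omega_open : open Omega ;
  emb : U -> 'rV[R]_d -> R ;                   (* U -> H *)
  stateop : U -> U -> R ;                      (* A : U -> U^* *)
  rhs : U -> R ;                               (* f *)
  cost : U -> ('rV[R]_d -> R) -> R ;           (* j : U * H -> R *)
  alpha : R ;
  admissible : set ('rV[R]_d -> R) ;           (* C *)
  u_lo : 'rV[R]_d -> R ;
  u_up : 'rV[R]_d -> R ;
  w_lo : 'rV[R]_d -> R ;
  w_up : 'rV[R]_d -> R }.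

Record discretization (R : realType) (d : nat) := Discretization {
  mesh_size : R ;                              (* h *)
  ncells : nat ;                               (* N_h *)
  cell : 'I_ncells -> set 'rV[R]_d ;           (* Q_h^i *)
  cell_u_lo : 'I_ncells -> R ;
  cell_u_up : 'I_ncells -> R ;
  cell_w_lo : 'I_ncells -> R ;
  cell_w_up : 'I_ncells -> R ;
  TVh : ('rV[R]_d -> R) -> \bar R }.

Section optimization.
Context {X : Type} {R : realType} (F : set X) (J : X -> \bar R).

Definition optimal_value : \bar R := ereal_inf (J @` F).

Definition minimizer (x : X) : Prop := F x /\ forall y, F y -> (J x <= J y)%E.

End optimization.

Section problem.
Context {R : realType} {d : nat} {U : completeNormedModType R} (P : ocp d U).
Implicit Types (u v : U) (w g : 'rV[R]_d -> R).

Definition leb : {measure set 'rV[R]_d -> \bar R} :=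
  mrestr (lebesgue_rV R d) (open_measurable_rV (@Omega_open _ _ _ P)).

Local Notation C := (admissible P).
Local Notation A := (stateop P).
Local Notation f := (rhs P).
Local Notation L2 := (Lfun leb 2%:E).
Local Notation TV := (TV leb (Omega P)).
Local Notation BV := (BV leb (Omega P)).

(* A measurable function g is identified with the functional v |-> int g v. *)
Definition pairing g v : R := \int[leb]_x (g x * emb P v x).

Definition in_dual g : Prop :=
  [/\ measurable_fun [set: 'rV[R]_d] g,
      (forall v, leb.-integrable setT (EFin \o (g \* emb P v))) &
      dual_space (pairing g)].

Definition control_bounds w : Prop :=
  \forall x \ae leb, w_lo P x <= w x <= w_up P x.

Definition state_eq u w : Prop :=
  forall v, A u v + pairing (emb P u \* w) v = f v.

(* Injectivity of both arrows of U -> H ~ H^* -> U^* and compactness of the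
   first one; compactness of the second one follows by duality. *)
Definition compact_embedding : Prop :=
  [/\ (forall u, emb P u \in L2),
      (forall (a : R) u v, \forall x \ae leb,
         emb P (a *: u + v) x = a * emb P u x + emb P v x),
      (forall u, emb P u = cst 0 %[ae leb] -> u = 0),
      (forall u_ : nat -> U, (exists M, forall n, `|u_ n| <= M) ->
         exists s : nat -> nat, exists g,
           [/\ (forall m n, (m < n)%N -> (s m < s n)%N), g \in L2 &
               L2norm leb (emb P (u_ (s n)) \- g) @[n --> \oo] --> (0 : R)]) &
      (forall g, g \in L2 -> (forall v, pairing g v = 0) ->
         g = cst 0 %[ae leb])].

Definition lipschitz_on_bounded_sets : Prop :=
  forall M : R, exists L : R, forall u1 u2 w1 w2,
    w1 \in L2 -> w2 \in L2 ->
    `|u1| <= M -> `|u2| <= M -> L2norm leb w1 <= M -> L2norm leb w2 <= M ->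
    `|cost P u1 w1 - cost P u2 w2| <= L * (`|u1 - u2| + L2norm leb (w1 \- w2)).

Definition admissible_set : Prop :=
  [/\ C !=set0,
      (forall w, C w -> w \in L2),
      (exists M : R, forall w, C w -> L2norm leb w <= M),
      (forall (w_ : nat -> 'rV[R]_d -> R) w, (forall n, C (w_ n)) -> w \in L2 ->
         L2norm leb (w_ n \- w) @[n --> \oo] --> (0 : R) -> C w) &
      (forall w1 w2 (t : R), C w1 -> C w2 -> 0 <= t <= 1 ->
         C (fun x => t * w1 x + (1 - t) * w2 x))].

Record setting : Prop := Setting {
  Omega_domain : [/\ Omega P !=set0, connected (Omega P) & bounded_set (Omega P)] ;
  U_reflexive : @reflexive_normed R U ;
  U_embedding : compact_embedding ;
  A_isomorphism : bounded_isomorphism A ;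
  f_dual : dual_space f ;
  alpha_gt0 : 0 < alpha P ;
  cost_lipschitz : lipschitz_on_bounded_sets ;
  C_admissible : admissible_set ;
  product_dual : forall u w, BV w -> in_dual (emb P u \* w) ;
  state_unique : forall w, C w -> BV w -> exists! u, state_eq u w ;
  bounds_spaces : [/\ u_lo P \in L2, u_up P \in L2,
    w_lo P \in Lfun leb +oo%E & w_up P \in Lfun leb +oo%E] ;
  state_control_bounds : forall u w, BV w -> C w -> state_eq u w ->
    (\forall x \ae leb, u_lo P x <= emb P u x <= u_up P x) /\
    control_bounds w }.

Definition OCP_feasible : set (U * ('rV[R]_d -> R)) :=
  [set x | [/\ BV x.2, C x.2 & state_eq x.1 x.2]].

Definition OCP_objective (x : U * ('rV[R]_d -> R)) : \bar R :=
  ((cost P x.1 x.2)%:E + (alpha P)%:E * TV x.2)%E.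

Section discrete.
Variable D : discretization R d.
Local Notation N := (ncells D).
Local Notation Q := (@cell R d D).

(* An axis-parallel cube with edge length s; any part of its boundary may belong
   to it, so that an open set can be partitioned into cubes. *)
Definition is_cube (q : set 'rV[R]_d) (s : R) : Prop :=
  [/\ 0 < s, measurable q & exists a : 'rV[R]_d,
     [set x : 'rV[R]_d | forall i, a 0 i < x 0 i < a 0 i + s] `<=` q /\
     q `<=` [set x : 'rV[R]_d | forall i, a 0 i <= x 0 i <= a 0 i + s]].

Definition cube_partition : Prop :=
  [/\ trivIset setT Q, \bigcup_i Q i = Omega P &
      exists s : 'I_N -> R, [/\ (forall i, is_cube (Q i) (s i)),
        (forall i, s i <= mesh_size D) & (exists i, s i = mesh_size D)]].

Definition avg g (i : 'I_N) : R :=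
  (fine (leb (Q i)))^-1 * \int[leb]_(x in Q i) g x.

Definition step (c : 'rV[R]_N) : 'rV[R]_d -> R :=
  fun x => \sum_(i < N) c 0 i * \1_(Q i) x.

Definition Ph g : 'rV[R]_d -> R := step (\row_i avg g i).

Definition averaged_state_eq u w : Prop :=
  forall v, A u v + pairing (Ph (emb P u) \* Ph w) v = f v.

Definition TVh_approximation : Prop :=
  [/\ (forall w, w \in Lfun leb 1 -> (0 <= TVh D w)%E),
      (forall (w_ : nat -> 'rV[R]_d -> R) w,
         (forall n, w_ n \in Lfun leb 1) -> w \in Lfun leb 1 ->
         L1norm leb (w_ n \- w) @[n --> \oo] --> (0 : R) ->
         (TVh D w <= limn_einf (fun n => TVh D (w_ n)))%E),
      (forall w, w \in Lfun leb 1 -> (TVh D (Ph w) <= TV w)%E) &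
      (forall w, w \in Lfun leb 1 -> (TVh D (Ph w) <= TVh D w)%E)].

Record discrete_setting : Prop := DiscreteSetting {
  cells_partition : cube_partition ;
  averaged_state_unique : forall w, BV w -> control_bounds w ->
    exists! u, averaged_state_eq u w ;
  averaged_bounds : forall u w, C w -> control_bounds w ->
    averaged_state_eq u w -> forall i,
    cell_u_lo i <= avg (emb P u) i <= @cell_u_up _ _ D i /\
    cell_w_lo i <= avg w i <= @cell_w_up _ _ D i ;
  TVh_approx : TVh_approximation }.

(* The McCormick inequalities, c i being the value of the control on Q i. *)
Definition mccormick u (c z : 'rV[R]_N) : Prop := forall i : 'I_N,
  let ui := avg (emb P u) i in
  let ul := cell_u_lo i in let uu := cell_u_up i in
  let wl := cell_w_lo i in let wu := cell_w_up i in
  [/\ z 0 i >= ul * c 0 i + ui * wl - ul * wl,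
      z 0 i >= uu * c 0 i + ui * wu - uu * wu,
      z 0 i <= uu * c 0 i + ui * wl - uu * wl,
      z 0 i <= ul * c 0 i + ui * wu - ul * wu &
      ul <= ui <= uu].

Definition relaxed_state_eq u (z : 'rV[R]_N) : Prop :=
  forall v, A u v + pairing (step z) v = f v.

Definition McCh_feasible : set (U * ('rV[R]_d -> R) * 'rV[R]_N) :=
  [set x | let: (u, w, z) := x in
    [/\ C w, control_bounds w, relaxed_state_eq u z &
        mccormick u (\row_i avg w i) z]].

Definition McCh_objective (x : U * ('rV[R]_d -> R) * 'rV[R]_N) : \bar R :=
  let: (u, w, _) := x in ((cost P u w)%:E + (alpha P)%:E * TV w)%E.

Definition McChh_feasible : set (U * 'rV[R]_N * 'rV[R]_N) :=
  [set x | let: (u, c, z) := x in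
    [/\ C (step c), control_bounds (step c), relaxed_state_eq u z &
        mccormick u c z]].

Definition McChh_objective (x : U * 'rV[R]_N * 'rV[R]_N) : \bar R :=
  let: (u, c, _) := x in
  ((cost P u (step c))%:E + (alpha P)%:E * TVh D (step c))%E.

Definition McChh_states : set U :=
  [set u | exists c z, McChh_feasible (u, c, z)].

End discrete.

(* Lipschitz constants in one argument, uniform in the other one. The sign
   condition is needed since a singleton admits negative constants. *)
Definition lipschitz_snd (S : set U) (T : set ('rV[R]_d -> R)) (L : R) : Prop :=
  0 <= L /\ forall u w1 w2, S u -> T w1 -> T w2 ->
    `|cost P u w1 - cost P u w2| <= L * L2norm leb (w1 \- w2).

Definition lipschitz_fst (S : set U) (T : set ('rV[R]_d -> R)) (L : R) : Prop :=
  0 <= L /\ forall u1 u2 w, S u1 -> S u2 -> T w ->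
    `|cost P u1 w - cost P u2 w| <= L * `|u1 - u2|.

Definition projection_error (h : R) w : \bar R :=
  ('N[leb]_+oo[EFin \o (w_up P \- w_lo P)%R] `^ (2^-1)%R *
   (Num.sqrt (Num.sqrt d%:R))%:E * TV w `^ (2^-1)%R * (Num.sqrt h)%:E)%E.

End problem.

Arguments avg {R d U} P D g i.
Arguments step {R d} D c _.
Arguments mccormick {R d U} P D u c z.
Arguments relaxed_state_eq {R d U} P D u z.
Arguments McCh_objective {R d U} P D x.
Arguments McChh_objective {R d U} P D x.
Arguments McCh_feasible {R d U} P D _.
Arguments McChh_feasible {R d U} P D _.

(* Main.v *)
Require Import Defs.
From mathcomp Require Import all_boot all_order all_algebra.
From mathcomp Require Import all_classical all_reals all_analysis.
Import measurable_realfun.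
From mathcomp Require Import ring lra.
Set Implicit Arguments.
Unset Strict Implicit.
Unset Printing Implicit Defensive.
Import Order.TTheory GRing.Theory Num.Theory numFieldNormedType.Exports.
Local Open Scope classical_set_scope.
Local Open Scope ring_scope.


(** The two relaxations have the same McCormick constraints, in which the control
enters through its cell averages only. Their feasible points are therefore
exchanged by averaging a control and by reading cell values as a step function.
The average of an admissible control satisfies the pointwise bounds because step
functions on cubes have bounded variation ([BV_step]): the flux of a test field
through the faces of a cube is at most the perimeter of the cube
([cube_flux_le]).

For the two estimates of the optimal value, let [u] solve the averaged state
equation for the control [w]. The averages of [u] and [w] and their products form
a feasible point ([averaged_feasible]), and averaging does not increase the total
variation if [TV] is replaced by [TVh]. The optimal value thus exceeds the
objective at [(u, w)] by at most the Lipschitz constant times the norm in [L^2] of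
[w - Ph w] ([value_le_objective]), which is interpolated between the width of the
control bounds in [L^oo] and the estimate by [h * sqrt d * TV w] in [L^1]
([projection_L1_le]).

The latter is proved with this constant as follows. The function [F = w - Ph w] has
mean zero on every cell. If all boxes of a partition are halved in a coordinate
direction, then the sum over the boxes [B] of the absolute values of the integrals
of [F] over [B] grows at most by the sum of the differences of the integrals of [w]
over the two halves. These differences are limits of integrals of [w] against the
derivative of tent-shaped functions, whose height is at most half of the width of
the box, so that their sum is controlled by the variation of [w] in that direction
([halving_le]). Halving again and again in all directions, starting from boxes of
width [h], costs [h / 2 + h / 4 + ...] times the sum of the directional variations,
which is at most [sqrt d * TV w] ([sum_dvar_le]). Finally, the sums of the absolute
values of the integrals of [F] over finer and finer boxes recover its norm in [L^1]
([L1_le_sum_boxes]).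

A minimizer exists since the problem is finite-dimensional in essence: the state is
a Lipschitz continuous function of [z] ([relaxed_solution]), the control values are
bounded because [C] is bounded in [L^2], and then [z] is bounded by the McCormick
inequalities ([feasible_bounded]). Limits of feasible points are feasible
([feasible_limit]), the cost is Lipschitz continuous on the feasible set, and [TVh]
is lower semicontinuous ([McChh_minimizer]). *)

(** * Real-valued integrals *)

Section real_integrals.
Context d (T : measurableType d) (R : realType) (mu : {measure set T -> \bar R}).
Implicit Types (A B : set T) (f g : T -> R).

Lemma integrableST A f : measurable A ->
  mu.-integrable setT (EFin \o f) -> mu.-integrable A (EFin \o f).
Proof. by move=> mA; apply: integrableS. Qed.

Lemma Rintegral_null_setD A B f : measurable A -> measurable B ->
  mu.-integrable A (EFin \o f) -> B `<=` A -> mu (A `\` B) = 0%E ->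
  \int[mu]_(x in A) f x = \int[mu]_(x in B) f x.
Proof.
move=> mA mB fi BA AB0; congr fine.
rewrite (@negligible_integral _ _ _ mu A (A `\` B) (EFin \o f))//.
  by rewrite setDD setIC setIidl.
exact: measurableD.
Qed.

Lemma ae_eq_Rintegral A f g : measurable A ->
  measurable_fun setT f -> measurable_fun setT g ->
  (\forall x \ae mu, f x = g x) ->
  \int[mu]_(x in A) f x = \int[mu]_(x in A) g x.
Proof.
move=> mA mf mg fg; congr fine; apply: ae_eq_integral => //.
- exact/measurable_EFinP/measurable_funTS.
- exact/measurable_EFinP/measurable_funTS.
- by apply: filterS fg => x /= -> _.
Qed.

Lemma ae_ge0_le_Rintegral f g :
  mu.-integrable setT (EFin \o f) -> mu.-integrable setT (EFin \o g) ->
  (forall x, 0 <= f x) -> (\forall x \ae mu, f x <= g x) ->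
  \int[mu]_x f x <= \int[mu]_x g x.
Proof.
move=> fi gi f0 fg.
have mf := measurable_int _ fi; have mg := measurable_int _ gi.
have g0 : \int[mu]_x g x = \int[mu]_x (Num.max 0 (g x)).
  apply: ae_eq_Rintegral => //; first exact/measurable_EFinP.
    by apply: measurable_maxr => //; exact/measurable_EFinP.
  by apply: filterS fg => x fgx; rewrite (max_idPr _)// (le_trans _ fgx).
have mi : mu.-integrable setT (EFin \o (fun x => Num.max 0 (g x))).
  apply: (le_integrable measurableT) gi => //.
    by apply/measurable_EFinP; apply: measurable_maxr => //; exact/measurable_EFinP.
  move=> x _ /=; rewrite lee_fin ger0_norm ?le_max ?lexx//.
  by rewrite ge_max normr_ge0 ler_norm.
rewrite g0 /Rintegral fine_le//; first exact: integrable_fin_num.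
  exact: integrable_fin_num.
apply: ae_ge0_le_integral => //.
- by move=> x _; rewrite lee_fin.
- by move=> x _; rewrite lee_fin le_max lexx.
- exact: measurable_int mi.
- by apply: filterS fg => x fgx _; rewrite lee_fin le_max fgx orbT.
Qed.

Lemma integrable_bounded_mul f g (M : R) :
  mu.-integrable setT (EFin \o f) -> measurable_fun setT g ->
  (forall x, `|g x| <= M) -> mu.-integrable setT (EFin \o (fun x => f x * g x)).
Proof.
move=> fi mg gM.
have mf : measurable_fun setT f.
  by apply/measurable_EFinP; exact: measurable_int fi.
have Mi : mu.-integrable setT (fun x => M%:E * (`|f x|)%:E)%E.
  apply: integrableZl => //.
  exact: (integrable_norm fi).
apply: (le_integrable measurableT) Mi => //.
  by apply/measurable_EFinP; exact: measurable_funM.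
move=> x _ /=; rewrite lee_fin !normrM mulrC normr_id ler_wpM2r//.
by rewrite (le_trans (gM x))// ler_norm.
Qed.

Lemma integrableZl_EFin A k f : measurable A -> mu.-integrable A (EFin \o f) ->
  mu.-integrable A (EFin \o (fun x => k * f x)).
Proof. by move=> mA /(integrableZl mA k); apply: eq_integrable => // x _ /=. Qed.

Lemma integrable_indic_lty A : measurable A -> (mu A < +oo)%E ->
  mu.-integrable setT (EFin \o (\1_A : T -> R)).
Proof.
move=> mA Afin; apply/integrableP; split.
  by apply/measurable_EFinP; exact: measurable_indic.
under eq_integral do rewrite /= normr_nat.
by rewrite integral_indic// setIT.
Qed.

Lemma integrable_mul_indic A f : measurable A -> mu.-integrable A (EFin \o f) ->
  mu.-integrable setT (EFin \o (fun x => f x * \1_A x)).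
Proof.
move=> mA /(integrable_mkcond _ mA); apply: eq_integrable => // x _ /=.
by rewrite patchE indicE; case: ifPn => _; rewrite ?mulr1 ?mulr0.
Qed.

Lemma integrableB_EFin A f g : measurable A -> mu.-integrable A (EFin \o f) ->
  mu.-integrable A (EFin \o g) -> mu.-integrable A (EFin \o (fun x => f x - g x)).
Proof.
by move=> mA fi gi; have := integrableB mA fi gi; apply: eq_integrable => // x _ /=.
Qed.

Lemma integrableD_EFin A f g : measurable A -> mu.-integrable A (EFin \o f) ->
  mu.-integrable A (EFin \o g) -> mu.-integrable A (EFin \o (fun x => f x + g x)).
Proof.
by move=> mA fi gi; have := integrableD mA fi gi; apply: eq_integrable => // x _ /=.
Qed.

Lemma Rintegral_dominated_cvg (f_ : nat -> T -> R) f g :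
  (forall n, measurable_fun setT (f_ n)) -> measurable_fun setT f ->
  (forall x, f_ n x @[n --> \oo] --> f x) ->
  mu.-integrable setT (EFin \o g) -> (forall n x, `|f_ n x| <= g x) ->
  \int[mu]_x f_ n x @[n --> \oo] --> \int[mu]_x f x.
Proof.
move=> mf_ mf cf gi fg.
have [] := @dominated_convergence _ _ _ mu setT measurableT
  (fun n => EFin \o f_ n) (EFin \o f) (EFin \o g).
- by move=> n; apply/measurable_EFinP; exact: mf_.
- exact/measurable_EFinP.
- by apply/nearW => x _; apply/cvg_EFin; [exact: nearW|exact: cf].
- exact: gi.
- by apply/nearW => x n _; rewrite lee_fin.
move=> fi _ cv; apply: fine_cvg.
rewrite fineK; last exact: integrable_fin_num.
exact: cv.
Qed.

Lemma Rintegral_sum (I : Type) (s : seq I) (F : I -> T -> R) A : measurable A ->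
  (forall i, mu.-integrable A (EFin \o F i)) ->
  \int[mu]_(x in A) (\sum_(i <- s) F i x) = \sum_(i <- s) \int[mu]_(x in A) F i x.
Proof.
move=> mA Fi; elim: s => [|i s IH].
  rewrite big_nil; under eq_Rintegral do rewrite big_nil.
  by rewrite Rintegral_cst// mul0r.
rewrite big_cons -IH -RintegralD//; last first.
  have := @integrable_sum _ _ _ mu _ mA I s xpredT (fun i => EFin \o F i).
  move=> /(_ (fun i _ => Fi i)); apply: eq_integrable => // x _ /=.
  by rewrite sumEFin.
by apply: eq_Rintegral => x _; rewrite big_cons.
Qed.

Lemma Rintegral_indicM A f :  measurable A ->
  \int[mu]_x (f x * \1_A x) = \int[mu]_(x in A) f x.
Proof.
move=> mA; rewrite [RHS]Rintegral_mkcond; apply: eq_Rintegral => x _.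
rewrite patchE indicE; case: ifPn => xA; first by rewrite mulr1.
by rewrite mulr0.
Qed.

End real_integrals.

(** * Boxes and Lebesgue measure on row vectors *)

Section boxes.
Context {R : realType}.

Definition cbox n (a b : 'rV[R]_n) : set 'rV[R]_n :=
  [set x | forall i, a 0 i <= x 0 i <= b 0 i].
Definition obox n (a b : 'rV[R]_n) : set 'rV[R]_n :=
  [set x | forall i, a 0 i < x 0 i < b 0 i].
Definition hbox n (a b : 'rV[R]_n) : set 'rV[R]_n :=
  [set x | forall i, a 0 i <= x 0 i < b 0 i].

Lemma coord_le_norm n (x : 'rV[R]_n) i : `|x 0 i| <= `|x|.
Proof.
change (`|x 0 i| <= mx_norm x); rewrite mx_normrE.
exact: (le_bigmax _ (fun ij => `|x ij.1 ij.2|) (0, i)).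
Qed.

Lemma measurable_coord_preimage n (i : 'I_n) (I : interval R) :
  measurable [set x : 'rV[R]_n | x 0 i \in I].
Proof.
rewrite -[X in measurable X]setTI.
exact: (@measurable_coord R n i measurableT [set` I] (measurable_itv I)).
Qed.

Lemma measurable_forall_coord n (I : 'I_n -> interval R) :
  measurable [set x : 'rV[R]_n | forall i, x 0 i \in I i].
Proof.
rewrite (_ : [set x | _] =
    \bigcap_(i in [set: 'I_n]) [set x : 'rV[R]_n | x 0 i \in I i]).
  apply: fin_bigcap_measurable => // i _.
  exact: measurable_coord_preimage.
by apply/seteqP; split=> [x /= xI i _|x /= xI i]; [exact: xI|exact: xI].
Qed.

Lemma measurable_cbox n (a b : 'rV[R]_n) : measurable (cbox a b).
Proof. exact: measurable_rV_box. Qed.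

Lemma measurable_obox n (a b : 'rV[R]_n) : measurable (obox a b).
Proof.
rewrite (_ : obox a b = [set x | forall i, x 0 i \in `]a 0 i, b 0 i[]).
  exact: measurable_forall_coord.
by apply/seteqP; split=> x /= xI i; have := xI i; rewrite in_itv.
Qed.

Lemma measurable_hbox n (a b : 'rV[R]_n) : measurable (hbox a b).
Proof.
rewrite (_ : hbox a b = [set x | forall i, x 0 i \in `[a 0 i, b 0 i[]).
  exact: measurable_forall_coord.
by apply/seteqP; split=> x /= xI i; have := xI i; rewrite in_itv.
Qed.

Lemma sub_obox_hbox n (a b : 'rV[R]_n) : obox a b `<=` hbox a b.
Proof. by move=> x xab i; have /andP[/ltW -> ->] := xab i. Qed.

Lemma sub_hbox_cbox n (a b : 'rV[R]_n) : hbox a b `<=` cbox a b.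
Proof. by move=> x xab i; have /andP[-> /ltW ->] := xab i. Qed.

Lemma sub_obox_cbox n (a b : 'rV[R]_n) : obox a b `<=` cbox a b.
Proof. exact: subset_trans (@sub_obox_hbox _ _ _) (@sub_hbox_cbox _ _ _). Qed.

Lemma hyperplane_null n (i : 'I_n) (c : R) :
  lebesgue_rV R n [set x | x 0 i = c] = 0%E.
Proof.
pose a k : 'rV[R]_n := \row_j if j == i then c else - k%:R.
pose b k : 'rV[R]_n := \row_j if j == i then c else k%:R.
have ab k j : a k 0 j <= b k 0 j.
  rewrite !mxE; case: ifP => // _.
  by rewrite (@le_trans _ _ 0)// oppr_le0.
have box0 k : lebesgue_rV R n (cbox (a k) (b k)) = 0%E.
  rewrite lebesgue_rV_box// (bigD1 i)//= !mxE eqxx subrr mul0r//.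
rewrite [X in lebesgue_rV R n X](_ : _ = \bigcup_k cbox (a k) (b k)); last first.
  apply/seteqP; split=> [x /= xc|x [k _ /(_ i)]]; last first.
    by rewrite !mxE eqxx -eq_le => /eqP/esym.
  have [k xk] : exists k, `|x| < k%:R.
    by exists (Num.bound `|x|); exact: archi_boundP.
  exists k => // j; rewrite !mxE; case: eqP => [->|_]; first by rewrite xc lexx.
  by rewrite -ler_norml (le_trans _ (ltW xk))// coord_le_norm.
apply/eqP; rewrite eq_le measure_ge0 andbT.
have mB k : measurable (cbox (a k) (b k)) by exact: measurable_cbox.
apply: le_trans (measure_sigma_subadditive (lebesgue_rV R n) mB _ _) _ => //.
  exact: bigcup_measurable.
by rewrite eseries0// => k _ _; exact: box0.
Qed.

(** The faces of a box lie in finitely many hyperplanes, each of them a countable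
union of degenerate boxes. *)
Lemma boundary_box_null n (a b : 'rV[R]_n) A : measurable A ->
  A `<=` cbox a b `\` obox a b -> lebesgue_rV R n A = 0%E.
Proof.
move=> mA Aab.
pose H i c : set 'rV[R]_n := [set x | x 0 i = c].
have mH i c : measurable (H i c).
  rewrite (_ : H i c = [set x | x 0 i \in `[c, c]]).
    exact: measurable_coord_preimage.
  apply/seteqP; split=> x; rewrite /H /= in_itv/= -eq_le; first by move=> ->.
  by move/eqP.
pose S := \big[setU/set0]_(i < n) (H i (a 0 i) `|` H i (b 0 i)).
have [mS S0] : measurable S /\ lebesgue_rV R n S = 0%E.
  apply: (big_ind (fun X => measurable X /\ lebesgue_rV R n X = 0%E)) => //.
    by move=> X Y [mX X0] [mY Y0]; split; [exact: measurableU|exact: null_set_setU].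
  move=> i _; split; first exact: measurableU.
  by apply: null_set_setU => //; exact: hyperplane_null.
apply/eqP; rewrite eq_le measure_ge0 andbT -S0.
apply: le_measure; rewrite ?inE//.
move=> x /Aab[xc xo]; rewrite /S -bigcup_seq.
apply: contrapT => xS; apply: xo => i.
have /andP[ax xb] := xc i.
rewrite !lt_neqAle ax xb !andbT; apply/andP; split; apply/eqP => e; apply: xS;
  exists i; rewrite /= ?mem_index_enum//; by [left|right].
Qed.

(** It does not matter for integrals which part of its boundary belongs to a cell,
and half-open boxes, which can be halved without overlap or loss, may replace
cells. *)
Lemma Rintegral_box_eq n (mu : {measure set 'rV[R]_n -> \bar R}) (a b : 'rV[R]_n)
    A B (f : 'rV[R]_n -> R) :
  (forall X, measurable X -> lebesgue_rV R n X = 0%E -> mu X = 0%E) ->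
  measurable A -> measurable B -> mu.-integrable (cbox a b) (EFin \o f) ->
  obox a b `<=` A -> A `<=` cbox a b -> obox a b `<=` B -> B `<=` cbox a b ->
  \int[mu]_(x in A) f x = \int[mu]_(x in B) f x.
Proof.
move=> mu0 mA mB fi oA Ac oB Bc.
have mo := measurable_obox a b.
have E X : measurable X -> obox a b `<=` X -> X `<=` cbox a b ->
    \int[mu]_(x in X) f x = \int[mu]_(x in obox a b) f x.
  move=> mX oX Xc; apply: Rintegral_null_setD => //.
    by apply: integrableS fi => //; exact: measurable_cbox.
  apply: mu0; first exact: measurableD.
  apply: (@boundary_box_null _ a b); first exact: measurableD.
  by move=> x [Xx ox]; split=> //; exact: Xc.
by rewrite !E.
Qed.

End boxes.

(** * Translation invariance *)

Section translation.
Context {R : realType}.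

(** Closed boxes are stable under intersection, so that two measures that agree on
them are equal. An open ball of the supremum norm is a countable union of
closed boxes, and an open set is a countable union of such balls. *)
Lemma cbox_generates n :
  @measurable _ 'rV[R]_n = <<s [set A | exists a b : 'rV[R]_n, A = cbox a b] >>.
Proof.
apply/seteqP; split=> A; last first.
  apply: smallest_sub; first exact: sigma_algebra_measurable.
  by move=> _ [a [b ->]]; exact: measurable_cbox.
set G := [set A | _].
apply: smallest_sub; first exact: smallest_sigma_algebra.
move=> O oO; rewrite (open_rV_bigcup oO) bigcup_mkcond.
have -> (I : countType) (F : I -> set 'rV[R]_n) : \bigcup_i F i =
    \bigcup_k (if unpickle k is Some i then F i else set0).
  apply/seteqP; split=> [x [i _ Fix]|x [k _]].
    by exists (pickle i) => //; rewrite pickleK.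
  by case: unpickle => // i Fix; exists i.
apply: sigma_algebra_bigcup => k.
case: unpickle => [[q m]|]; last exact: sigma_algebra0.
case: ifPn => _; last exact: sigma_algebra0.
move: (map_mx _ _) => c; set r := _^-1.
have r0 : 0 < r by rewrite invr_gt0.
rewrite [X in <<s G >> X](_ : _ =
    \bigcup_j cbox (\row_i (c 0 i - r + j.+1%:R^-1)) (\row_i (c 0 i + r - j.+1%:R^-1))).
  apply: sigma_algebra_bigcup => j; apply: sub_sigma_algebra.
  by exists (\row_i (c 0 i - r + j.+1%:R^-1)), (\row_i (c 0 i + r - j.+1%:R^-1)).
apply/seteqP; split=> x; last first.
  move=> [j _ xj]; split=> // i0 i; rewrite ord1 /ball/=.
  have := xj i; rewrite !mxE; have : 0 < j.+1%:R^-1 :> R by rewrite invr_gt0.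
  set e := _^-1 => e0 /andP[? ?]; rewrite distrC ltr_distl; apply/andP; split; lra.
move=> [_ xc].
have [j jx] : exists j : nat, forall i : 'I_n, `|c 0 i - x 0 i| + j.+1%:R^-1 <= r.
  have [s s0 sr] : exists2 s, 0 < s & forall i : 'I_n, `|c 0 i - x 0 i| + s <= r.
    pose s := \big[Num.min/r]_(i < n) (r - `|c 0 i - x 0 i|).
    exists s => [|i].
      rewrite /s; apply: (big_ind (fun y => 0 < y)) => //; first by move=> ? ? ? ?; rewrite lt_min; apply/andP.
      by move=> i _; rewrite subr_gt0; exact: (xc 0 i).
    by rewrite -lerBrDl; rewrite /s; exact: (bigmin_le r i (fun i => r - `|c 0 i - x 0 i|)).
  have [j] := @ltr_add_invr R 0 s s0; rewrite add0r => js.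
  by exists j => i; rewrite (le_trans _ (sr i))// lerD2l ltW.
exists j => // i; rewrite !mxE; have := jx i; have := ler_norm (c 0 i - x 0 i).
have := ler_norm (- (c 0 i - x 0 i)); rewrite normrN.
move: (j.+1%:R^-1) `|c 0 i - x 0 i| => e N ? ? ?.
by apply/andP; split; lra.
Qed.

Lemma measurable_shift n (v : 'rV[R]_n) :
  measurable_fun setT (fun x : 'rV[R]_n => x + v).
Proof.
apply: measurable_rV => i; under eq_fun do rewrite mxE.
by apply: measurable_funD => //; exact: measurable_coord.
Qed.

(** Both sides are measures in [A] that agree on closed boxes. *)
Lemma lebesgue_rV_shift n (v : 'rV[R]_n) A : measurable A ->
  lebesgue_rV R n [set x | A (x + v)] = lebesgue_rV R n A.
Proof.
pose m2 := measure_function_pushforward__canonical__measure_function_Measure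
    (lebesgue_rV R n) (measurable_shift v).
move=> mA; apply/esym.
pose G := [set A | exists a b : 'rV[R]_n, A = cbox a b].
pose g (k : nat) : set 'rV[R]_n := cbox (const_mx (- k%:R)) (const_mx k%:R).
have gfin k : (lebesgue_rV R n (g k) < +oo)%E.
  rewrite lebesgue_rV_box ?ltry// => i; rewrite !mxE.
  by rewrite (@le_trans _ _ 0)// oppr_le0.
apply: (@measure_unique _ _ _ G g _ _ _ _ (lebesgue_rV R n) m2 _ _ A mA).
- exact: cbox_generates.
- move=> _ _ [a1 [b1 ->]] [a2 [b2 ->]].
  exists (\row_i Num.max (a1 0 i) (a2 0 i)), (\row_i Num.min (b1 0 i) (b2 0 i)).
  apply/seteqP; split=> [x [x1 x2] i|x x12].
    by rewrite !mxE ge_max le_min; have /andP[-> ->] := x1 i; have /andP[-> ->] := x2 i.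
  by split=> i; have := x12 i; rewrite !mxE ge_max le_min => /andP[/andP[? ?] /andP[? ?]];
    apply/andP.
- by move=> k; exists (const_mx (- k%:R)), (const_mx k%:R).
- rewrite -subTset => x _; exists (Num.bound `|x|) => // i; rewrite !mxE -ler_norml.
  by rewrite (le_trans (coord_le_norm _ _))// ltW// archi_boundP.
- move=> _ [a [b ->]]; rewrite /m2 /= /pushforward.
  rewrite [X in _ = lebesgue_rV R n X](_ : _ = cbox (a - v) (b - v)); last first.
    by apply/seteqP; split=> x /= xab i; have := xab i;
      rewrite !mxE lerBlDr lerBrDr.
  have [ab|/existsNP[i /negP]] := pselect (forall i, a 0 i <= b 0 i).
    rewrite !lebesgue_rV_box//; last by move=> i; rewrite !mxE lerD2r.
    by congr EFin; apply: eq_bigr => i _; rewrite !mxE; ring.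
  rewrite -ltNge => ba.
  have -> : cbox a b = set0.
    by apply/seteqP; split=> // x /(_ i) /andP[? ?]; exfalso; lra.
  have -> : cbox (a - v) (b - v) = set0.
    by apply/seteqP; split=> // x /(_ i); rewrite !mxE => /andP[? ?]; exfalso; lra.
  by rewrite !measure0.
- move=> k; exact: (gfin k).
Qed.

End translation.

(** * Step functions have bounded variation *)

Section directional_derivative.
Context {R : realType}.

Lemma is_derive_line (V : normedModType R) (f : V -> R) (x v : V) (r df : R) :
  is_derive (x + r *: v) v f df -> is_derive r (1 : R) (fun t => f (x + t *: v)) df.
Proof.
have E : (fun h : R => h^-1 *: (((fun t => f (x + t *: v)) \o shift r) (h *: 1)
            - f (x + r *: v))) =
    (fun h : R => h^-1 *: ((f \o shift (x + r *: v)) (h *: v) - f (x + r *: v))).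
  apply/funext => h /=; congr (_ *: (f _ - _)).
  by rewrite [h *: 1]mulr1 scalerDl [RHS]addrC -addrA [r *: v + _]addrC.
case=> D1 D2; split; first by move: D1; rewrite /derivable E.
by rewrite -D2 /derive E.
Qed.

Lemma increment_le (V : normedModType R) (f df : V -> R) (x v : V) (t M : R) :
  (forall y, is_derive y v f (df y)) -> 0 <= t ->
  (forall r, 0 <= r <= t -> `|df (x + r *: v)| <= M) ->
  `|f (x + t *: v) - f x| <= M * t.
Proof.
move=> fd t0 dM.
have gd r : is_derive r (1 : R) (fun t => f (x + t *: v)) (df (x + r *: v)).
  exact: is_derive_line.
have gc : {within `[0, t], continuous (fun t => f (x + t *: v))}.
  apply: derivable_within_continuous => r _.
  by have [] := gd r.
have [c c0t] := MVT_segment t0 (fun r _ => gd r) gc.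
rewrite scale0r addr0 subr0 => ->; rewrite normrM (ger0_norm t0) ler_wpM2r//.
by apply: dM; move: c0t; rewrite in_itv.
Qed.

Lemma continuous_measurable_rV n (f : 'rV[R]_n -> R) :
  continuous f -> measurable_fun setT f.
Proof.
move=> cf; apply: (measurability _ (measurable_realfun.RGenOpens.measurableE R)).
move=> _ [_ [a [b ->] <-]]; rewrite setTI; apply: open_measurable_rV.
by apply: open_comp; [move=> x _; exact: cf|exact: interval_open].
Qed.

Lemma compact_cbox n (a b : 'rV[R]_n) : compact (cbox a b).
Proof.
rewrite (_ : cbox a b = [set v | forall i, `[a ord0 i, b ord0 i]%classic (v ord0 i)]).
  exact: (@rV_compact R n (fun i => `[a ord0 i, b ord0 i]%classic)
    (fun i => @segment_compact R _ _)).
by apply/seteqP; split=> x /= xab i; have := xab i; rewrite /= in_itv.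
Qed.

Lemma continuous_bounded_cbox n (f : 'rV[R]_n -> R) (a b : 'rV[R]_n) :
  continuous f -> exists M, forall x, cbox a b x -> `|f x| <= M.
Proof.
move=> cf.
have /compact_bounded[M [_ /(_ (M + 1))]] : compact (f @` cbox a b).
  by apply: continuous_compact; [exact: continuous_subspaceT|exact: compact_cbox].
rewrite ltrDl ltr01 => /(_ isT) fM; exists (M + 1) => x xab.
by apply: fM; exists x.
Qed.

End directional_derivative.

Section flux.
Context {R : realType} {n : nat}.
Local Notation lam := (lebesgue_rV R n).
Local Notation e i := (delta_mx 0 i : 'rV[R]_n).

Lemma cbox_fin_num (a b : 'rV[R]_n) : lam (cbox a b) \is a fin_num.
Proof.
have [ab|/existsNP[i /negP]] := pselect (forall i, a 0 i <= b 0 i).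
  by rewrite lebesgue_rV_box.
rewrite -ltNge => ba; rewrite (_ : cbox a b = set0) ?measure0//.
by apply/seteqP; split=> // x /(_ i) /andP[? ?]; exfalso; lra.
Qed.

Lemma Rintegral_shift (v : 'rV[R]_n) A (f : 'rV[R]_n -> R) : measurable A ->
  measurable_fun setT f ->
  lam.-integrable [set x | A (x + v)] (EFin \o (fun x => f (x + v))) ->
  \int[lam]_(x in [set x | A (x + v)]) f (x + v) = \int[lam]_(x in A) f x.
Proof.
move=> mA mf fi; congr fine.
have mS := measurable_shift v.
have <- := @integral_pushforward _ _ _ _ R _ mS lam A (EFin \o f) _ fi mA.
  apply: eq_measure_integral => X mX _.
  exact: lebesgue_rV_shift.
exact/measurable_EFinP.
Qed.

Lemma bounded_integrable A (f : 'rV[R]_n -> R) M : measurable A ->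
  (lam A < +oo)%E -> measurable_fun setT f -> (forall x, A x -> `|f x| <= M) ->
  lam.-integrable A (EFin \o f).
Proof.
move=> mA Afin mf fM; apply: measurable_bounded_integrable => //.
  exact: measurable_funTS.
exists M; split; first exact: num_real.
by move=> r r1 x Ax /=; exact: le_trans (fM x Ax) (ltW r1).
Qed.

Lemma normr_Rintegral_le A B (f : 'rV[R]_n -> R) (c : R) : measurable A ->
  measurable B -> A `<=` B -> lam B = c%:E -> measurable_fun setT f ->
  (forall x, `|f x| <= 1) -> `|\int[lam]_(x in A) f x| <= c.
Proof.
move=> mA mB AB Bc mf f1.
have Afin : (lam A < +oo)%E.
  by rewrite (@le_lt_trans _ _ (lam B)) ?Bc ?ltry// -Bc le_measure// inE.
have fi : lam.-integrable A (EFin \o f) by apply: (@bounded_integrable _ _ 1).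
rewrite (le_trans (le_normr_Rintegral mA fi))//.
apply: (@le_trans _ _ (\int[lam]_(x in A) 1)).
  apply: le_Rintegral => //; first exact: (integrable_norm fi).
  by apply: (@bounded_integrable _ _ 1) => // x _; rewrite normr1.
rewrite Rintegral_cst// mul1r -lee_fin fineK ?ge0_fin_numE// -Bc.
by rewrite le_measure// inE.
Qed.

(** The integral is the flux through the two faces of the cube that are
orthogonal to the direction [i]. It is the limit of the integrals of difference
quotients: the translates of the cube in that direction differ from the
cube by two thin slabs. *)
Lemma cube_flux_le (a : 'rV[R]_n) (s : R) (i : 'I_n) (f df : 'rV[R]_n -> R) :
  0 < s -> (forall y, is_derive y (e i) f (df y)) -> continuous f -> continuous df ->
  (forall x, `|f x| <= 1) ->
  `|\int[lam]_(x in cbox a (a + const_mx s)) df x| <= 2 * \prod_(j < n | j != i) s.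
Proof.
move=> s0 fd cf cdf f1.
set B := cbox a _; set K := \prod_(j < n | _) s.
have mB : measurable B by exact: measurable_cbox.
have mf : measurable_fun setT f by exact: continuous_measurable_rV.
have mdf : measurable_fun setT df by exact: continuous_measurable_rV.
pose t k : R := k.+1%:R^-1.
have t0 k : 0 < t k by rewrite invr_gt0.
have t1 k : t k <= 1 by rewrite invf_le1// ler1n.
have cvt : t k @[k --> \oo] --> (0 : R) by exact: cvg_harmonic.
pose q k (x : 'rV[R]_n) := (t k)^-1 * (f (x + t k *: e i) - f x).
have [M dM] := continuous_bounded_cbox a (a + const_mx (s + 1)) cdf.
have mft k : measurable_fun setT (fun x : 'rV[R]_n => f (x + t k *: e i)).
  by apply: (measurableT_comp mf); exact: measurable_shift.
have qB k x : B x -> `|q k x| <= M.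
  move=> Bx; rewrite normrM ger0_norm ?invr_ge0 ?(ltW (t0 k))//  ler_pdivrMl//.
  rewrite mulrC; apply: increment_le fd (ltW (t0 k)) _ => r /andP[r0 rt].
  apply: dM => j; have := Bx j; rewrite !mxE eqxx/= => /andP[ax xs].
  case: (j == i) => /=; rewrite ?mulr1 ?mulr0; have := t1 k; lra.
have cvq x : q k x @[k --> \oo] --> df x.
  have [/cvg_ex[l dl] dE] := fd x.
  have -> : df x = l by rewrite -dE; exact: cvg_lim.
  have cv0 : t k @[k --> \oo] --> 0^'.
    move=> A /= /cvt [N _ AN]; exists N => // k Nk /=.
    by apply: (AN k Nk); rewrite /= gt_eqF.
  have := cvg_comp _ _ cv0 dl; apply: cvg_trans.
  by apply: near_eq_cvg; apply: nearW => k /=; rewrite /q [t k *: e i + x]addrC.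
have cvI : \int[lam]_x (q k x * \1_B x) @[k --> \oo] --> \int[lam]_x (df x * \1_B x).
  apply: (@Rintegral_dominated_cvg _ _ _ _ _ _ (fun x => `|M| * \1_B x)).
  - move=> k; apply: measurable_funM; last exact: measurable_indic.
    by apply: measurable_funM => //; exact: measurable_funB.
  - by apply: measurable_funM => //; exact: measurable_indic.
  - by move=> x; apply: cvgMl; exact: cvq.
  - apply: integrableZl_EFin => //.
    by apply: integrable_indic_lty => //; rewrite -ge0_fin_numE//; exact: cbox_fin_num.
  - move=> k x; rewrite normrM indicE; case: (boolP (x \in B)) => xB.
      by rewrite normr1 !mulr1 (le_trans (qB k x _)) ?ler_norm//; exact: set_mem.
    by rewrite normr0 !mulr0.
rewrite -(Rintegral_indicM lam df mB).
have cvN : `|\int[lam]_x (q k x * \1_B x)| @[k --> \oo] --> `|\int[lam]_x (df x * \1_B x)|.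
  exact: cvg_norm.
rewrite -(cvg_lim _ cvN)//; apply: limr_le; first by apply/cvg_ex; eexists; exact: cvN.
apply: nearW => k; rewrite Rintegral_indicM//.
pose Bt : set 'rV[R]_n := [set x | B (x - t k *: e i)].
have mBt : measurable Bt.
  by rewrite -[Bt]setTI; exact: (measurable_shift (- (t k *: e i)) measurableT mB).
pose S0 := cbox a (\row_j (a 0 j + if j == i then t k else s)).
pose S1 := cbox (\row_j (a 0 j + if j == i then s else 0))
  (\row_j (a 0 j + if j == i then s + t k else s)).
have slab (u v : 'rV[R]_n) : (forall j, v 0 j - u 0 j = if j == i then t k else s) ->
    lam (cbox u v) = (t k * K)%:E.
  move=> uv; rewrite lebesgue_rV_box; last first.
    by move=> j; rewrite -subr_ge0 uv; case: ifP => _; rewrite ltW.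
  rewrite (bigD1 i)//= uv eqxx; congr (_ * _)%:E.
  by apply: eq_bigr => j /negbTE ji; rewrite uv ji.
have S0E : lam S0 = (t k * K)%:E by apply: slab => j; rewrite !mxE; ring.
have S1E : lam S1 = (t k * K)%:E.
  by apply: slab => j; rewrite !mxE; case: ifP => _; ring.
have BtB : Bt `\` B `<=` S1.
  move=> x [Btx Bx] j; rewrite !mxE.
  have := Btx j; rewrite !mxE eqxx/=; have [->|ji] := eqVneq j i; last first.
    by rewrite mulr0 subr0 addr0.
  rewrite mulr1 => /andP[ax xs]; apply/andP; split; last lra.
  rewrite leNgt; apply/negP => xas; apply: Bx => l; rewrite !mxE.
  have := Btx l; rewrite !mxE eqxx/=; have [->|li] := eqVneq l i; last first.
    by rewrite mulr0 subr0.
  by rewrite mulr1 => _; have := t0 k; move=> ?; apply/andP; split; lra.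
have BBt : B `\` Bt `<=` S0.
  move=> x [Bx Btx] j; rewrite !mxE.
  have := Bx j; rewrite !mxE; have [->|ji] := eqVneq j i; last by [].
  move=> /andP[ax xs]; apply/andP; split => //.
  rewrite leNgt; apply/negP => xas; apply: Btx => l; rewrite !mxE eqxx/=.
  have := Bx l; rewrite !mxE; have [->|li] := eqVneq l i; last first.
    by rewrite mulr0 subr0.
  by rewrite mulr1 => _; have := t0 k; move=> ?; apply/andP; split; lra.
have Bfin : (lam B < +oo)%E by rewrite -ge0_fin_numE//; exact: cbox_fin_num.
have fBi : lam.-integrable B (EFin \o f) by apply: (@bounded_integrable _ _ 1).
have ftBi : lam.-integrable B (EFin \o (fun x => f (x + t k *: e i))).
  by apply: (@bounded_integrable _ _ 1).
have BE : B = [set x | Bt (x + t k *: e i)].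
  by apply/funext => x; rewrite /Bt /= addrK.
have shiftE : \int[lam]_(x in B) f (x + t k *: e i) = \int[lam]_(x in Bt) f x.
  by rewrite [in LHS]BE Rintegral_shift// -BE.
have Btfin : (lam Bt < +oo)%E by rewrite -(lebesgue_rV_shift (t k *: e i) mBt) -BE.
have fBti : lam.-integrable Bt (EFin \o f) by apply: (@bounded_integrable _ _ 1).
have splitI (X Y : set 'rV[R]_n) : measurable X -> measurable Y ->
    lam.-integrable X (EFin \o f) -> \int[lam]_(x in X) f x =
    \int[lam]_(x in X `&` Y) f x + \int[lam]_(x in X `\` Y) f x.
  move=> mX mY Xi; rewrite -Rintegral_setU.
  - by rewrite setUIDK.
  - exact: measurableI.
  - exact: measurableD.
  - by rewrite setUIDK.
  - apply/disj_setPS => x [[_ ?] []] //.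
rewrite RintegralZl//; last exact: integrableB_EFin.
rewrite RintegralB// shiftE normrM ger0_norm ?invr_ge0 ?(ltW (t0 k))//  ler_pdivrMl//.
rewrite (splitI Bt B)// (splitI B Bt)// (setIC Bt B).
have cancel (u v w : R) : u + v - (u + w) = v - w by ring.
(* the integrals over the common part cancel, those over the slabs remain *)
rewrite cancel.
rewrite (le_trans (ler_normB _ _))//.
have D1 : `|\int[lam]_(x in Bt `\` B) f x| <= t k * K.
  apply: (normr_Rintegral_le _ _ BtB) => //; [exact: measurableD|exact: measurable_cbox].
have D2 : `|\int[lam]_(x in B `\` Bt) f x| <= t k * K.
  apply: (normr_Rintegral_le _ _ BBt) => //; [exact: measurableD|exact: measurable_cbox].
by rewrite (le_trans (lerD D1 D2))//; lra.
Qed.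

End flux.

Section step_bounded_variation.
Context {R : realType} {d : nat} {U : completeNormedModType R} (P : ocp d U).
Local Notation lam := (lebesgue_rV R d).
Local Notation mu := (leb P).
Local Notation e i := (delta_mx 0 i : 'rV[R]_d).

Lemma measurable_Omega : measurable (Omega P).
Proof. by apply: open_measurable_rV; exact: Omega_open. Qed.

Lemma leb_le X : measurable X -> (mu X <= lam X)%E.
Proof.
move=> mX; apply: le_measure; rewrite ?inE//.
by apply: measurableI => //; exact: measurable_Omega.
Qed.

Lemma leb_null X : measurable X -> lam X = 0%E -> mu X = 0%E.
Proof. by move=> mX X0; apply/eqP; rewrite eq_le measure_ge0 andbT -X0 leb_le. Qed.

Lemma leb_sub X : X `<=` Omega P -> mu X = lam X.
Proof. by move=> XO; rewrite /leb /= /mrestr setIidl. Qed.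

Lemma Rintegral_leb_sub A (f : 'rV[R]_d -> R) : measurable A -> A `<=` Omega P ->
  \int[mu]_(x in A) f x = \int[lam]_(x in A) f x.
Proof.
move=> mA AO; congr fine; apply: eq_measure_integral => X mX XA.
by rewrite /= /mrestr setIidl//; exact: subset_trans AO.
Qed.

Lemma integrable_leb_sub A (f : 'rV[R]_d -> R) : measurable A -> A `<=` Omega P ->
  lam.-integrable A (EFin \o f) -> mu.-integrable A (EFin \o f).
Proof.
move=> mA AO /integrableP[mf foo]; apply/integrableP; split => //.
apply: le_lt_trans foo; rewrite le_eqVlt; apply/orP; left; apply/eqP.
apply: eq_measure_integral => X mX XA.
by rewrite /= /mrestr setIidl//; exact: subset_trans AO.
Qed.

Lemma is_derive_coord (phi : 'rV[R]_d -> 'rV[R]_d) x v i : differentiable phi x ->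
  is_derive x v (fun y => phi y 0 i) (('D_v phi x) 0 i).
Proof.
move=> dphi; have dv : derivable phi x v by exact: diff_derivable.
split; first by move/derivable_mxP : dv; exact.
by rewrite derive_mx// mxE.
Qed.

Lemma continuous_rV_coord n (f : 'rV[R]_d -> 'rV[R]_n) i :
  continuous f -> continuous (fun x => f x 0 i).
Proof.
move=> cf x.
exact: (@continuous_comp _ _ _ f (fun y : 'rV[R]_n => y 0 i) x (cf x) (@coord_continuous _ _ _ _ _ _)).
Qed.

Lemma continuous_big_sum (I : Type) (r : seq I) (g : I -> 'rV[R]_d -> R) :
  (forall i, continuous (g i)) -> continuous (fun x => \sum_(i <- r) g i x).
Proof.
move=> cg; elim: r => [|i r IH].
  by under eq_fun do rewrite big_nil; exact: cst_continuous.
under eq_fun do rewrite big_cons.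
by move=> x; exact: (cvgD (cg i x) (IH x)).
Qed.

Lemma test_coord_le1 (v : 'rV[R]_d) i : \sum_(j < d) (v 0 j) ^+ 2 <= 1 ->
  `|v 0 i| <= 1.
Proof.
move=> v1; rewrite -(@ler_pXn2r _ 2)// ?nnegrE// expr1n real_normK ?num_real//.
apply: le_trans v1; rewrite (bigD1 i)//= lerDl sumr_ge0// => j _; exact: sqr_ge0.
Qed.

(** A step function on cubes has bounded variation because its total variation
is at most the sum of the perimeters of the cubes weighted by the values. *)
Lemma TV_step_lty (D : discretization R d) (c : 'rV[R]_(ncells D)) :
  (forall k, @cell _ _ D k `<=` Omega P) ->
  (forall k, exists s : R, is_cube (@cell _ _ D k) s) ->
  (TV mu (Omega P) (step D c) < +oo)%E.
Proof.
move=> QO /choice[s cubeQ].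
pose K k : R := \sum_(i < d) 2 * \prod_(j < d | j != i) s k.
apply: (@le_lt_trans _ _ (\sum_(k < ncells D) `|c 0 k| * K k)%:E); last exact: ltry.
apply: ge_ereal_sup => _ [phi [dphi cphi _ phi1] <-]; rewrite lee_fin.
have cphi0 : continuous phi by move=> x; exact: differentiable_continuous.
have cdphi i : continuous (fun x => ('D_(e i) phi x) 0 i).
  exact: (@continuous_rV_coord _ ('D_(e i) phi) i (cphi (e i))).
have cdiv : continuous (divergence phi).
  by apply: continuous_big_sum => i; exact: cdphi.
have mdiv : measurable_fun setT (divergence phi) by exact: continuous_measurable_rV.
have s0 k : 0 < s k by have [] := cubeQ k.
have mQ k : measurable (@cell _ _ D k) by have [] := cubeQ k.
have /choice[a aQ] k : exists a : 'rV[R]_d, obox a (a + const_mx (s k)) `<=` @cell _ _ D k /\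
    @cell _ _ D k `<=` cbox a (a + const_mx (s k)).
  have [_ _ [a [oQ Qc]]] := cubeQ k; exists a; split=> x.
    by move=> ox; apply: oQ => i; have := ox i; rewrite !mxE.
  by move=> /Qc cx i; have := cx i; rewrite !mxE.
pose B k := cbox (a k) (a k + const_mx (s k)).
have mB k : measurable (B k) by exact: measurable_cbox.
have Bfin k : (lam (B k) < +oo)%E by rewrite -ge0_fin_numE//; exact: cbox_fin_num.
have ciB k (g : 'rV[R]_d -> R) : continuous g -> lam.-integrable (B k) (EFin \o g).
  move=> cg; have [M gM] := continuous_bounded_cbox (a k) (a k + const_mx (s k)) cg.
  by apply: (@bounded_integrable _ _ _ _ M) => //; exact: continuous_measurable_rV.
have divQ k : `|\int[mu]_(x in @cell _ _ D k) divergence phi x| <= K k.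
  have [oQ Qc] := aQ k.
  rewrite Rintegral_leb_sub//.
  rewrite (@Rintegral_box_eq _ _ lam (a k) (a k + const_mx (s k)) _ (B k))//.
  - rewrite /divergence Rintegral_sum//; last by move=> i; exact: ciB.
    rewrite (le_trans (ler_norm_sum _ _ _))//; apply: ler_sum => i _.
    apply: (@cube_flux_le _ _ _ _ _ (fun x => phi x 0 i)) => //.
    + by move=> y; exact: is_derive_coord.
    + exact: continuous_rV_coord.
    + by move=> x; exact: test_coord_le1.
  - exact: ciB.
  - exact: sub_obox_cbox.
have Qi k : mu.-integrable (@cell _ _ D k) (EFin \o divergence phi).
  apply: integrable_leb_sub => //.
  by apply: integrableS (ciB k _ cdiv) => //; have [] := aQ k.
rewrite (@eq_Rintegral _ _ _ _ _ (fun x => \sum_(k < ncells D) c 0 k * (divergence phi x * \1_(@cell _ _ D k) x))).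
  rewrite Rintegral_sum//; last first.
    by move=> k; apply: integrableZl_EFin => //; exact: integrable_mul_indic.
  rewrite (le_trans (ler_norm _))// (le_trans (ler_norm_sum _ _ _))//.
  apply: ler_sum => k _; rewrite RintegralZl//; last exact: integrable_mul_indic.
  by rewrite Rintegral_indicM// normrM ler_wpM2l.
move=> x _; rewrite /step mulr_suml; apply: eq_bigr => k _; ring.
Qed.

End step_bounded_variation.

(** * One-dimensional cut-off profiles *)

Section profiles.
Context {R : realType}.
Implicit Types r t e : R.

(** The square of the positive part, the simplest continuously differentiable
function that vanishes on a half-line; all profiles are built from it. *)
Definition sqpos r : R := (Num.max 0 r) ^+ 2.

Lemma is_derive_sqpos r : is_derive r (1 : R) sqpos (2 * Num.max 0 r).
Proof.
suff cv : h^-1 *: ((sqpos \o shift r) (h *: (1 : R)) - sqpos r) @[h --> 0^']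
    --> 2 * Num.max 0 r.
  by split; [apply/cvg_ex; eexists; exact: cv|exact: cvg_lim cv].
apply/cvgrPdist_le => /= e e0; near=> h.
have h0 : h != 0 by near: h; exact: nbhs_dnbhs_neq.
have he : `|h| <= e by apply: ltW; near: h; exact: dnbhs0_lt.
rewrite [h *: 1]mulr1 /sqpos.
have -> : 2 * Num.max 0 r - h^-1 *: (Num.max 0 (h + r) ^+ 2 - Num.max 0 r ^+ 2) =
    h^-1 * (2 * Num.max 0 r * h - (Num.max 0 (h + r) ^+ 2 - Num.max 0 r ^+ 2)).
  by rewrite mulrBr [X in _ = X - _]mulrC mulfK.
rewrite normrM normfV ler_pdivrMl ?normr_gt0//.
apply: (@le_trans _ _ (h ^+ 2)); last first.
  by rewrite -real_normK ?num_real// expr2 ler_wpM2l.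
rewrite ler_norml; case: (leP 0 r) => r0; case: (leP 0 (h + r)) => hr0;
  apply/andP; split; nra.
Unshelve. all: by end_near. Qed.

Lemma continuous_maxr0 : continuous (fun r : R => Num.max 0 r).
Proof. by move=> r; apply: continuous_max; [exact: cst_continuous|exact: cvg_id]. Qed.

(** A continuous approximation of the indicator function of the positive half-line. *)
Definition ramp e t : R := (Num.max 0 t - Num.max 0 (t - e)) / e.

Lemma ramp_ge0 e t : 0 < e -> 0 <= ramp e t.
Proof.
move=> e0; apply: divr_ge0; last exact: ltW.
by case: (leP 0 t); case: (leP 0 (t - e)) => ? ?; lra.
Qed.

Lemma ramp_le1 e t : 0 < e -> ramp e t <= 1.
Proof.
move=> e0; rewrite ler_pdivrMr// mul1r.
by case: (leP 0 t); case: (leP 0 (t - e)) => ? ?; lra.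
Qed.

Lemma ramp_nondecreasing e t t' : 0 < e -> t <= t' -> ramp e t <= ramp e t'.
Proof.
move=> e0 tt'; rewrite ler_pM2r ?invr_gt0//.
by case: (leP 0 t); case: (leP 0 (t - e)); case: (leP 0 t');
  case: (leP 0 (t' - e)) => ? ? ? ?; lra.
Qed.

Lemma ramp_eq0 e t : 0 < e -> t <= 0 -> ramp e t = 0.
Proof.
move=> e0 t0; rewrite /ramp (max_idPl t0) (max_idPl _) ?subr0 ?mul0r//; lra.
Qed.

Lemma ramp_eq1 e t : 0 < e -> e <= t -> ramp e t = 1.
Proof.
move=> e0 et; rewrite /ramp (max_idPr _) ?(max_idPr _)//; try lra.
by rewrite opprB addrC subrK divff// gt_eqF.
Qed.

Lemma continuous_ramp e : continuous (ramp e).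
Proof.
move=> t; apply: cvgMl; apply: cvgB; first exact: continuous_maxr0.
apply: (@continuous_comp _ _ _ (fun t => t - e) (fun r => Num.max 0 r)).
  by apply: cvgB; [exact: cvg_id|exact: cst_continuous].
exact: continuous_maxr0.
Qed.


Lemma is_derive_rescale (f : R -> R) df a L t : is_derive ((t - a) / L) (1 : R) f df ->
  is_derive t (1 : R) (fun t => f ((t - a) / L)) (df / L).
Proof.
move=> fd; apply: (@is_derive1_comp _ f (fun t => (t - a) / L)) => //.
have -> : (fun t : R => (t - a) / L) = (L^-1 \*: (id - cst a)).
  by apply/funext => u /=; rewrite mulrC.
apply: is_derive_eq; by rewrite subr0 [_ *: _]mulr1.
Qed.

Lemma is_derive_translate (f : R -> R) df a t : is_derive (t - a) (1 : R) f df ->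
  is_derive t (1 : R) (fun t => f (t - a)) df.
Proof.
have := @is_derive_rescale f df a 1 t; rewrite !divr1.
have -> // : (fun t => f ((t - a) / 1)) = (fun t => f (t - a)).
by apply/funext => u; rewrite divr1.
Qed.

Lemma is_derive_sqpos_shift a t :
  is_derive t (1 : R) (fun t => sqpos (t - a)) (2 * Num.max 0 (t - a)).
Proof. by apply: is_derive_translate; exact: is_derive_sqpos. Qed.

(** The antiderivative of [ramp e], a hinge with a rounded corner. *)
Definition hinge e t : R := (2 * e)^-1 * (sqpos t - sqpos (t - e)).

Lemma is_derive_hinge e t : 0 < e -> is_derive t (1 : R) (hinge e) (ramp e t).
Proof.
move=> e0; have -> : hinge e = (2 * e)^-1 \*: (sqpos - (fun t => sqpos (t - e))).
  by apply/funext => u.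
have d1 := is_derive_sqpos t; have d2 := is_derive_sqpos_shift e t.
apply: is_derive_eq; rewrite /ramp /GRing.scale /=.
by field; rewrite gt_eqF.
Qed.

Lemma hinge_eq0 e t : 0 < e -> t <= 0 -> hinge e t = 0.
Proof.
move=> e0 t0; rewrite /hinge /sqpos (max_idPl t0) (max_idPl _) ?subrr ?mulr0//; lra.
Qed.

Lemma hinge_affine e t : 0 < e -> e <= t -> hinge e t = t - e / 2.
Proof.
move=> e0 et; rewrite /hinge /sqpos (max_idPr _) ?(max_idPr _)//; try lra.
by field; rewrite gt_eqF.
Qed.

(** A rounded tent over the unit interval: its slope is one on most of the first
half and minus one on most of the second half. *)
Definition tent e t : R :=
  hinge e (t - e) - 2 * hinge e (t - (2^-1 - e / 2)) + hinge e (t - (1 - 2 * e)).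
Definition dtent e t : R :=
  ramp e (t - e) - 2 * ramp e (t - (2^-1 - e / 2)) + ramp e (t - (1 - 2 * e)).

Lemma is_derive_tent e t : 0 < e -> is_derive t (1 : R) (tent e) (dtent e t).
Proof.
move=> e0; have h a : is_derive t (1 : R) (fun t => hinge e (t - a)) (ramp e (t - a)).
  by apply: is_derive_translate; exact: is_derive_hinge.
have -> : tent e = (fun t => hinge e (t - e)) -
    2 \*: (fun t => hinge e (t - (2^-1 - e / 2))) + (fun t => hinge e (t - (1 - 2 * e))).
  by apply/funext.
have h1 := h e; have h2 := h (2^-1 - e / 2); have h3 := h (1 - 2 * e).
by apply: is_derive_eq.
Qed.

Lemma continuous_dtent e : continuous (dtent e).
Proof.
have cr a : continuous (fun t => ramp e (t - a)).
  move=> t; apply: (@continuous_comp _ _ _ (fun t => t - a) (ramp e)).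
    by apply: cvgB; [exact: cvg_id|exact: cst_continuous].
  exact: continuous_ramp.
move=> t; apply: cvgD; last exact: cr.
by apply: cvgB; [exact: cr|apply: cvgMr; exact: cr].
Qed.

Lemma normr_dtent_le1 e t : 0 < e <= 4^-1 -> `|dtent e t| <= 1.
Proof.
move=> /andP[e0 e4].
have := @ramp_ge0 e (t - (1 - 2 * e)) e0; have := @ramp_le1 e (t - e) e0.
have : ramp e (t - (2^-1 - e / 2)) <= ramp e (t - e) by apply: ramp_nondecreasing => //; lra.
have : ramp e (t - (1 - 2 * e)) <= ramp e (t - (2^-1 - e / 2)).
  by apply: ramp_nondecreasing => //; lra.
by rewrite /dtent ler_norml => ? ? ? ?; apply/andP; split; lra.
Qed.

Lemma tent_eq0 e t : 0 < e <= 4^-1 -> ~~ (e < t < 1 - e) -> tent e t = 0.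
Proof.
move=> /andP[e0 e4]; rewrite negb_and -!leNgt => /orP[te|te].
  by rewrite /tent !hinge_eq0//; lra.
by rewrite /tent !hinge_affine//; lra.
Qed.

Lemma normr_tent_le e t : 0 < e <= 4^-1 -> `|tent e t| <= 2^-1.
Proof.
move=> ee; have /andP[e0 e4] := ee.
have [/andP[t0 t1]|] := boolP (e < t < 1 - e); last first.
  by move/(tent_eq0 ee) => ->; rewrite normr0.
have lip x y : x <= y -> `|tent e y - tent e x| <= y - x.
  move=> xy; have := @increment_le _ R (tent e) (dtent e) x 1 (y - x) 1.
  rewrite mul1r [_ *: 1]mulr1 (addrC x) subrK; apply.
  - by move=> z; exact: is_derive_tent.
  - by rewrite subr_ge0.
  - by move=> r _; exact: normr_dtent_le1.
have /lip : 0 <= t by lra.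
have /lip : t <= 1 by lra.
have T0 : tent e 0 = 0 by apply: tent_eq0 => //; apply/negP => /andP[? ?]; lra.
have T1 : tent e 1 = 0 by apply: tent_eq0 => //; apply/negP => /andP[? ?]; lra.
rewrite T0 T1 subr0 sub0r normrN => ? ?; lra.
Qed.

(** [plateau e] is continuously differentiable, vanishes outside of the unit
interval and tends to its indicator function as [e] tends to zero. *)
Definition bump e t : R := sqpos (t - e) * sqpos (1 - e - t).
Definition plateau e t : R := bump e t / (bump e t + e).

Lemma bump_ge0 e t : 0 <= bump e t.
Proof. by apply: mulr_ge0; exact: sqr_ge0. Qed.

Lemma plateau_ge0 e t : 0 < e -> 0 <= plateau e t.
Proof. by move=> e0; rewrite divr_ge0 ?bump_ge0// addr_ge0 ?bump_ge0// ltW. Qed.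

Lemma plateau_le1 e t : 0 < e -> plateau e t <= 1.
Proof.
move=> e0; have b0 := bump_ge0 e t.
by rewrite ler_pdivrMr ?mul1r ?lerDl ?ltW// ltr_wpDl.
Qed.

Lemma plateau_eq0 e t : ~~ (e < t < 1 - e) -> plateau e t = 0.
Proof.
rewrite negb_and -!leNgt => te; rewrite /plateau /bump /sqpos.
suff -> : Num.max 0 (t - e) ^+ 2 * Num.max 0 (1 - e - t) ^+ 2 = 0 by rewrite mul0r.
case/orP: te => te; first by rewrite (max_idPl _) ?expr0n ?mul0r//; lra.
by rewrite [Num.max 0 (1 - e - t)](max_idPl _) ?expr0n ?mulr0//; lra.
Qed.

Lemma plateau_C1 e : 0 < e -> exists2 d : R -> R, continuous d &
  forall t, is_derive t (1 : R) (plateau e) (d t).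
Proof.
move=> e0.
pose db t := sqpos (t - e) * (- (2 * Num.max 0 (1 - e - t))) +
  sqpos (1 - e - t) * (2 * Num.max 0 (t - e)).
have bd t : is_derive t (1 : R) (bump e) (db t).
  have d1 := is_derive_sqpos_shift e t.
  have d2 : is_derive t (1 : R) (fun t => sqpos (1 - e - t)) (- (2 * Num.max 0 (1 - e - t))).
    have d3 := is_derive_sqpos (1 - e - t).
    have -> : - (2 * Num.max 0 (1 - e - t)) = (2 * Num.max 0 (1 - e - t)) * - 1 by ring.
    apply: (@is_derive1_comp _ sqpos (fun t => 1 - e - t)) => //.
    have -> : (fun t : R => 1 - e - t) = cst (1 - e) - id by apply/funext.
    by apply: is_derive_eq; rewrite sub0r.
  have -> : bump e = (fun t => sqpos (t - e)) * (fun t => sqpos (1 - e - t)).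
    by apply/funext.
  by apply: is_derive_eq.
pose D t := bump e t + e.
have D0 t : D t != 0 by rewrite gt_eqF// ltr_wpDl// bump_ge0.
exists (fun t => bump e t * (- (D t) ^- 2 * db t) + (D t)^-1 * db t).
  have c1 : continuous (fun t : R => t - e).
    by move=> t; apply: cvgB; [exact: cvg_id|exact: cst_continuous].
  have c2 : continuous (fun t : R => 1 - e - t).
    by move=> t; apply: cvgB; [exact: cst_continuous|exact: cvg_id].
  have m1 : continuous (fun t => Num.max 0 (t - e)).
    by move=> t; apply: (continuous_comp (c1 t)); exact: continuous_maxr0.
  have m2 : continuous (fun t => Num.max 0 (1 - e - t)).
    by move=> t; apply: (continuous_comp (c2 t)); exact: continuous_maxr0.
  have s1 : continuous (fun t => sqpos (t - e)).
    by move=> t; rewrite /sqpos; under eq_fun do rewrite expr2; apply: cvgM; exact: m1.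
  have s2 : continuous (fun t => sqpos (1 - e - t)).
    by move=> t; rewrite /sqpos; under eq_fun do rewrite expr2; apply: cvgM; exact: m2.
  have cdb : continuous db.
    move=> t; apply: cvgD; apply: cvgM; [exact: s1| |exact: s2|].
      by apply: cvgN; apply: cvgMr; exact: m2.
    by apply: cvgMr; exact: m1.
  have cb : continuous (bump e) by move=> t; apply: cvgM; [exact: s1|exact: s2].
  have cD : continuous D by move=> t; apply: cvgD; [exact: cb|exact: cst_continuous].
  have cDV : continuous (fun t => (D t)^-1) by move=> t; apply: cvgV => //; exact: cD.
  move=> t; apply: cvgD; apply: cvgM; [exact: cb| |exact: cDV|exact: cdb].
  apply: cvgM; last exact: cdb.
  apply: cvgN; under eq_fun do rewrite -exprVn expr2.
  by rewrite -exprVn expr2; apply: cvgM; exact: cDV.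
move=> t.
have dD : is_derive t (1 : R) D (db t).
  have -> : D = bump e + cst e by apply/funext.
  by apply: is_derive_eq; rewrite addr0.
have dV : is_derive t (1 : R) (fun t => (D t)^-1) (- (D t) ^- 2 * db t).
  exact: is_deriveV.
have -> : plateau e = bump e * (fun t => (D t)^-1) by apply/funext.
by apply: is_derive_eq.
Qed.

Definition cutoff (n : nat) : R := (4 * n.+1%:R)^-1.

Lemma cutoff_bounds n : 0 < cutoff n <= 4^-1.
Proof.
rewrite /cutoff invr_gt0 mulr_gt0//= lef_pV2 ?posrE ?mulr_gt0//.
by rewrite ler_peMr// ler1n.
Qed.

Lemma cvg_cutoff : cutoff n @[n --> \oo] --> (0 : R).
Proof.
rewrite /cutoff; under eq_fun do rewrite invfM.
by rewrite -(mulr0 (4^-1 : R)); apply: cvgMr; exact: cvg_harmonic.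
Qed.

Lemma cutoff_lt (r : R) : 0 < r -> \forall n \near \oo, cutoff n < r.
Proof. by move=> r0; apply: (cvgr_lt _ cvg_cutoff). Qed.

Lemma cvg_dtent t : dtent (cutoff n) t @[n --> \oo] -->
  ((0 < t < 2^-1)%R%:R - (2^-1 < t < 1)%R%:R : R).
Proof.
apply: cvg_near_cst.
have [t0|t0] : t <= 0 \/ 0 < t by case: (leP t 0) => ?; [left|right].
  have -> : (0 < t < 2^-1) = false by apply/negP => /andP[? ?]; lra.
  have -> : (2^-1 < t < 1) = false by apply/negP => /andP[? ?]; lra.
  apply: nearW => n; have /andP[e0 e4] := cutoff_bounds n.
  have r1 : ramp (cutoff n) (t - cutoff n) = 0 by apply: ramp_eq0; lra.
  have r2 : ramp (cutoff n) (t - (2^-1 - cutoff n / 2)) = 0 by apply: ramp_eq0; lra.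
  have r3 : ramp (cutoff n) (t - (1 - 2 * cutoff n)) = 0 by apply: ramp_eq0; lra.
  by rewrite /dtent r1 r2 r3 /=; lra.
have [t2|[t2|t2]] : t < 2^-1 \/ (2^-1 < t \/ t = 2^-1).
  by case: (ltgtP t 2^-1) => ?; [left|right; left|right; right].
- have -> : (0 < t < 2^-1) = true by rewrite t0.
  have -> : (2^-1 < t < 1) = false by apply/negP => /andP[? ?]; lra.
  near=> n; have /andP[e0 e4] := cutoff_bounds n.
  have ? : cutoff n < t / 2 by near: n; apply: cutoff_lt; lra.
  have ? : cutoff n < 1 - 2 * t by near: n; apply: cutoff_lt; lra.
  have r1 : ramp (cutoff n) (t - cutoff n) = 1 by apply: ramp_eq1; lra.
  have r2 : ramp (cutoff n) (t - (2^-1 - cutoff n / 2)) = 0 by apply: ramp_eq0; lra.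
  have r3 : ramp (cutoff n) (t - (1 - 2 * cutoff n)) = 0 by apply: ramp_eq0; lra.
  by rewrite /dtent r1 r2 r3 /=; lra.
- have -> : (0 < t < 2^-1) = false by apply/negP => /andP[? ?]; lra.
  have [t1|t1] : t < 1 \/ 1 <= t by case: (ltP t 1) => ?; [left|right].
    have -> : (2^-1 < t < 1) = true by rewrite t2.
    near=> n; have /andP[e0 e4] := cutoff_bounds n.
    have ? : cutoff n < 2 * (t - 2^-1) by near: n; apply: cutoff_lt; lra.
    have ? : cutoff n < (1 - t) / 2 by near: n; apply: cutoff_lt; lra.
    have r1 : ramp (cutoff n) (t - cutoff n) = 1 by apply: ramp_eq1; lra.
    have r2 : ramp (cutoff n) (t - (2^-1 - cutoff n / 2)) = 1 by apply: ramp_eq1; lra.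
    have r3 : ramp (cutoff n) (t - (1 - 2 * cutoff n)) = 0 by apply: ramp_eq0; lra.
    by rewrite /dtent r1 r2 r3 /=; lra.
  have -> : (2^-1 < t < 1) = false by apply/negP => /andP[? ?]; lra.
  apply: nearW => n; have /andP[e0 e4] := cutoff_bounds n.
  have r1 : ramp (cutoff n) (t - cutoff n) = 1 by apply: ramp_eq1; lra.
  have r2 : ramp (cutoff n) (t - (2^-1 - cutoff n / 2)) = 1 by apply: ramp_eq1; lra.
  have r3 : ramp (cutoff n) (t - (1 - 2 * cutoff n)) = 1 by apply: ramp_eq1; lra.
  by rewrite /dtent r1 r2 r3 /=; lra.
- have -> : (0 < t < 2^-1) = false by apply/negP => /andP[? ?]; lra.
  have -> : (2^-1 < t < 1) = false by apply/negP => /andP[? ?]; lra.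
  apply: nearW => n; have /andP[e0 e4] := cutoff_bounds n.
  rewrite /dtent t2 ramp_eq1 ?[ramp _ (_ - (1 - _))]ramp_eq0//; try lra.
  have -> : 2^-1 - (2^-1 - cutoff n / 2) = cutoff n / 2 by ring.
  rewrite /ramp (max_idPr _) ?(max_idPl _); try lra.
  by field; rewrite gt_eqF.
Unshelve. all: by end_near. Qed.

Lemma cvg_plateau t : plateau (cutoff n) t @[n --> \oo] --> ((0 < t < 1)%R%:R : R).
Proof.
have [/andP[t0 t1]|t01] := boolP (0 < t < 1); last first.
  apply: cvg_near_cst; apply: nearW => n; have /andP[e0 e4] := cutoff_bounds n.
  apply: plateau_eq0; apply: contra t01 => /andP[? ?]; apply/andP; split; lra.
have sq (f : nat -> R) l : f n @[n --> \oo] --> l -> sqpos (f n) @[n --> \oo] --> sqpos l.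
  move=> fl; rewrite /sqpos; under eq_fun do rewrite expr2.
  have m : Num.max 0 (f n) @[n --> \oo] --> Num.max 0 l.
    exact: (cvg_comp _ _ fl (@continuous_maxr0 l)).
  by rewrite expr2; exact: (cvgM m m).
have cb : bump (cutoff n) t @[n --> \oo] --> bump 0 t.
  apply: cvgM; apply: sq; first by apply: cvgB; [exact: cvg_cst|exact: cvg_cutoff].
  apply: cvgB; last exact: cvg_cst.
  by apply: cvgB; [exact: cvg_cst|exact: cvg_cutoff].
have b0 : 0 < bump 0 t.
  rewrite /bump /sqpos !subr0 (max_idPr _) ?(max_idPr _) ?mulr_gt0 ?exprn_gt0//; lra.
rewrite -[X in _ --> X](@divff _ (bump 0 t)) ?gt_eqF//.
apply: cvgM => //; apply: cvgV; first by rewrite gt_eqF.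
by rewrite -[X in _ --> X]addr0; apply: cvgD => //; exact: cvg_cutoff.
Qed.

End profiles.

(** * Continuously differentiable functions with compact support *)

Section C1_functions.
Context {R : realType} {n : nat}.
Implicit Types (f g : 'rV[R]_n -> R) (x v : 'rV[R]_n).

Definition C1 f : Prop :=
  (forall x, differentiable f x) /\ (forall v, continuous ('D_v f)).

Definition compact_support (D : set 'rV[R]_n) f : Prop :=
  exists K, [/\ compact K, K `<=` D & forall x, ~ K x -> f x = 0].

Lemma C1_continuous f : C1 f -> continuous f.
Proof. by move=> [df _] x; exact: differentiable_continuous. Qed.

Lemma C1_cst (c : R) : C1 (cst c).
Proof.
split=> [x|v x]; first exact: differentiable_cst.
have -> : 'D_v (cst c : 'rV[R]_n -> R) = cst 0 by apply/funext => y; rewrite derive_cst.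
exact: cst_continuous.
Qed.

Lemma derive_C1D f g v x : C1 f -> C1 g ->
  'D_v (fun x => f x + g x) x = 'D_v f x + 'D_v g x.
Proof. by move=> [df _] [dg _]; rewrite -deriveD//; exact: diff_derivable. Qed.

Lemma C1_D f g : C1 f -> C1 g -> C1 (fun x => f x + g x).
Proof.
move=> f1 g1; split=> [x|v].
  by have [df _] := f1; have [dg _] := g1; exact: differentiableD.
have -> : 'D_v (fun x => f x + g x) = (fun x => 'D_v f x + 'D_v g x).
  by apply/funext => x; exact: derive_C1D.
by move=> x; exact: (cvgD (f1.2 v x) (g1.2 v x)).
Qed.

Lemma derive_C1M f g v x : C1 f -> C1 g ->
  'D_v (fun x => f x * g x) x = f x * 'D_v g x + g x * 'D_v f x.
Proof. by move=> [df _] [dg _]; rewrite -deriveM//; exact: diff_derivable. Qed.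

Lemma C1_M f g : C1 f -> C1 g -> C1 (fun x => f x * g x).
Proof.
move=> f1 g1; split=> [x|v].
  by have [df _] := f1; have [dg _] := g1; exact: differentiableM.
have -> : 'D_v (fun x => f x * g x) = (fun x => f x * 'D_v g x + g x * 'D_v f x).
  by apply/funext => x; exact: derive_C1M.
have cf := C1_continuous f1; have cg := C1_continuous g1.
move=> x; exact: (cvgD (cvgM (cf x) (g1.2 v x)) (cvgM (cg x) (f1.2 v x))).
Qed.

Lemma derive_C1Z f (c : R) v x : C1 f -> 'D_v (fun x => c * f x) x = c * 'D_v f x.
Proof.
by move=> f1; rewrite (derive_C1M v x (C1_cst c) f1) derive_cst mulr0 addr0.
Qed.

Lemma C1_Z f (c : R) : C1 f -> C1 (fun x => c * f x).
Proof. exact: C1_M (C1_cst c). Qed.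

Lemma C1_sum (I : Type) (r : seq I) (F : I -> 'rV[R]_n -> R) :
  (forall i, C1 (F i)) -> C1 (fun x => \sum_(i <- r) F i x).
Proof.
move=> F1; elim: r => [|i r IH].
  by under eq_fun do rewrite big_nil; exact: C1_cst.
by under eq_fun do rewrite big_cons; exact: C1_D.
Qed.

Lemma derive_C1_sum (I : Type) (r : seq I) (F : I -> 'rV[R]_n -> R) v x :
  (forall i, C1 (F i)) ->
  'D_v (fun x => \sum_(i <- r) F i x) x = \sum_(i <- r) 'D_v (F i) x.
Proof.
move=> F1; elim: r => [|i r IH].
  by under eq_fun do rewrite big_nil; rewrite big_nil derive_cst.
rewrite big_cons -IH -derive_C1D//; last exact: C1_sum.
by congr ('D_v _ x); apply/funext => y; rewrite big_cons.
Qed.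

Lemma C1_prod (I : Type) (r : seq I) (P : pred I) (F : I -> 'rV[R]_n -> R) :
  (forall i, C1 (F i)) -> C1 (fun x => \prod_(i <- r | P i) F i x).
Proof.
move=> F1; elim: r => [|i r IH].
  by under eq_fun do rewrite big_nil; exact: C1_cst.
under eq_fun do rewrite big_cons; case: (P i) => //.
exact: C1_M.
Qed.

Lemma derive_C1_prod0 (I : Type) (r : seq I) (P : pred I) (F : I -> 'rV[R]_n -> R) v x :
  (forall i, C1 (F i)) -> (forall i, P i -> 'D_v (F i) x = 0) ->
  'D_v (fun x => \prod_(i <- r | P i) F i x) x = 0.
Proof.
move=> F1 F0; elim: r => [|i r IH].
  by under eq_fun do rewrite big_nil; rewrite derive_cst.
have -> : (fun x => \prod_(j <- i :: r | P j) F j x) =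
    (fun x => (if P i then F i x else 1) * \prod_(j <- r | P j) F j x).
  by apply/funext => y; rewrite big_cons; case: (P i) => //; rewrite mul1r.
have C : C1 (fun x => \prod_(j <- r | P j) F j x) by exact: C1_prod.
have [Pi|_] := boolP (P i); last by rewrite (derive_C1M v x (C1_cst 1) C) IH derive_cst !mulr0 addr0.
by rewrite (derive_C1M v x (F1 i) C) IH F0// !mulr0 addr0.
Qed.

Lemma is_derive_from_line f (df : R) x v :
  is_derive (0 : R) (1 : R) (fun h => f (h *: v + x)) df -> is_derive x v f df.
Proof.
have E : (fun h : R => h^-1 *: (((fun h => f (h *: v + x)) \o shift 0) (h *: 1)
            - f (0 *: v + x))) =
    (fun h : R => h^-1 *: ((f \o shift x) (h *: v) - f x)).
  apply/funext => h /=; rewrite scale0r add0r; congr (_ *: (f _ - _)).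
  by rewrite [h *: 1]mulr1 addr0.
case=> D1 D2; split; first by move: D1; rewrite /derivable E.
by rewrite -D2 /derive E.
Qed.

Lemma is_derive_coord_comp (g dg : R -> R) (i : 'I_n) x v :
  (forall t, is_derive t (1 : R) g (dg t)) ->
  is_derive x v (fun x => g (x 0 i)) (dg (x 0 i) * v 0 i).
Proof.
move=> gd; apply: is_derive_from_line.
have -> : (fun h : R => g ((h *: v + x) 0 i)) = g \o (fun h => h * v 0 i + x 0 i).
  by apply/funext => h; rewrite /= !mxE.
have lin : is_derive (0 : R) (1 : R) (fun h => h * v 0 i + x 0 i) (v 0 i).
  have -> : (fun h : R => h * v 0 i + x 0 i) = (v 0 i \*: id) + cst (x 0 i).
    by apply/funext => h; rewrite mulrC.
  by apply: is_derive_eq; rewrite addr0 [_ *: _]mulr1.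
have := @is_derive1_comp _ g (fun h => h * v 0 i + x 0 i) 0 _ _ (gd _) lin.
by rewrite mul0r add0r.
Qed.

Lemma derive_coord_comp (g dg : R -> R) (i : 'I_n) x v :
  (forall t, is_derive t (1 : R) g (dg t)) ->
  'D_v (fun x => g (x 0 i)) x = dg (x 0 i) * v 0 i.
Proof. by move=> gd; have [_ ->] := is_derive_coord_comp i x v gd. Qed.

Lemma C1_coord_comp (g dg : R -> R) (i : 'I_n) :
  (forall t, is_derive t (1 : R) g (dg t)) -> continuous dg ->
  C1 (fun x => g (x 0 i)).
Proof.
move=> gd cdg; split=> [x|v].
  apply: (@differentiable_comp _ _ _ _ (fun x : 'rV[R]_n => x 0 i) g).
    exact: differentiable_coord.
  by apply/derivable1_diffP; have [] := gd (x 0 i).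
have -> : 'D_v (fun x => g (x 0 i)) = (fun x => dg (x 0 i) * v 0 i).
  by apply/funext => x; exact: derive_coord_comp.
have cc : continuous (dg \o (fun y : 'rV[R]_n => y 0 i)).
  by move=> y; apply: continuous_comp; [exact: coord_continuous|exact: cdg].
by move=> x; exact: (cvgM (cc x) (@cst_continuous _ _ (v 0 i) x)).
Qed.

Lemma compact_support_D (D : set 'rV[R]_n) f g : compact_support D f -> compact_support D g ->
  compact_support D (fun x => f x + g x).
Proof.
move=> [K [cK KD fK]] [K' [cK' KD' gK']]; exists (K `|` K'); split.
- exact: compactU.
- by move=> x [/KD|/KD'].
- by move=> x /not_orP[xK xK']; rewrite fK// gK'// addr0.
Qed.

Lemma compact_support_Z (D : set 'rV[R]_n) f (c : R) : compact_support D f ->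
  compact_support D (fun x => c * f x).
Proof. by move=> [K [cK KD fK]]; exists K; split=> // x xK; rewrite fK// mulr0. Qed.

Lemma compact_support_sum (D : set 'rV[R]_n) (I : Type) (r : seq I) (F : I -> 'rV[R]_n -> R) :
  (forall i, compact_support D (F i)) ->
  compact_support D (fun x => \sum_(i <- r) F i x).
Proof.
move=> FD; elim: r => [|i r IH].
  by exists set0; split=> [||x _]; [exact: compact0|exact: sub0set|rewrite big_nil].
by under eq_fun do rewrite big_cons; exact: compact_support_D.
Qed.

(** Outside of the support the function vanishes on an open set, so that its
derivatives vanish there as well. *)
Lemma C1_derive_bounded (D : set 'rV[R]_n) f v : C1 f -> compact_support D f ->
  exists M, forall x, `|'D_v f x| <= M.
Proof.
move=> f1 [K [cK _ fK]].
have /compact_bounded[M [_ /(_ (M + 1))]] : compact ('D_v f @` K).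
  by apply: continuous_compact => //; apply: continuous_subspaceT; exact: f1.2.
rewrite ltrDl ltr01 => /(_ isT) fM; exists (Num.max 0 (M + 1)) => x.
have [Kx|Kx] := pselect (K x).
  by rewrite le_max; apply/orP; right; apply: fM; exists x.
suff -> : 'D_v f x = 0 by rewrite normr0 le_max lexx.
have oK : open (~` K) by apply: closed_openC; exact: compact_closed.
have near0 : \near x, f x = cst 0 x.
  by apply: filterS (open_nbhs_nbhs (conj oK Kx)) => y /= /fK.
by rewrite (near_eq_derive _ near0) derive_cst.
Qed.

End C1_functions.

(** * Directional variations *)

Section directional_variation.
Context {R : realType} {n : nat} (mu : {measure set 'rV[R]_n -> \bar R}).
Context (D : set 'rV[R]_n) (w : 'rV[R]_n -> R).
Hypothesis wi : mu.-integrable setT (EFin \o w).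
Local Notation e i := (delta_mx 0 i : 'rV[R]_n).

Definition scalar_test : set ('rV[R]_n -> R) :=
  [set f | [/\ C1 f, compact_support D f & forall x, `|f x| <= 1]].

(** The variation of [w] in the coordinate direction [i]. *)
Definition dvar (i : 'I_n) : R :=
  sup [set \int[mu]_x (w x * 'D_(e i) f x) | f in scalar_test].

Lemma rows_C1 (F : 'I_n -> 'rV[R]_n -> R) : (forall i, C1 (F i)) ->
  [/\ (forall x, differentiable (fun x => \row_i F i x) x),
      (forall v x, 'D_v (fun x => \row_i F i x) x = \row_i 'D_v (F i) x) &
      (forall v, continuous ('D_v (fun x => \row_i F i x)))].
Proof.
move=> F1.
have dF x : differentiable (fun x => \row_i F i x) x.
  have -> : (fun x => \row_i F i x) = \sum_(i < n) (fun x => F i x *: e i).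
    apply/funext => y; rewrite fct_sumE [LHS]row_sum_delta.
    by apply: eq_bigr => i _; rewrite mxE.
  apply: differentiable_sum => i; apply: differentiableZl; exact: (F1 i).1.
have DF v x : 'D_v (fun x => \row_i F i x) x = \row_i 'D_v (F i) x.
  rewrite derive_mx; last exact: diff_derivable.
  apply/rowP => i; rewrite !mxE; congr ('D_v _ x).
  by apply/funext => y; rewrite mxE.
split=> // v.
have -> : 'D_v (fun x => \row_i F i x) = (fun x => \sum_(i < n) 'D_v (F i) x *: e i).
  apply/funext => x; rewrite DF [LHS]row_sum_delta.
  by apply: eq_bigr => i _; rewrite mxE.
elim: (index_enum _) => [|i r IH].
  by under eq_fun do rewrite big_nil; exact: cst_continuous.
under eq_fun do rewrite big_cons.
move=> x; exact: (cvgD (cvgZ ((F1 i).2 v x) (@cst_continuous _ _ (e i) x)) (IH x)).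
Qed.

Lemma rows_test (F : 'I_n -> 'rV[R]_n -> R) : (forall i, C1 (F i)) ->
  (forall i, compact_support D (F i)) -> (forall x, \sum_(i < n) (F i x) ^+ 2 <= 1) ->
  TV_test D (fun x => \row_i F i x).
Proof.
move=> F1 /choice[K KF] Fle; have [dF _ cF] := rows_C1 F1; split=> //.
  exists (\big[setU/set0]_(i < n) K i); split.
  - apply: big_ind => [|X Y cX cY|i _]; first exact: compact0.
      exact: compactU.
    by have [] := KF i.
  - by rewrite -bigcup_seq => x [i _ Kx]; have [_ KD _] := KF i; exact: KD.
  - move=> x Kx; apply/rowP => i; rewrite !mxE.
    have [_ _ F0] := KF i; apply: F0 => Kix; apply: Kx.
    by rewrite -bigcup_seq; exists i => //=; rewrite mem_index_enum.
move=> x; rewrite (eq_bigr (fun i => F i x ^+ 2))//.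
by move=> i _; rewrite mxE.
Qed.

Lemma divergence_rows (F : 'I_n -> 'rV[R]_n -> R) x : (forall i, C1 (F i)) ->
  divergence (fun x => \row_i F i x) x = \sum_(i < n) 'D_(e i) (F i) x.
Proof.
move=> F1; have [_ DF _] := rows_C1 F1.
by apply: eq_bigr => i _; rewrite DF mxE.
Qed.

Lemma integrable_mul_derive f v : C1 f -> compact_support D f ->
  mu.-integrable setT (EFin \o (fun x => w x * 'D_v f x)).
Proof.
move=> f1 cf; have [M fM] := C1_derive_bounded v f1 cf.
apply: (integrable_bounded_mul wi _ fM).
by apply: continuous_measurable_rV; exact: f1.2.
Qed.

Hypothesis TVfin : (TV mu D w < +oo)%E.

Lemma TV_ub (F : 'I_n -> 'rV[R]_n -> R) : (forall i, C1 (F i)) ->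
  (forall i, compact_support D (F i)) -> (forall x, \sum_(i < n) (F i x) ^+ 2 <= 1) ->
  \sum_(i < n) \int[mu]_x (w x * 'D_(e i) (F i) x) <= fine (TV mu D w).
Proof.
move=> F1 cF Fle; rewrite -lee_fin.
have tF := rows_test F1 cF Fle.
have -> : \sum_(i < n) \int[mu]_x (w x * 'D_(e i) (F i) x) =
    \int[mu]_x (w x * divergence (fun x => \row_i F i x) x).
  rewrite -Rintegral_sum//; last by move=> i; exact: integrable_mul_derive.
  by apply: eq_Rintegral => x _; rewrite divergence_rows// mulr_sumr.
have le_TV : ((\int[mu]_x (w x * divergence (fun x => \row_i F i x) x))%:E <= TV mu D w)%E.
  by apply: ereal_sup_ubound; exists (fun x => \row_i F i x).
have fin : TV mu D w \is a fin_num.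
  by rewrite fin_numElt TVfin andbT (lt_le_trans _ le_TV)// ltNyr.
by rewrite (fineK fin).
Qed.

Lemma zero_test : scalar_test (cst 0).
Proof.
split; [exact: C1_cst| |by move=> x; rewrite normr0].
by exists set0; split=> //; exact: compact0.
Qed.

Lemma scalar_test_ub i f : scalar_test f ->
  \int[mu]_x (w x * 'D_(e i) f x) <= fine (TV mu D w).
Proof.
move=> [f1 cf fle].
have cst0 : compact_support D (cst 0) by have [] := zero_test.
have := @TV_ub (fun j => if j == i then f else cst 0).
rewrite (bigD1 i)//= eqxx big1 => [|j /negbTE ->]; last first.
  rewrite (_ : (fun x => _) = cst 0) ?Rintegral_cst ?mul0r//.
  by apply/funext => x; rewrite derive_cst mulr0.
rewrite addr0; apply.
- by move=> j; case: ifP => // _; exact: C1_cst.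
- by move=> j; case: ifP.
- move=> x; rewrite (bigD1 i)//= eqxx big1 => [|j /negbTE ->]; last by rewrite expr0n.
  by rewrite addr0 -real_normK ?num_real// expr_le1.
Qed.

Lemma has_sup_dvar i : has_sup [set \int[mu]_x (w x * 'D_(e i) f x) | f in scalar_test].
Proof.
split; first by exists (\int[mu]_x (w x * 'D_(e i) (cst 0) x)), (cst 0) => //; exact: zero_test.
by exists (fine (TV mu D w)) => _ [f ft <-]; exact: scalar_test_ub.
Qed.

Lemma dvar_ub i f : scalar_test f -> \int[mu]_x (w x * 'D_(e i) f x) <= dvar i.
Proof. by move=> ft; apply: ub_le_sup; [exact: (has_sup_dvar i).2|exists f]. Qed.

(** Scalar test functions for the [n] directions, divided by [sqrt n], are the
components of an admissible vector field. *)
Lemma sum_dvar_le : (0 < n)%N -> \sum_(i < n) dvar i <= Num.sqrt n%:R * fine (TV mu D w).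
Proof.
move=> n0; apply/ler_addgt0Pr => eps eps0.
have eps'0 : 0 < eps / n%:R by rewrite divr_gt0// ltr0n.
have /choice[F FP] i : exists f, scalar_test f /\
    dvar i - eps / n%:R < \int[mu]_x (w x * 'D_(e i) f x).
  have [_ [f ft <-] fd] := sup_adherent eps'0 (has_sup_dvar i).
  by exists f.
set s := Num.sqrt n%:R.
have s0 : 0 < s by rewrite sqrtr_gt0 ltr0n.
have F1 i : C1 (F i) by have [[]] := FP i.
have cF i : compact_support D (F i) by have [[]] := FP i.
have Fle i x : `|F i x| <= 1 by have [[]] := FP i.
have := @TV_ub (fun i x => s^-1 * F i x).
have -> : \sum_(i < n) \int[mu]_x (w x * 'D_(e i) (fun x => s^-1 * F i x) x) =
    s^-1 * \sum_(i < n) \int[mu]_x (w x * 'D_(e i) (F i) x).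
  rewrite mulr_sumr; apply: eq_bigr => i _.
  rewrite -RintegralZl//; last exact: integrable_mul_derive.
  by apply: eq_Rintegral => x _; rewrite derive_C1Z// mulrCA.
rewrite ler_pdivrMl// => TVF.
have sumlt : \sum_(i < n) dvar i - eps <= \sum_(i < n) \int[mu]_x (w x * 'D_(e i) (F i) x).
  have -> : eps = \sum_(i < n) (eps / n%:R).
    by rewrite sumr_const card_ord -(mulr_natr (eps / n%:R)) divfK// pnatr_eq0 -lt0n.
  rewrite -sumrB; apply: ler_sum => i _; exact/ltW/(FP i).2.
rewrite -lerBlDr (le_trans sumlt)// TVF//.
- by move=> i; exact: C1_Z.
- by move=> i; exact: compact_support_Z.
- move=> x; rewrite (le_trans (_ : _ <= \sum_(i < n) s ^- 2))//.
    apply: ler_sum => i _; rewrite exprMn exprVn ler_piMr ?invr_ge0 ?exprn_ge0 ?(ltW s0)//.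
    by rewrite -real_normK ?num_real// expr_le1.
  rewrite sumr_const card_ord sqr_sqrtr ?ler0n// -[_ *+ n]mulr_natl mulfV//.
  by rewrite pnatr_eq0 -lt0n.
Qed.

End directional_variation.

(** * Halving boxes *)

Section box_tests.
Context {R : realType} {n : nat}.
Local Notation e i := (delta_mx 0 i : 'rV[R]_n).
Local Notation box := ('rV[R]_n * 'rV[R]_n)%type.
Implicit Types (B : box) (i j : 'I_n) (x : 'rV[R]_n) (eps : R).

Definition width B i : R := B.2 0 i - B.1 0 i.
Definition mid B i : R := (B.1 0 i + B.2 0 i) / 2.
Definition lower i B : box := (B.1, \row_j if j == i then mid B i else B.2 0 j).
Definition upper i B : box := (\row_j if j == i then mid B i else B.1 0 j, B.2).

Local Notation unit_coord B x j := ((x 0 j - B.1 0 j) / width B j).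

(** The product of a tent in direction [i] and of plateaus in the other
directions; its derivative in direction [i] is close to one on the lower half of
the box and to minus one on the upper half. *)
Definition box_test eps B i x : R :=
  width B i * tent eps (unit_coord B x i) *
  \prod_(j < n | j != i) plateau eps (unit_coord B x j).

Section one_box.
Variables (eps : R) (B : box).
Hypothesis eps_bd : 0 < eps <= 4^-1.
Hypothesis wB : forall j, 0 < width B j.

Let eps0 : 0 < eps. Proof. by case/andP: eps_bd. Qed.

Let tentd i t : is_derive t (1 : R) (fun t => width B i * tent eps ((t - B.1 0 i) / width B i))
  (dtent eps ((t - B.1 0 i) / width B i)).
Proof.
have h : is_derive t (1 : R) (fun t => tent eps ((t - B.1 0 i) / width B i))
    (dtent eps ((t - B.1 0 i) / width B i) / width B i).
  by apply: is_derive_rescale; exact: is_derive_tent.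
have -> : (fun t => width B i * tent eps ((t - B.1 0 i) / width B i)) =
    width B i \*: (fun t => tent eps ((t - B.1 0 i) / width B i)) by apply/funext.
apply: is_derive_eq; rewrite /GRing.scale /= mulrC divfK// gt_eqF//; exact: wB.
Qed.

Let C1_tent i : C1 (fun x => width B i * tent eps (unit_coord B x i)).
Proof.
apply: (@C1_coord_comp _ n (fun t => width B i * tent eps ((t - B.1 0 i) / width B i))
  (fun t => dtent eps ((t - B.1 0 i) / width B i)) i (tentd i)).
move=> t; apply: (@continuous_comp _ _ _ (fun t => (t - B.1 0 i) / width B i) (dtent eps)).
  by apply: cvgMl; apply: cvgB; [exact: cvg_id|exact: cst_continuous].
exact: continuous_dtent.
Qed.

Let plateau_d j : exists2 d : R -> R, continuous d &
  forall t, is_derive t (1 : R) (fun t => plateau eps ((t - B.1 0 j) / width B j)) (d t).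
Proof.
have [d cd hd] := plateau_C1 eps0.
exists (fun t => d ((t - B.1 0 j) / width B j) / width B j).
  move=> t; apply: cvgMl.
  apply: (@continuous_comp _ _ _ (fun t => (t - B.1 0 j) / width B j) d); last exact: cd.
  by apply: cvgMl; apply: cvgB; [exact: cvg_id|exact: cst_continuous].
by move=> t; apply: is_derive_rescale.
Qed.

Let C1_plateau j : C1 (fun x => plateau eps (unit_coord B x j)).
Proof.
have [d cd hd] := plateau_d j.
exact: (@C1_coord_comp _ n (fun t => plateau eps ((t - B.1 0 j) / width B j)) d j hd cd).
Qed.

Lemma C1_box_test i : C1 (box_test eps B i).
Proof. by apply: C1_M => //; apply: C1_prod. Qed.

Lemma derive_box_test i x : 'D_(e i) (box_test eps B i) x =
  dtent eps (unit_coord B x i) * \prod_(j < n | j != i) plateau eps (unit_coord B x j).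
Proof.
have C : C1 (fun x => \prod_(j < n | j != i) plateau eps (unit_coord B x j)).
  exact: C1_prod.
rewrite (derive_C1M (e i) x (C1_tent i) C) derive_C1_prod0//; last first.
  move=> j ji; have [d cd hd] := plateau_d j.
  rewrite (@derive_coord_comp _ n (fun t => plateau eps ((t - B.1 0 j) / width B j)) d j x (e i) hd).
  by rewrite mxE (negbTE ji) andbF mulr0.
rewrite mulr0 add0r.
rewrite (@derive_coord_comp _ n (fun t => width B i * tent eps ((t - B.1 0 i) / width B i))
  (fun t => dtent eps ((t - B.1 0 i) / width B i)) i x (e i) (tentd i)).
by rewrite mxE !eqxx mulr1 mulrC.
Qed.

Let prod_plateau_le1 i x :
  0 <= \prod_(j < n | j != i) plateau eps (unit_coord B x j) <= 1.
Proof.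
apply/andP; split; first by apply: prodr_ge0 => j _; exact: plateau_ge0.
by apply: prodr_ile1 => j _; rewrite plateau_ge0// plateau_le1.
Qed.

Lemma normr_derive_box_test_le1 i x : `|'D_(e i) (box_test eps B i) x| <= 1.
Proof.
have /andP[p0 p1] := prod_plateau_le1 i x.
rewrite derive_box_test normrM (ger0_norm p0) -[leRHS]mulr1.
by apply: ler_pM => //; exact: normr_dtent_le1.
Qed.

(** The support stays away from the faces of the box. *)
Lemma box_test_support i x :
  ~ cbox (\row_j (B.1 0 j + eps * width B j)) (\row_j (B.2 0 j - eps * width B j)) x ->
  box_test eps B i x = 0.
Proof.
move=> /existsNP[j]; rewrite !mxE => /negP xj.
have uj : ~~ (eps < unit_coord B x j < 1 - eps).
  apply: contra xj; rewrite ltr_pdivlMr ?wB// ltr_pdivrMr ?wB//.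
  have wE : width B j = B.2 0 j - B.1 0 j by [].
  by move=> /andP[? ?]; apply/andP; split; lra.
rewrite /box_test; have [<-|ji] := eqVneq j i; first by rewrite tent_eq0// mulr0 mul0r.
by rewrite (bigD1 j)//= plateau_eq0// mul0r mulr0.
Qed.

Lemma sub_support_obox : 
  cbox (\row_j (B.1 0 j + eps * width B j)) (\row_j (B.2 0 j - eps * width B j))
  `<=` obox B.1 B.2.
Proof.
move=> x xB j; have := xB j; rewrite !mxE.
have : 0 < eps * width B j by rewrite mulr_gt0.
by move=> ? /andP[? ?]; apply/andP; split; lra.
Qed.

Lemma compact_support_box_test (D : set 'rV[R]_n) i : obox B.1 B.2 `<=` D ->
  compact_support D (box_test eps B i).
Proof.
move=> BD.
exists (cbox (\row_j (B.1 0 j + eps * width B j)) (\row_j (B.2 0 j - eps * width B j))).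
split; [exact: compact_cbox| |exact: box_test_support].
exact: (subset_trans sub_support_obox BD).
Qed.

Lemma normr_box_test_le i x :
  `|box_test eps B i x| <= width B i / 2 * \1_(hbox B.1 B.2) x.
Proof.
have wi := wB i.
have [xB|xB] := pselect (hbox B.1 B.2 x); last first.
  rewrite box_test_support.
    by rewrite normr0 mulr_ge0// divr_ge0// ltW.
  by apply: contra_not xB => /sub_support_obox; exact: sub_obox_hbox.
rewrite indicE mem_set// mulr1 /box_test !normrM (gtr0_norm wi).
have /andP[p0 p1] := prod_plateau_le1 i x.
rewrite (ger0_norm p0) -[leRHS]mulr1; apply: ler_pM => //.
  by rewrite mulr_ge0// ltW.
by rewrite ler_wpM2l ?(ltW wi)// normr_tent_le.
Qed.

End one_box.

Lemma cvg_prod (I : Type) (r : seq I) (P : pred I) (F : nat -> I -> R) (G : I -> R) :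
  (forall a, F k a @[k --> \oo] --> G a) ->
  \prod_(a <- r | P a) F k a @[k --> \oo] --> \prod_(a <- r | P a) G a.
Proof.
move=> FG; elim: r => [|a r IH].
  by rewrite big_nil; under eq_fun do rewrite big_nil; exact: cvg_cst.
rewrite big_cons; under eq_fun do rewrite big_cons.
by case: (P a) => //; exact: (cvgM (FG a) IH).
Qed.

Lemma cvg_sum_finite (I : Type) (r : seq I) (F : nat -> I -> R) (G : I -> R) :
  (forall a, F k a @[k --> \oo] --> G a) ->
  \sum_(a <- r) F k a @[k --> \oo] --> \sum_(a <- r) G a.
Proof.
move=> FG; elim: r => [|a r IH].
  by rewrite big_nil; under eq_fun do rewrite big_nil; exact: cvg_cst.
rewrite big_cons; under eq_fun do rewrite big_cons.
exact: (cvgD (FG a) IH).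
Qed.

Lemma prod_nat_of_bool (I : finType) (P c : pred I) :
  \prod_(a | P a) (c a)%:R = [forall a, P a ==> c a]%:R :> R.
Proof.
case: forallP => [Pc|/existsNP[a /negP]].
  by rewrite big1// => a Pa; have := Pc a; rewrite Pa => /= ->.
rewrite negb_imply => /andP[Pa /negbTE ca].
by rewrite (bigD1 a)//= ca mul0r.
Qed.

Lemma width_lower B i j : width (lower i B) j = if j == i then width B i / 2 else width B j.
Proof. by rewrite /width /= mxE; case: eqP => // ->; rewrite /mid; field. Qed.

Lemma width_upper B i j : width (upper i B) j = if j == i then width B i / 2 else width B j.
Proof. by rewrite /width /= mxE; case: eqP => // ->; rewrite /mid; field. Qed.

(** Dividing by the widths turns the coordinates [u j] into numbers that lie between
0 and 1 exactly on the box, and between 0 and 1/2 in direction [i] exactly on its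
lower half. *)
Lemma cvg_derive_box_test B i x : (forall j, 0 < width B j) ->
  'D_(e i) (box_test (cutoff k) B i) x @[k --> \oo] -->
  (\1_(obox (lower i B).1 (lower i B).2) x - \1_(obox (upper i B).1 (upper i B).2) x : R).
Proof.
move=> wB.
pose u j := unit_coord B x j.
have uE j (c : R) : (B.1 0 j + c * width B j < x 0 j) = (c < u j).
  by rewrite /u ltr_pdivlMr ?wB// -ltrBrDl.
have uE' j (c : R) : (x 0 j < B.1 0 j + c * width B j) = (u j < c).
  by rewrite /u ltr_pdivrMr ?wB// -ltrBlDl.
pose Q : R := \prod_(j < n | j != i) (0 < u j < 1)%R%:R.
have QE : Q = [forall j, (j != i) ==> (0 < u j < 1)]%:R.
  exact: (prod_nat_of_bool (fun j => j != i) (fun j => 0 < u j < 1)).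
have half (C : box) (b : bool) : 
    (forall j, j != i -> (C.1 0 j < x 0 j < C.2 0 j) = (0 < u j < 1)) ->
    (C.1 0 i < x 0 i < C.2 0 i) = b -> \1_(obox C.1 C.2) x = b%:R * Q.
  move=> Cj Ci; rewrite indicE QE -natrM mulnb; congr (_%:R); congr nat_of_bool.
  apply/idP/idP => [/set_mem xC|/andP[bT /forallP uj]].
    apply/andP; split; first by rewrite -Ci; exact: xC.
    by apply/forallP => j; apply/implyP => ji; rewrite -Cj//; exact: xC.
  apply/mem_set => j; have [->|ji] := eqVneq j i; first by rewrite Ci.
  by rewrite Cj//; have := uj j; rewrite ji.
have b0 j : B.1 0 j = B.1 0 j + 0 * width B j by rewrite mul0r addr0.
have b1 j : B.2 0 j = B.1 0 j + 1 * width B j by rewrite mul1r addrC subrK.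
have bm : mid B i = B.1 0 i + 2^-1 * width B i by rewrite /mid /width; field.
rewrite (half (lower i B) (0 < u i < 2^-1)); last 2 first.
- by move=> j ji; rewrite /= mxE (negbTE ji) b0 b1 uE uE'.
- by rewrite /= mxE eqxx b0 bm uE uE'.
rewrite (half (upper i B) (2^-1 < u i < 1)); last 2 first.
- by move=> j ji; rewrite /= mxE (negbTE ji) b0 b1 uE uE'.
- by rewrite /= mxE eqxx bm b1 uE uE'.
rewrite -mulrBl.
under eq_fun => k do rewrite (derive_box_test (cutoff_bounds k) wB).
apply: cvgM; first exact: cvg_dtent.
by apply: cvg_prod => j; exact: cvg_plateau.
Qed.

Section halving.
Variables (mu : {measure set 'rV[R]_n -> \bar R}) (D : set 'rV[R]_n) (w : 'rV[R]_n -> R).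
Hypothesis mu_null : forall X, measurable X -> lebesgue_rV R n X = 0%E -> mu X = 0%E.
Hypothesis wi : mu.-integrable setT (EFin \o w).
Hypothesis TVfin : (TV mu D w < +oo)%E.

Local Notation Int B := (\int[mu]_(x in hbox B.1 B.2) w x).

Lemma Rintegral_obox_hbox B :
  \int[mu]_(x in obox B.1 B.2) w x = Int B.
Proof.
apply: (@Rintegral_box_eq _ _ _ B.1 B.2) => //.
- exact: measurable_obox.
- exact: measurable_hbox.
- by apply: integrableST => //; exact: measurable_cbox.
- exact: sub_obox_cbox.
- exact: sub_obox_hbox.
- exact: sub_hbox_cbox.
Qed.

Lemma cvg_Rintegral_box_test B i : (forall j, 0 < width B j) -> obox B.1 B.2 `<=` D ->
  \int[mu]_x (w x * 'D_(e i) (box_test (cutoff k) B i) x) @[k --> \oo] -->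
  Int (lower i B) - Int (upper i B).
Proof.
move=> wB BD.
have mo C : measurable (obox C.1 C.2 : set 'rV[R]_n) by exact: measurable_obox.
have mw : measurable_fun setT w by apply/measurable_EFinP; exact: measurable_int wi.
have -> : Int (lower i B) - Int (upper i B) =
    \int[mu]_x (w x * (\1_(obox (lower i B).1 (lower i B).2) x -
                       \1_(obox (upper i B).1 (upper i B).2) x)).
  rewrite -(Rintegral_obox_hbox (lower i B)) -(Rintegral_obox_hbox (upper i B)).
  rewrite -(Rintegral_indicM mu w (mo (lower i B))) -(Rintegral_indicM mu w (mo (upper i B))).
  rewrite -RintegralB//.
  - by apply: eq_Rintegral => x _; rewrite mulrBr.
  - by apply: integrable_mul_indic => //; exact: integrableST.
  - by apply: integrable_mul_indic => //; exact: integrableST.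
apply: (@Rintegral_dominated_cvg _ _ _ _ _ _ (fun x => `|w x|)).
- move=> k; apply: measurable_funM => //; apply: continuous_measurable_rV.
  exact: (C1_box_test (cutoff_bounds k) wB i).2.
- by apply: measurable_funM => //; apply: measurable_funB; exact: measurable_indic.
- by move=> x; apply: cvgMr; exact: cvg_derive_box_test.
- exact: (integrable_norm wi).
- move=> k x; rewrite normrM ler_piMr// normr_derive_box_test_le1//.
  exact: cutoff_bounds.
Qed.

(** Halving a family of non-overlapping boxes in a given direction changes the
integrals of [w] by an amount controlled by the variation of [w] in that
direction: the differences of the integrals over the two halves are limits of
[w] tested against the sum of the signed tent functions of the boxes, which is
bounded by half of the largest width. *)
Lemma halving_le (L : seq box) i (l : R) : 0 < l ->
  (forall B, B \in L -> [/\ forall j, 0 < width B j, obox B.1 B.2 `<=` D & width B i <= l]) ->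
  (forall x, \sum_(B <- L) \1_(hbox B.1 B.2) x <= 1 :> R) ->
  \sum_(B <- L) `|Int (lower i B) - Int (upper i B)| <= l / 2 * dvar mu D w i.
Proof.
move=> l0 LP Ldisj; rewrite big_tnth.
pose C k : box := tnth (in_tuple L) k.
have CL k : C k \in L by exact: mem_tnth.
have wC k j : 0 < width (C k) j by have [] := LP _ (CL k).
have CD k : obox (C k).1 (C k).2 `<=` D by have [] := LP _ (CL k).
have Cl k : width (C k) i <= l by have [] := LP _ (CL k).
pose s k : R := Num.sg (Int (lower i (C k)) - Int (upper i (C k))).
pose Phi m x := \sum_(k < size L) s k * box_test (cutoff m) (C k) i x.
have PhiC1 m : C1 (Phi m).
  by apply: C1_sum => k; apply: C1_Z; apply: C1_box_test => //; exact: cutoff_bounds.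
have Phics m : compact_support D (Phi m).
  apply: compact_support_sum => k; apply: compact_support_Z.
  by apply: compact_support_box_test => //; exact: cutoff_bounds.
have l20 : 0 < l / 2 by rewrite divr_gt0.
have Phile m x : `|Phi m x| <= l / 2.
  rewrite (le_trans (ler_norm_sum _ _ _))//.
  apply: (@le_trans _ _ (\sum_(k < size L) l / 2 * \1_(hbox (C k).1 (C k).2) x)).
    apply: ler_sum => k _; rewrite normrM.
    have h := normr_box_test_le (cutoff_bounds m) (wC k) i x.
    apply: (le_trans (ler_piMl _ _)) => //; first by rewrite normr_sg lern1; case: (_ != 0).
    by rewrite (le_trans h)// ler_wpM2r// ler_pM2r ?invr_gt0.
  rewrite -mulr_sumr ler_piMr ?(ltW l20)//.
  by have := Ldisj x; rewrite big_tnth.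
have test m : scalar_test D (fun x => (l / 2)^-1 * Phi m x).
  split; [exact: C1_Z|exact: compact_support_Z|move=> x].
  by rewrite normrM gtr0_norm ?invr_gt0// ler_pdivrMl// mulr1.
have lim : \int[mu]_x (w x * 'D_(e i) (Phi m) x) @[m --> \oo] -->
    \sum_(k < size L) `|Int (lower i (C k)) - Int (upper i (C k))|.
  have E m : \int[mu]_x (w x * 'D_(e i) (Phi m) x) =
      \sum_(k < size L) s k * \int[mu]_x (w x * 'D_(e i) (box_test (cutoff m) (C k) i) x).
    have C1t k : C1 (box_test (cutoff m) (C k) i).
      by apply: C1_box_test => //; exact: cutoff_bounds.
    have ti k : mu.-integrable setT (EFin \o (fun x => w x * 'D_(e i) (box_test (cutoff m) (C k) i) x)).
      apply: (integrable_mul_derive wi _ (C1t k)).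
      by apply: (@compact_support_box_test _ _ _ _ D) => //; exact: cutoff_bounds.
    rewrite (@eq_Rintegral _ _ _ _ _ (fun x => \sum_(k < size L) s k * (w x * 'D_(e i) (box_test (cutoff m) (C k) i) x))).
      rewrite Rintegral_sum//; last by move=> k; exact: integrableZl_EFin.
      by apply: eq_bigr => k _; rewrite RintegralZl.
    move=> x _; rewrite derive_C1_sum; last by move=> k; exact: C1_Z.
    rewrite mulr_sumr; apply: eq_bigr => k _.
    by rewrite derive_C1Z// mulrCA.
  under eq_fun do rewrite E.
  have sgE k : `|Int (lower i (C k)) - Int (upper i (C k))| =
      s k * (Int (lower i (C k)) - Int (upper i (C k))) by rewrite normrEsg.
  under eq_bigr do rewrite sgE.
  apply: cvg_sum_finite => k.
  by apply: cvgMr; exact: cvg_Rintegral_box_test.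
rewrite -(cvg_lim _ lim)//; apply: limr_le; first by apply/cvg_ex; eexists; exact: lim.
apply: nearW => m; rewrite -ler_pdivrMl//.
have := dvar_ub wi TVfin i (test m); apply: le_trans.
rewrite -RintegralZl//; last exact: (integrable_mul_derive wi _ (PhiC1 m) (Phics m)).
rewrite le_eqVlt; apply/orP; left; apply/eqP; apply: eq_Rintegral => x _.
by rewrite derive_C1Z// mulrCA.
Qed.

End halving.

End box_tests.

(** * Approximation by functions that are constant on boxes *)

Section density.
Context {R : realType} {n : nat} (mu : {measure set 'rV[R]_n -> \bar R}).
Local Notation box := ('rV[R]_n * 'rV[R]_n)%type.
Variables (lev : nat -> seq box) (F : 'rV[R]_n -> R).
Hypothesis lev_disj : forall k x, \sum_(B <- lev k) \1_(hbox B.1 B.2) x <= 1 :> R.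
Hypothesis lev_cover : forall k x, F x != 0 -> exists2 B, B \in lev k & hbox B.1 B.2 x.
Hypothesis lev_refine : forall k B, B \in lev k.+1 ->
  exists2 B', B' \in lev k & hbox B.1 B.2 `<=` hbox B'.1 B'.2.
Hypothesis lev_fine : forall r : R, 0 < r -> exists k, forall m, (k <= m)%N ->
  forall B j, B \in lev m -> width B j < r.
Hypothesis Fi : mu.-integrable setT (EFin \o F).

Definition adapted k (g : 'rV[R]_n -> R) : Prop := forall B, B \in lev k ->
  forall x y, hbox B.1 B.2 x -> hbox B.1 B.2 y -> g x = g y.

Lemma lev_inj k B B' x : B \in lev k -> B' \in lev k ->
  hbox B.1 B.2 x -> hbox B'.1 B'.2 x -> B = B'.
Proof.
move=> Bk B'k Bx B'x; apply/eqP; apply: contraT => BB'.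
have B'r : B' \in rem B (lev k).
  by have := B'k; rewrite (perm_mem (perm_to_rem Bk)) inE eq_sym (negbTE BB').
have := lev_disj k x; rewrite (big_rem B)//= (big_rem B')//=.
rewrite !indicE !mem_set//= leNgt => /negP[]; by rewrite ltrDl ltr_wpDr// sumr_ge0.
Qed.

Lemma adapted_leq k m g : (k <= m)%N -> adapted k g -> adapted m g.
Proof.
move=> /subnK <-; elim: (m - k)%N => // l IH gk B /lev_refine[B' B'l BB'] x y Bx By.
by apply: (IH gk B' B'l); exact: BB'.
Qed.

(** Density is measured with the weight [F], which is the only distance needed for
the sign of [F]; the approximations may take values in the unit interval. *)
Definition approximable (A : set 'rV[R]_n) : Prop := measurable A /\
  forall r : R, 0 < r -> exists k (g : 'rV[R]_n -> R), [/\ measurable_fun setT g,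
    forall x, 0 <= g x <= 1, adapted k g &
    \int[mu]_x (`|F x| * `|\1_A x - g x|) <= r].

Let mF : measurable_fun setT F.
Proof. by apply/measurable_EFinP; exact: measurable_int Fi. Qed.

Let F_integrable_mul (g : 'rV[R]_n -> R) M : measurable_fun setT g ->
  (forall x, `|g x| <= M) -> mu.-integrable setT (EFin \o (fun x => `|F x| * g x)).
Proof.
by move=> mg gM; exact: (integrable_bounded_mul (integrable_norm Fi) mg gM).
Qed.

Let dist_integrable (A : set 'rV[R]_n) (g : 'rV[R]_n -> R) : measurable A -> measurable_fun setT g ->
  (forall x, 0 <= g x <= 1) ->
  mu.-integrable setT (EFin \o (fun x => `|F x| * `|\1_A x - g x|)).
Proof.
move=> mA mg g01; apply: (@F_integrable_mul _ 1).
  by apply: measurableT_comp => //; apply: measurable_funB => //; exact: measurable_indic.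
move=> x; rewrite normr_id indicE; have /andP[? ?] := g01 x.
by case: (x \in A) => /=; rewrite ler_norml; apply/andP; split; lra.
Qed.

Lemma approximable_setD A B : B `<=` A -> approximable A -> approximable B ->
  approximable (A `\` B).
Proof.
move=> BA [mA Aa] [mB Ba]; split; first exact: measurableD.
move=> r r0; have r20 : 0 < r / 2 by rewrite divr_gt0.
have [k [g [mg g01 gk gr]]] := Aa _ r20; have [m [f [mf f01 fm fr]]] := Ba _ r20.
have mgf : measurable_fun setT (fun x => g x * (1 - f x)).
  by apply: measurable_funM => //; exact: measurable_funB.
have gf01 x : 0 <= g x * (1 - f x) <= 1.
  by have /andP[? ?] := g01 x; have /andP[? ?] := f01 x; apply/andP; split; nra.
exists (maxn k m), (fun x => g x * (1 - f x)); split=> //.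
  move=> C Cm x y Cx Cy.
  by rewrite (adapted_leq (leq_maxl k m) gk Cm Cx Cy) (adapted_leq (leq_maxr k m) fm Cm Cx Cy).
have mAB : measurable (A `\` B) by exact: measurableD.
apply: le_trans (_ : \int[mu]_x (`|F x| * `|\1_A x - g x|) +
    \int[mu]_x (`|F x| * `|\1_B x - f x|) <= _); last by rewrite [leRHS]splitr lerD.
rewrite -RintegralD//; [|exact: dist_integrable|exact: dist_integrable].
apply: le_Rintegral => //; first exact: dist_integrable.
  by apply: integrableD_EFin => //; exact: dist_integrable.
move=> x _; rewrite -mulrDr ler_wpM2l//.
have -> : \1_(A `\` B) x = \1_A x * (1 - \1_B x) :> R.
  by rewrite !indicE in_setD; case: (x \in A); case: (x \in B); rewrite /= ?mul0r ?subr0 ?subrr ?mulr1 ?mulr0.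
have -> : \1_A x * (1 - \1_B x) - g x * (1 - f x) =
    (\1_A x - g x) * (1 - \1_B x) - g x * (\1_B x - f x) by ring.
rewrite (le_trans (ler_normB _ _))// !normrM lerD//.
  by rewrite ler_piMr// indicE; case: (x \in B); rewrite ?subr0 ?subrr ?normr0 ?normr1.
by rewrite ler_piMl//; have /andP[? ?] := g01 x; rewrite ger0_norm.
Qed.

Lemma approximable_bigcup (A : nat -> set 'rV[R]_n) : nondecreasing_seq A ->
  (forall i, approximable (A i)) -> approximable (\bigcup_i A i).
Proof.
move=> ndA Aa; have mA i : measurable (A i) by have [] := Aa i.
have mU : measurable (\bigcup_i A i) by exact: bigcup_measurable.
split=> // r r0; have r20 : 0 < r / 2 by rewrite divr_gt0.
have AU i x : A i x -> (\bigcup_i A i) x by exists i.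
have cvA : \int[mu]_x (`|F x| * `|\1_(\bigcup_i A i) x - \1_(A k) x|) @[k --> \oo] -->
    \int[mu]_x (`|F x| * 0).
  apply: (@Rintegral_dominated_cvg _ _ _ _ _ _ (fun x => `|F x|)).
  - move=> k; apply: measurable_funM; first exact: measurableT_comp.
    apply: measurableT_comp => //.
    by apply: measurable_funB; apply: measurable_indic => //; exact: mA.
  - by under eq_fun do rewrite mulr0; exact: measurable_cst.
  - move=> x; apply: cvgMr; apply: cvg_near_cst.
    have [[i _ Aix]|nAx] := pselect ((\bigcup_i A i) x).
      exists i => // k ik /=; rewrite !indicE mem_set ?mem_set ?subrr ?normr0//.
      - by have /subsetPset := ndA _ _ ik; exact.
      - by exists i.
    apply: nearW => k; rewrite !indicE memNset// memNset ?subrr ?normr0//.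
    by apply: contra_not nAx => ?; exists k.
  - exact: (integrable_norm Fi).
  - move=> k x; rewrite normrM normr_id normr_id ler_piMr// !indicE.
    by case: (_ \in _); case: (_ \in _); rewrite ?subrr ?subr0 ?sub0r ?normrN ?normr0 ?normr1.
have [k kr] : exists k, \int[mu]_x (`|F x| * `|\1_(\bigcup_i A i) x - \1_(A k) x|) < r / 2.
  move: cvA; under [X in _ --> X]eq_Rintegral do rewrite mulr0.
  rewrite Rintegral_cst// mul0r => cvA.
  have [N _ /(_ N (leqnn N))] : \forall k \near \oo,
      \int[mu]_x (`|F x| * `|\1_(\bigcup_i A i) x - \1_(A k) x|) < r / 2.
    exact: (cvgr_lt _ cvA).
  by exists N.
have [m [g [mg g01 gm gr]]] := (Aa k).2 _ r20.
exists m, g; split=> //.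
apply: le_trans (_ : \int[mu]_x (`|F x| * `|\1_(\bigcup_i A i) x - \1_(A k) x|) +
    \int[mu]_x (`|F x| * `|\1_(A k) x - g x|) <= _); last first.
  by rewrite [leRHS]splitr lerD// ltW.
have i1 : mu.-integrable setT (EFin \o (fun x => `|F x| * `|\1_(\bigcup_i A i) x - \1_(A k) x|)).
  apply: (dist_integrable mU (measurable_indic (mA k))).
  by move=> x; rewrite indicE; case: (_ \in _); rewrite /= ?ler01 ?lexx.
rewrite -RintegralD//; last exact: dist_integrable.
apply: le_Rintegral => //; first exact: dist_integrable.
  by apply: integrableD_EFin => //; exact: dist_integrable.
by move=> x _; rewrite -mulrDr ler_wpM2l// ler_distD.
Qed.

(** An open set is exhausted by the boxes that it contains. *)
Lemma approximable_open (O : set 'rV[R]_n) : open O -> approximable O.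
Proof.
move=> oO; have mO : measurable O by exact: open_measurable_rV.
split=> // r r0.
pose S k := \big[setU/set0]_(B <- lev k | `[< hbox B.1 B.2 `<=` O >]) hbox B.1 B.2.
have SE k x : S k x <-> exists B, [/\ B \in lev k, hbox B.1 B.2 `<=` O & hbox B.1 B.2 x].
  rewrite /S -bigcup_seq_cond; split=> [[B /= /andP[Bk /asboolP BO] Bx]|[B [Bk BO Bx]]].
    by exists B.
  by exists B => //=; rewrite Bk/=; apply/asboolP.
have mS k : measurable (S k).
  by apply: bigsetU_measurable => B _; exact: measurable_hbox.
have cvS : \int[mu]_x (`|F x| * `|\1_O x - \1_(S k) x|) @[k --> \oo] -->
    \int[mu]_x (`|F x| * 0).
  apply: (@Rintegral_dominated_cvg _ _ _ _ _ _ (fun x => `|F x|)).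
  - move=> k; apply: measurable_funM; first exact: measurableT_comp.
    apply: measurableT_comp => //.
    by apply: measurable_funB; apply: measurable_indic => //; exact: mS.
  - by under eq_fun do rewrite mulr0; exact: measurable_cst.
  - move=> x; have [Fx0|Fx0] := eqVneq (F x) 0.
      by rewrite Fx0 normr0; under eq_fun do rewrite mul0r; rewrite mul0r; exact: cvg_cst.
    apply: cvgMr; apply: cvg_near_cst.
    have [Ox|nOx] := pselect (O x); last first.
      apply: nearW => k; rewrite !indicE memNset// memNset ?subrr ?normr0//.
      by move=> /SE[B [_ BO Bx]]; apply: nOx; exact: BO.
    have /nbhs_ballP[s /= s0 sO] : nbhs x O by exact: open_nbhs_nbhs.
    have [N Nw] := lev_fine s0.
    exists N => // k Nk /=; rewrite !indicE mem_set// mem_set ?subrr ?normr0//.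
    apply/SE; have [B Bk Bx] := lev_cover k Fx0; exists B; split=> // y By.
    apply: sO; split=> // i j; rewrite ord1 /ball /=.
    have := Nw k Nk B j Bk; have /andP[? ?] := Bx j; have /andP[? ?] := By j.
    by rewrite /width => ?; rewrite ltr_norml; apply/andP; split; lra.
  - exact: (integrable_norm Fi).
  - move=> k x; rewrite normrM normr_id normr_id ler_piMr// !indicE.
    by case: (_ \in _); case: (_ \in _); rewrite ?subrr ?subr0 ?sub0r ?normrN ?normr0 ?normr1.
have [k kr] : exists k, \int[mu]_x (`|F x| * `|\1_O x - \1_(S k) x|) < r.
  move: cvS; under [X in _ --> X]eq_Rintegral do rewrite mulr0.
  rewrite Rintegral_cst// mul0r => cvS.
  have [N _ /(_ N (leqnn N))] : \forall k \near \oo,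
      \int[mu]_x (`|F x| * `|\1_O x - \1_(S k) x|) < r by exact: (cvgr_lt _ cvS).
  by exists N.
exists k, (\1_(S k)); split; [exact: measurable_indic| | |exact: ltW].
  by move=> x; rewrite indicE; case: (_ \in _); rewrite /= ?ler01 ?lexx.
move=> B Bk x y Bx By; rewrite !indicE; congr (_%:R); congr nat_of_bool.
suff h u v : hbox B.1 B.2 u -> hbox B.1 B.2 v -> S k u -> S k v.
  by apply/idP/idP => /set_mem ?; apply/mem_set; [exact: (h x y)|exact: (h y x)].
move=> Bu Bv /SE[B' [B'k B'O B'u]]; apply/SE; exists B; split=> //.
by rewrite (lev_inj Bk B'k Bu B'u).
Qed.

(** Approximable sets form a lambda-system that contains the open sets, which are
stable under intersection. *)
Lemma measurable_approximable A : measurable A -> approximable A.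
Proof.
move=> mA; have setIO : setI_closed (@open 'rV[R]_n) by move=> X Y; exact: openI.
have h : <<l (@open 'rV[R]_n) >> `<=` [set X | approximable X].
  apply: smallest_sub; last by move=> X; exact: approximable_open.
  split=> //.
  - by apply: approximable_open; exact: openT.
  - by move=> X Y YX Xa Ya; exact: approximable_setD.
  - by move=> X; exact: approximable_bigcup.
apply: h; rewrite smallest_lambda_system//.
by apply: lambda_system_smallest.
Qed.

(** The [L^1] norm of [F] is recovered from the integrals of [F] over the boxes
of the refining partitions, because its sign is approximated by functions that
are constant on boxes. *)
Lemma L1_le_sum_boxes (K : R) :
  (forall k, \sum_(B <- lev k) `|\int[mu]_(x in hbox B.1 B.2) F x| <= K) ->
  \int[mu]_x `|F x| <= K.
Proof.
move=> FK; apply/ler_addgt0Pr => r r0.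
have r20 : 0 < r / 2 by rewrite divr_gt0.
pose A := [set x | 0 <= F x].
have mA : measurable A.
  rewrite (_ : A = F @^-1` `[0, +oo[); last first.
    by apply/seteqP; split=> x /=; rewrite in_itv/= andbT.
  by rewrite -[X in measurable X]setTI; apply: mF => //; exact: measurable_itv.
have [k [g [mg g01 gk gr]]] := (measurable_approximable mA).2 _ r20.
pose s x := 2 * g x - 1.
have ms : measurable_fun setT s.
  by apply: measurable_funB => //; apply: measurable_funM.
have s1 x : `|s x| <= 1.
  by have /andP[? ?] := g01 x; rewrite /s ler_norml; apply/andP; split; lra.
have Fsi : mu.-integrable setT (EFin \o (fun x => F x * s x)).
  exact: (integrable_bounded_mul Fi ms s1).
have di : mu.-integrable setT (EFin \o (fun x => `|F x| * `|\1_A x - g x|)).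
  exact: dist_integrable.
have step1 : \int[mu]_x `|F x| <= \int[mu]_x (F x * s x) + 2 * \int[mu]_x (`|F x| * `|\1_A x - g x|).
  rewrite -RintegralZl// -RintegralD//; last exact: integrableZl_EFin.
  apply: le_Rintegral => //; first exact: (integrable_norm Fi).
    by apply: integrableD_EFin => //; exact: integrableZl_EFin.
  move=> x _; rewrite [leLHS](_ : _ = F x * s x + 2 * (F x * (\1_A x - g x))); last first.
    rewrite /s indicE; have [F0|F0] := ger0P (F x).
      by rewrite mem_set//=; ring.
    by rewrite memNset /=; [ring|rewrite /A /= leNgt F0].
  by rewrite lerD2l ler_pM2l// (le_trans (ler_norm _))// normrM.
have step2 : \int[mu]_x (F x * s x) <= K.
  apply: le_trans (FK k).
  rewrite (@eq_Rintegral _ _ _ _ _ (fun x => \sum_(B <- lev k) F x * s x * \1_(hbox B.1 B.2) x)); last first.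
    move=> x _; have [->|Fx0] := eqVneq (F x) 0.
      by rewrite !mul0r big1_seq// => B _; rewrite mul0r.
    rewrite -mulr_sumr; have [B Bk Bx] := lev_cover k Fx0.
    suff -> : \sum_(B <- lev k) \1_(hbox B.1 B.2) x = 1 :> R by rewrite mulr1.
    apply/eqP; rewrite eq_le lev_disj (big_rem B)//= indicE mem_set//= lerDl.
    by rewrite sumr_ge0// => C _; rewrite indicE ler0n.
  have mh (B : box) : measurable (hbox B.1 B.2) by exact: measurable_hbox.
  rewrite Rintegral_sum//; last first.
    by move=> B; apply: integrable_mul_indic => //; exact: integrableST.
  rewrite big_seq [leRHS]big_seq; apply: ler_sum => B Bk.
  rewrite Rintegral_indicM//.
  have [[x0 Bx0]|nB] := pselect (exists x, hbox B.1 B.2 x); last first.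
    rewrite (_ : hbox _ _ = set0) ?Rintegral_set0//.
    by apply/seteqP; split=> // x Bx; apply: nB; exists x.
  rewrite (@eq_Rintegral _ _ _ _ _ (fun x => F x * s x0)); last first.
    by move=> x /set_mem Bx; rewrite /s (gk B Bk x x0).
  rewrite RintegralZr//; last exact: integrableST.
  by rewrite (le_trans (ler_norm _))// normrM ler_piMr.
rewrite (le_trans step1)// lerD//; lra.
Qed.

End density.

(** * Oscillation over the boxes of a partition *)

Lemma lebesgue_obox (R : realType) n (a b : 'rV[R]_n) : (forall i, a 0 i <= b 0 i) ->
  lebesgue_rV R n (obox a b) = (\prod_(i < n) (b 0 i - a 0 i))%:E.
Proof.
move=> ab; have mo := measurable_obox a b; have mc := measurable_cbox a b.
have <- : lebesgue_rV R n (cbox a b) = (\prod_(i < n) (b 0 i - a 0 i))%:E.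
  exact: lebesgue_rV_box.
have null : lebesgue_rV R n (cbox a b `\` obox a b) = 0%E.
  by apply: boundary_box_null (@subset_refl _ _); exact: measurableD.
have inter : lebesgue_rV R n (cbox a b `&` obox a b) = lebesgue_rV R n (obox a b).
  by rewrite setIC setIidl//; exact: sub_obox_cbox.
have split : lebesgue_rV R n (cbox a b) =
    (lebesgue_rV R n (cbox a b `\` obox a b) + lebesgue_rV R n (cbox a b `&` obox a b))%E.
  exact: measureDI.
by rewrite split null inter add0e.
Qed.

Section refinement.
Context {R : realType} {n : nat} (mu : {measure set 'rV[R]_n -> \bar R}).
Local Notation box := ('rV[R]_n * 'rV[R]_n)%type.
Variables (D : set 'rV[R]_n) (w F : 'rV[R]_n -> R).
Hypothesis mu_null : forall X, measurable X -> lebesgue_rV R n X = 0%E -> mu X = 0%E.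
Hypothesis mu_sub : forall X, X `<=` D -> mu X = lebesgue_rV R n X.
Hypothesis wi : mu.-integrable setT (EFin \o w).
Hypothesis Fi : mu.-integrable setT (EFin \o F).
Hypothesis TVfin : (TV mu D w < +oo)%E.
Implicit Types (B C : box) (L : seq box) (i j : 'I_n) (l h : R).

Local Notation Int f B := (\int[mu]_(x in hbox B.1 B.2) f x).
Local Notation cover L x := (\sum_(B <- L) \1_(hbox B.1 B.2) x : R).

Definition refine i L : seq box := flatten [seq [:: lower i B; upper i B] | B <- L].
Definition refine_all (s : seq 'I_n) L : seq box := foldl (fun L i => refine i L) L s.
Definition level L k : seq box := iter k (refine_all (enum 'I_n)) L.

Lemma big_refine i L (f : box -> R) :
  \sum_(B <- refine i L) f B = \sum_(B <- L) (f (lower i B) + f (upper i B)).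
Proof.
rewrite /refine big_flatten /= big_map; apply: eq_bigr => B _.
by rewrite !big_cons big_nil addr0.
Qed.

Lemma refineP i L B : B \in refine i L ->
  exists2 C, C \in L & B = lower i C \/ B = upper i C.
Proof.
move=> /flattenP[s /mapP[C CL ->]]; rewrite !inE => /orP[|] /eqP ->; exists C => //.
  by left.
by right.
Qed.

(** Since the two halves of a box have the same measure, passing from [w] to [F],
which differs from it by a constant on the box, does not alter the difference of
the integrals over the halves. *)
Definition good L : Prop := forall B, B \in L ->
  [/\ forall j, 0 < width B j, obox B.1 B.2 `<=` D &
      exists c, forall x, obox B.1 B.2 x -> F x = w x - c].

Lemma mid_bounds B i : 0 < width B i -> B.1 0 i < mid B i < B.2 0 i.
Proof. by rewrite /width /mid => ?; apply/andP; split; lra. Qed.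

Lemma lowerP B i x : 0 < width B i ->
  hbox (lower i B).1 (lower i B).2 x <-> hbox B.1 B.2 x /\ x 0 i < mid B i.
Proof.
move=> /mid_bounds/andP[m1 m2]; split=> [xl|[xB xm] j /=]; last first.
  by rewrite mxE; case: eqP => [->|_]; [rewrite xm; have /andP[-> _] := xB i|exact: xB].
split; last by have := xl i; rewrite /= mxE eqxx => /andP[].
move=> j; have := xl j; rewrite /= mxE; case: eqP => [->|//].
by move=> /andP[-> xm] /=; exact: lt_trans m2.
Qed.

Lemma upperP B i x : 0 < width B i ->
  hbox (upper i B).1 (upper i B).2 x <-> hbox B.1 B.2 x /\ mid B i <= x 0 i.
Proof.
move=> /mid_bounds/andP[m1 m2]; split=> [xl|[xB xm] j /=]; last first.
  by rewrite mxE; case: eqP => [->|_]; [rewrite xm; have /andP[_ ->] := xB i|exact: xB].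
split; last by have := xl i; rewrite /= mxE eqxx => /andP[].
move=> j; have := xl j; rewrite /= mxE; case: eqP => [->|//].
by move=> /andP[xm ->]; rewrite (le_trans (ltW m1)).
Qed.

Lemma sub_obox_lower B i : 0 < width B i ->
  obox (lower i B).1 (lower i B).2 `<=` obox B.1 B.2.
Proof.
move=> /mid_bounds/andP[m1 m2] x xl j; have := xl j; rewrite /= mxE; case: eqP => [->|//].
by move=> /andP[-> xm] /=; exact: lt_trans m2.
Qed.

Lemma sub_obox_upper B i : 0 < width B i ->
  obox (upper i B).1 (upper i B).2 `<=` obox B.1 B.2.
Proof.
move=> /mid_bounds/andP[m1 m2] x xl j; have := xl j; rewrite /= mxE; case: eqP => [->|//].
by move=> /andP[xm ->]; rewrite andbT (lt_trans m1).
Qed.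

Lemma indic_halves B i x : 0 < width B i -> \1_(hbox B.1 B.2) x =
  \1_(hbox (lower i B).1 (lower i B).2) x + \1_(hbox (upper i B).1 (upper i B).2) x :> R.
Proof.
move=> wB; rewrite !indicE.
have [xB|xB] := pselect (hbox B.1 B.2 x); last first.
  by rewrite !memNset ?addr0//; [move=> /(upperP x wB)[]|move=> /(lowerP x wB)[]].
rewrite (mem_set xB); have [xm|xm] := ltP (x 0 i) (mid B i).
  rewrite mem_set; last by apply/lowerP.
  by rewrite memNset ?addr0//; move=> /(upperP x wB)[_]; rewrite leNgt xm.
rewrite memNset; last by move=> /(lowerP x wB)[_]; rewrite ltNge xm.
by rewrite mem_set ?add0r//; apply/upperP.
Qed.

Lemma good_refine i L : good L -> good (refine i L).
Proof.
move=> gL B /refineP[C /gL[wC CD [c Fc]]] [] ->; split.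
- by move=> j; rewrite width_lower; case: ifP => _; rewrite ?divr_gt0.
- exact: subset_trans (sub_obox_lower (wC i)) CD.
- by exists c => x /(sub_obox_lower (wC i)); exact: Fc.
- by move=> j; rewrite width_upper; case: ifP => _; rewrite ?divr_gt0.
- exact: subset_trans (sub_obox_upper (wC i)) CD.
- by exists c => x /(sub_obox_upper (wC i)); exact: Fc.
Qed.

Lemma cover_refine i L x : good L -> cover (refine i L) x = cover L x.
Proof.
move=> gL; rewrite big_refine big_seq [RHS]big_seq; apply: eq_bigr => B /gL[wB _ _].
by rewrite -indic_halves.
Qed.

Lemma halves_same_measure B i : (forall j, 0 < width B j) -> obox B.1 B.2 `<=` D ->
  mu (obox (lower i B).1 (lower i B).2) = mu (obox (upper i B).1 (upper i B).2).
Proof.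
move=> wB BD; have wi' := wB i.
rewrite !mu_sub; [|exact: subset_trans (sub_obox_upper wi') BD
                  |exact: subset_trans (sub_obox_lower wi') BD].
rewrite !lebesgue_obox.
- congr EFin; apply: eq_bigr => j _; rewrite -![_ 0 j - _]/(width _ j).
  by rewrite width_lower width_upper.
- by move=> j; rewrite -subr_ge0 -[_ - _]/(width _ j) width_upper; case: ifP => _; rewrite ?divr_ge0 ?ltW.
- by move=> j; rewrite -subr_ge0 -[_ - _]/(width _ j) width_lower; case: ifP => _; rewrite ?divr_ge0 ?ltW.
Qed.

Lemma Int_halves B i : (forall j, 0 < width B j) ->
  Int F B = Int F (lower i B) + Int F (upper i B).
Proof.
move=> wB; have mh C : measurable (hbox C.1 C.2 : set 'rV[R]_n) by exact: measurable_hbox.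
have Fh C : mu.-integrable setT (EFin \o (fun x => F x * \1_(hbox C.1 C.2) x)).
  by apply: integrable_mul_indic => //; exact: integrableST.
rewrite -(Rintegral_indicM mu F (mh B)) -(Rintegral_indicM mu F (mh (lower i B))).
rewrite -(Rintegral_indicM mu F (mh (upper i B))) -RintegralD//.
by apply: eq_Rintegral => x _; rewrite -mulrDr -indic_halves.
Qed.

Lemma Int_halves_diff B i : (forall j, 0 < width B j) -> obox B.1 B.2 `<=` D ->
  (exists c, forall x, obox B.1 B.2 x -> F x = w x - c) ->
  Int F (lower i B) - Int F (upper i B) = Int w (lower i B) - Int w (upper i B).
Proof.
move=> wB BD [c Fc].
have mo C : measurable (obox C.1 C.2 : set 'rV[R]_n) by exact: measurable_obox.
have fin C : obox C.1 C.2 `<=` obox B.1 B.2 -> (mu (obox C.1 C.2) < +oo)%E.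
  move=> CB; rewrite mu_sub; last exact: subset_trans CB BD.
  rewrite (@le_lt_trans _ _ (lebesgue_rV R n (cbox B.1 B.2)))//.
    apply: le_measure; rewrite ?inE//; first exact: measurable_cbox.
    exact: subset_trans CB (@sub_obox_cbox _ _ _ _).
  by rewrite -ge0_fin_numE//; exact: cbox_fin_num.
have E C : obox C.1 C.2 `<=` obox B.1 B.2 ->
    Int F C = Int w C - c * fine (mu (obox C.1 C.2)).
  move=> CB; rewrite -(Rintegral_obox_hbox mu_null wi C) -(Rintegral_obox_hbox mu_null Fi C).
  rewrite -Rintegral_cst// -RintegralB//.
  - by apply: eq_Rintegral => x /set_mem /CB/Fc.
  - exact: integrableST.
  - apply: measurable_bounded_integrable => //; first exact: fin.
    exact: bounded_cst.
have wBi := wB i.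
rewrite !E; [|exact: sub_obox_upper|exact: sub_obox_lower].
rewrite (halves_same_measure i wB BD).
by move: (Int w _) (Int w _) (fine _) => u v m; ring.
Qed.

(** If [p] and [q] are the integrals of [F] over the two halves of a box, then
[|p| + |q|] is at most [|p + q| + |p - q|], and [p - q] is estimated by the
variation of [w] in direction [i]. *)
Lemma sum_refine_le i L l : 0 < l -> good L -> (forall B, B \in L -> width B i <= l) ->
  (forall x, cover L x <= 1) ->
  \sum_(B <- refine i L) `|Int F B| <= \sum_(B <- L) `|Int F B| + l / 2 * dvar mu D w i.
Proof.
move=> l0 gL Ll Ldisj; rewrite big_refine.
have LP B : B \in L -> [/\ forall j, 0 < width B j, obox B.1 B.2 `<=` D & width B i <= l].
  by move=> BL; have [? ? _] := gL B BL; split=> //; exact: Ll.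
apply: le_trans (_ : \sum_(B <- L) (`|Int F B| + `|Int w (lower i B) - Int w (upper i B)|) <= _).
  rewrite big_seq [leRHS]big_seq; apply: ler_sum => B /gL[wB BD Bc].
  rewrite (Int_halves i wB) -(Int_halves_diff i wB BD Bc).
  move: (Int F _) (Int F _) => v u.
  have := ler_norm (u + v); have := ler_norm (- (u + v)).
  have := ler_norm (u - v); have := ler_norm (- (u - v)); rewrite !normrN.
  by case: (ger0P u); case: (ger0P v); lra.
rewrite big_split lerD2l; exact: (halving_le mu_null wi TVfin l0 LP Ldisj).
Qed.

Lemma good_refine_all s L : good L -> good (refine_all s L).
Proof. by elim: s L => // i s IH L gL; apply: IH; exact: good_refine. Qed.

Lemma cover_refine_all s L x : good L -> cover (refine_all s L) x = cover L x.
Proof.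
by elim: s L => // i s IH L gL; rewrite /= IH ?cover_refine//; exact: good_refine.
Qed.

Lemma refine_allP s L B : good L -> B \in refine_all s L -> exists C,
  [/\ C \in L, hbox B.1 B.2 `<=` hbox C.1 C.2 & forall j,
      width B j <= width C j /\ (j \in s -> width B j <= width C j / 2)].
Proof.
elim: s L => [L _ BL|i s IH L gL /(IH _ (good_refine gL))[C [/refineP[C' C'L CC'] BC wBC]]].
  by exists B; split=> //.
have [wC' _ _] := gL _ C'L.
have wCC' j : width C j = if j == i then width C' i / 2 else width C' j.
  by case: CC' => ->; rewrite ?width_lower ?width_upper.
exists C'; split=> //.
  by apply: subset_trans BC _; case: CC' => -> x; [move/(lowerP x (wC' i))|move/(upperP x (wC' i))] => -[].
move=> j; have [wj wjs] := wBC j; have C'j := wC' j.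
move: wj wjs; rewrite wCC' inE; case: eqP => [->|_] wj wjs.
  by have := wC' i; split=> [|_]; lra.
by split.
Qed.

Lemma sum_refine_all_le s L l : 0 < l -> good L ->
  (forall B j, B \in L -> width B j <= l) -> (forall x, cover L x <= 1) ->
  \sum_(B <- refine_all s L) `|Int F B| <=
  \sum_(B <- L) `|Int F B| + l / 2 * \sum_(i <- s) dvar mu D w i.
Proof.
move=> l0; elim: s L => [|i s IH] L gL Ll Ldisj; first by rewrite big_nil mulr0 addr0.
rewrite /= big_cons mulrDr addrA.
apply: le_trans (IH _ (good_refine gL) _ _) _.
- move=> B j /refineP[C CL CB]; have [wC _ _] := gL C CL; apply: le_trans (Ll C j CL).
  by have := wC i; case: CB => ->; rewrite ?width_lower ?width_upper; case: eqP => // ->; lra.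
- by move=> x; rewrite cover_refine.
- by rewrite lerD2r; apply: sum_refine_le => // B BL; exact: Ll.
Qed.

Lemma dvar_ge0 i : 0 <= dvar mu D w i.
Proof.
have := dvar_ub wi TVfin i (zero_test D); apply: le_trans.
rewrite (_ : (fun x => _) = cst 0) ?Rintegral_cst ?mul0r//.
by apply/funext => x; rewrite derive_cst mulr0.
Qed.

(** A function whose integral over each box of a partition vanishes and that
differs from [w] by a constant on each box is small in [L^1]: successive
halvings of the boxes of width at most [h] cost [h / 2 + h / 4 + ...] times the
directional variations of [w]. *)
Theorem L1_oscillation_le L h : (0 < n)%N -> 0 < h -> good L ->
  (forall B j, B \in L -> width B j <= h) -> (forall x, cover L x <= 1) ->
  (forall x, F x != 0 -> exists2 B, B \in L & hbox B.1 B.2 x) ->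
  (forall B, B \in L -> Int F B = 0) ->
  \int[mu]_x `|F x| <= h * (Num.sqrt n%:R * fine (TV mu D w)).
Proof.
move=> n0 h0 gL Lh Ldisj LF LF0.
pose V := \sum_(i < n) dvar mu D w i.
have V0 : 0 <= V by apply: sumr_ge0 => i _; exact: dvar_ge0.
apply: (@le_trans _ _ (h * V)); last by rewrite ler_pM2l// sum_dvar_le.
have glev k : good (level L k) by elim: k => // k IH; exact: good_refine_all.
have clev k x : cover (level L k) x = cover L x.
  by elim: k => // k IH; rewrite /= cover_refine_all//; exact: glev.
have hk0 k : 0 < h / 2 ^+ k by rewrite divr_gt0 ?exprn_gt0.
have wlev k B j : B \in level L k -> width B j <= h / 2 ^+ k.
  elim: k B => [|k IH] B; first by rewrite expr0 divr1; exact: Lh.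
  move=> /(refine_allP (glev k))[C [/IH Ck _ /(_ j)[_]]].
  rewrite mem_enum => /(_ isT) wB; rewrite (le_trans wB)//.
  by rewrite exprS invfM mulrA mulrAC ler_pM2r ?invr_gt0.
apply: (@L1_le_sum_boxes _ _ mu (level L) F) => //.
- by move=> k x; rewrite clev.
- move=> k x /LF[B BL Bx].
  apply: contrapT => nB.
  have : cover (level L k) x = 0.
    rewrite big1_seq// => C /andP[_ Ck]; rewrite indicE memNset// => Cx.
    by apply: nB; exists C.
  rewrite clev (big_rem B)//= indicE mem_set//= => /eqP.
  by rewrite gt_eqF// ltr_wpDr// sumr_ge0.
- by move=> k B /(refine_allP (glev k))[C [Ck BC _]]; exists C.
- move=> r r0; exists (Num.bound (h / r)) => m km B j /wlev/le_lt_trans; apply.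
  rewrite ltr_pdivrMr ?exprn_gt0// mulrC -ltr_pdivrMr//.
  have hr : h / r < (Num.bound (h / r))%:R by apply: archi_boundP; rewrite divr_ge0// ltW.
  rewrite (lt_le_trans hr)// -natrX ler_nat (leq_trans km)// ltnW// ltn_expl//.
- move=> k; suff : \sum_(B <- level L k) `|Int F B| <= (1 - (2 ^+ k)^-1) * (h * V).
    move/le_trans; apply; rewrite ler_piMl ?mulr_ge0 ?(ltW h0)//.
  elim: k => [|k IH].
    rewrite expr0 invr1 subrr mul0r big1_seq// => B /andP[_ BL].
    by rewrite LF0// normr0.
  apply: le_trans (sum_refine_all_le _ (hk0 k) (glev k) (wlev k) _) _.
    by move=> x; rewrite clev.
  apply: le_trans (lerD IH (lexx _)) _.
  rewrite (_ : \sum_(i <- enum 'I_n) _ = V); last by rewrite big_enum.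
  by rewrite le_eqVlt; apply/orP; left; apply/eqP; rewrite exprS; field; rewrite expf_neq0.
Qed.

End refinement.

(** * Cells, averages and step functions *)

Section cells.
Context {R : realType} {d : nat} {U : completeNormedModType R} (P : ocp d U).
Context (D : discretization R d).
Hypothesis Obd : bounded_set (Omega P).
Hypothesis cubes : cube_partition P D.
Local Notation lam := (lebesgue_rV R d).
Local Notation mu := (leb P).
Local Notation Q := (@cell R d D).
Local Notation N := (ncells D).
Implicit Types (c z : 'rV[R]_N) (w g : 'rV[R]_d -> R) (k i : 'I_N).

Lemma leb_setT_lty : (mu setT < +oo)%E.
Proof.
have [M [_ /(_ (M + 1))]] := Obd; rewrite ltrDl ltr01 => /(_ isT) OM.
have O_sub : Omega P `<=` cbox (const_mx (- (M + 1))) (const_mx (M + 1)).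
  move=> x /OM /= xM i; rewrite !mxE -ler_norml.
  exact: le_trans (coord_le_norm x i) xM.
rewrite /leb /= /mrestr setTI.
rewrite (@le_lt_trans _ _ (lam (cbox (const_mx (- (M + 1))) (const_mx (M + 1)))))//.
  apply: le_measure; rewrite ?inE//; [exact: measurable_Omega|exact: measurable_cbox].
by rewrite -ge0_fin_numE//; exact: cbox_fin_num.
Qed.

Lemma leb_lty A : measurable A -> (mu A < +oo)%E.
Proof.
move=> mA; apply: le_lt_trans leb_setT_lty.
by apply: le_measure; rewrite ?inE.
Qed.

Lemma leb_fin_num A : measurable A -> mu A \is a fin_num.
Proof. by move=> mA; rewrite ge0_fin_numE//; exact: leb_lty. Qed.

Lemma integrable_cst_leb A (r : R) : measurable A -> mu.-integrable A (EFin \o cst r).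
Proof.
move=> mA; apply: measurable_bounded_integrable => //; first exact: leb_lty.
exact: bounded_cst.
Qed.

Lemma bounded_integrable_leb g (M : R) : measurable_fun setT g ->
  (forall x, `|g x| <= M) -> mu.-integrable setT (EFin \o g).
Proof.
move=> mg gM; have := integrable_bounded_mul (integrable_cst_leb 1 measurableT) mg gM.
by apply: eq_integrable => // x _ /=; rewrite mul1r.
Qed.

Lemma Lfun2_integrable g : g \in Lfun mu 2%:E -> mu.-integrable setT (EFin \o g).
Proof.
move=> /(Lfun_subset12 (leb_fin_num measurableT)).
by move/Lfun1_integrable.
Qed.

Lemma measurable_Lfun p g : g \in Lfun mu p -> measurable_fun setT g.
Proof. by rewrite inE => /andP[]; rewrite inE. Qed.

Lemma bounded_Lfun2 g (M : R) : measurable_fun setT g ->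
  (forall x, `|g x| <= M) -> g \in Lfun mu 2%:E.
Proof.
move=> mg gM; rewrite inE; apply/andP; split; rewrite inE//=.
rewrite /finite_norm unlock; apply: poweR_lty.
rewrite (@le_lt_trans _ _ (\int[mu]_x ((`|M| `^ 2)%:E))%E)//.
  apply: ge0_le_integral => //.
  - by move=> x _; rewrite poweR_ge0.
  - apply/measurable_EFinP; apply: (@measurableT_comp _ _ _ _ _ _ (fun x : R => x `^ 2)).
      exact: measurable_powR.
    exact: measurableT_comp.
  - move=> x _ /=; rewrite lee_fin ge0_ler_powR// ?nnegrE//.
    exact: le_trans (gM x) (ler_norm _).
by rewrite integral_cst//= lte_mul_pinfty ?lee_fin ?powR_ge0//; exact: leb_setT_lty.
Qed.

(** Cells are open cubes together with some of their boundary points. *)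
Lemma cell_box : exists a : 'I_N -> 'rV[R]_d, exists s : 'I_N -> R,
  forall k, [/\ 0 < s k <= mesh_size D, measurable (Q k), Q k `<=` Omega P,
    obox (a k) (a k + const_mx (s k)) `<=` Q k &
    Q k `<=` cbox (a k) (a k + const_mx (s k))].
Proof.
have [_ QO [s [sQ sh _]]] := cubes.
have /choice[a aQ] k : exists a : 'rV[R]_d, obox a (a + const_mx (s k)) `<=` Q k /\
    Q k `<=` cbox a (a + const_mx (s k)).
  have [_ _ [a [oQ Qc]]] := sQ k; exists a; split=> x.
    by move=> ox; apply: oQ => i; have := ox i; rewrite !mxE.
  by move=> /Qc cx i; have := cx i; rewrite !mxE.
exists a, s => k; have [s0 mQ _] := sQ k; have [? ?] := aQ k; split=> //.
  by rewrite s0 sh.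
by rewrite -QO; exact: bigcup_sup.
Qed.

Lemma measurable_cell k : measurable (Q k).
Proof. by have [a [s /(_ k)[]]] := cell_box. Qed.

Lemma sub_cell_Omega k : Q k `<=` Omega P.
Proof. by have [a [s /(_ k)[]]] := cell_box. Qed.

Lemma mesh_gt0 : 0 < mesh_size D.
Proof.
have [_ _ [s [sQ _ [k <-]]]] := cubes; by have [] := sQ k.
Qed.

Lemma cell_measure_gt0 k : 0 < fine (mu (Q k)).
Proof.
have [a [s /(_ k)[/andP[s0 _] mQ QO oQ Qc]]] := cell_box.
rewrite -lte_fin fineK ?leb_fin_num// leb_sub//.
apply: (@lt_le_trans _ _ (lam (obox (a k) (a k + const_mx (s k))))).
  rewrite lebesgue_obox; last by move=> i; rewrite !mxE lerDl ltW.
  by rewrite lte_fin prodr_gt0// => i _; rewrite !mxE; lra.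
by apply: le_measure; rewrite ?inE//; exact: measurable_obox.
Qed.

Lemma cell_inj k i x : Q k x -> Q i x -> k = i.
Proof.
have [tQ _ _] := cubes; move=> kx ix; apply: contrapT => ki.
by have /trivIsetP/(_ k i I I) := tQ; move=> /(_ (introN eqP ki)) /seteqP[/(_ x (conj kx ix))].
Qed.

Lemma cell_cover x : Omega P x -> exists k, Q k x.
Proof. by have [_ <- _] := cubes; move=> [k _ kx]; exists k. Qed.

Lemma step_cell c k x : Q k x -> step D c x = c 0 k.
Proof.
move=> kx; rewrite /step (bigD1 k)//= indicE mem_set// mulr1 big1 ?addr0// => i ik.
rewrite indicE memNset ?mulr0// => ix; move/eqP: ik; apply.
exact: cell_inj ix kx.
Qed.

Lemma step_notin c x : ~ Omega P x -> step D c x = 0.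
Proof.
move=> Ox; rewrite /step big1// => k _; rewrite indicE memNset ?mulr0//.
by apply: contra_not Ox; exact: sub_cell_Omega.
Qed.

Lemma measurable_step c : measurable_fun setT (step D c).
Proof.
rewrite /step; apply: measurable_sum => k; apply: measurable_funM => //.
by apply: measurable_indic; exact: measurable_cell.
Qed.

Lemma normr_step_le c x : `|step D c x| <= `|c|.
Proof.
have [Ox|Ox] := pselect (Omega P x); last by rewrite step_notin// normr0.
by have [k kx] := cell_cover Ox; rewrite (step_cell c kx); exact: coord_le_norm.
Qed.

Lemma step_integrable c : mu.-integrable setT (EFin \o step D c).
Proof. exact: (bounded_integrable_leb (measurable_step c) (normr_step_le c)). Qed.

Lemma step_Lfun2 c : step D c \in Lfun mu 2%:E.
Proof. exact: (bounded_Lfun2 (measurable_step c) (normr_step_le c)). Qed.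

Lemma step_Lfun1 c : step D c \in Lfun mu 1.
Proof. by apply/Lfun1_integrable; exact: step_integrable. Qed.

Lemma avg_step c k : avg P D (step D c) k = c 0 k.
Proof.
rewrite /avg (@eq_Rintegral _ _ _ _ _ (cst (c 0 k))); last first.
  by move=> x /set_mem; exact: step_cell.
rewrite Rintegral_cst; last exact: measurable_cell.
by rewrite mulrC mulfK// gt_eqF// cell_measure_gt0.
Qed.

Lemma row_avg_step c : \row_i avg P D (step D c) i = c.
Proof. by apply/rowP => k; rewrite mxE avg_step. Qed.

Lemma stepD c1 c2 (t1 t2 : R) :
  step D (t1 *: c1 + t2 *: c2) = (fun x => t1 * step D c1 x + t2 * step D c2 x).
Proof.
apply/funext => x; rewrite /step !mulr_sumr -big_split /=; apply: eq_bigr => k _.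
by rewrite !mxE; ring.
Qed.

Lemma stepB c1 c2 : step D c1 \- step D c2 = step D (c1 - c2).
Proof.
apply/funext => x; rewrite /step /= -sumrB; apply: eq_bigr => k _.
by rewrite !mxE mulrBl.
Qed.

Lemma stepM c1 c2 : step D c1 \* step D c2 = step D (\row_k (c1 0 k * c2 0 k)).
Proof.
apply/funext => x /=; have [Ox|Ox] := pselect (Omega P x); last first.
  by rewrite !step_notin// mulr0.
by have [k kx] := cell_cover Ox; rewrite !(step_cell _ kx) mxE.
Qed.

Lemma BV_step c : BV mu (Omega P) (step D c).
Proof.
split; first exact: step_Lfun1.
apply: TV_step_lty => k; first exact: sub_cell_Omega.
by have [_ _ [s [/(_ k) ? _ _]]] := cubes; exists (s k).
Qed.

End cells.

(** * The error of averaging over the cells *)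

Lemma Lfun2B d (T : measurableType d) (R : realType)
    (mu : {measure set T -> \bar R}) (f g : T -> R) :
  f \in Lfun mu 2%:E -> g \in Lfun mu 2%:E -> f \- g \in Lfun mu 2%:E.
Proof.
move=> f2 g2; have p1 : (1 <= 2%:E :> \bar R)%E by rewrite lee_fin ler1n.
have [_ D] := Lfun_addr_closed mu p1.
exact: (D _ _ f2 (Lfun_oppr_closed g2)).
Qed.

Section projection.
Context {R : realType} {d : nat} {U : completeNormedModType R} (P : ocp d U).
Context (D : discretization R d).
Hypothesis Obd : bounded_set (Omega P).
Hypothesis cubes : cube_partition P D.
Local Notation lam := (lebesgue_rV R d).
Local Notation mu := (leb P).
Local Notation Q := (@cell R d D).
Local Notation N := (ncells D).
Implicit Types (w g : 'rV[R]_d -> R) (k i : 'I_N).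

(** Moving along the diagonal from a point of a half-open box leads into its
interior; hence half-open cubes overlap only if the open cubes, and thus the
cells, do. *)
Lemma hbox_push (a b x : 'rV[R]_d) : hbox a b x -> exists2 r : R, 0 < r &
  forall t, 0 < t < r -> obox a b (x + const_mx t).
Proof.
move=> xab; pose r : R := \big[Num.min/1]_(j < d) (b 0 j - x 0 j).
exists r.
  rewrite /r; apply: (big_ind (fun y => 0 < y)) => //.
    by move=> ? ? ? ?; rewrite lt_min; apply/andP.
  by move=> j _; rewrite subr_gt0; have /andP[] := xab j.
move=> t /andP[t0 tr] j; rewrite !mxE.
have tj : t < b 0 j - x 0 j.
  exact: lt_le_trans tr (bigmin_le 1 j (fun j => b 0 j - x 0 j)).
by have /andP[? ?] := xab j; apply/andP; split; lra.
Qed.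

(** [F] is [w] minus its cell averages, set to zero outside of the half-open cubes;
this modification on a null set makes the cubes a partition of the support of
[F] that can be refined by halving. *)
Theorem projection_L1_le w : (0 < d)%N -> w \in Lfun mu 1 ->
  (TV mu (Omega P) w < +oo)%E ->
  \int[mu]_x `|w x - Ph P D w x| <=
  mesh_size D * (Num.sqrt d%:R * fine (TV mu (Omega P) w)).
Proof.
move=> d0 /Lfun1_integrable wi TVfin.
have [a [s cellP]] := cell_box cubes.
pose b k := a k + const_mx (s k).
pose H k := hbox (a k) (b k).
pose E := \bigcup_(k in [set: 'I_N]) H k.
have mH k : measurable (H k) by exact: measurable_hbox.
have mE : measurable E by apply: fin_bigcup_measurable => //; exact: finite_finset.
have mQ k : measurable (Q k) by exact: (measurable_cell cubes).
have H_inj x k l : H k x -> H l x -> k = l.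
  move=> /hbox_push[r r0 rk] /hbox_push[r' r'0 r'l].
  pose t := Num.min r r' / 2.
  have tr : 0 < t < Num.min r r'.
    by rewrite /t; have : 0 < Num.min r r' by [rewrite lt_min r0]; move=> ?; apply/andP; split; lra.
  have [_ _ _ ok _] := cellP k; have [_ _ _ ol _] := cellP l.
  apply: (cell_inj cubes (x := x + const_mx t)).
    by apply/ok/rk; move: tr; rewrite lt_min => /andP[-> /andP[->]].
  by apply/ol/r'l; move: tr; rewrite lt_min => /andP[-> /andP[_ ->]].
have wPi : mu.-integrable setT (EFin \o (fun x => w x - Ph P D w x)).
  by apply: integrableB_EFin => //; exact: step_integrable.
have mwP : measurable_fun setT (fun x => w x - Ph P D w x).
  by apply/measurable_EFinP; exact: measurable_int wPi.
pose F x := (w x - Ph P D w x) * \1_E x.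
have Fi : mu.-integrable setT (EFin \o F).
  by apply: integrable_mul_indic => //; exact: integrableST.
have Fo k x : obox (a k) (b k) x -> F x = w x - avg P D w k.
  move=> ox; have [_ _ _ ok _] := cellP k.
  rewrite /F indicE mem_set; last by exists k => //; exact: sub_obox_hbox.
  by rewrite mulr1 /Ph (step_cell cubes _ (ok _ ox)) mxE.
have -> : \int[mu]_x `|w x - Ph P D w x| = \int[mu]_x `|F x|.
  apply: ae_eq_Rintegral => //; first exact: measurableT_comp.
    by apply: measurableT_comp => //; apply/measurable_EFinP; exact: measurable_int Fi.
  pose Z := \big[setU/set0]_(k < N) (Q k `\` obox (a k) (b k)).
  have [mZ Z0] : measurable Z /\ mu Z = 0%E.
    apply: (big_ind (fun X => measurable X /\ mu X = 0%E)) => //.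
      by move=> X Y [mX X0] [mY Y0]; split; [exact: measurableU|exact: null_set_setU].
    move=> k _; have [_ _ _ _ Qc] := cellP k.
    have mQo : measurable (Q k `\` obox (a k) (b k)).
      by apply: measurableD => //; exact: measurable_obox.
    split=> //; apply: leb_null => //; apply: (@boundary_box_null _ _ (a k) (b k)) => //.
    exact: setSD.
  have mO := measurable_Omega P.
  exists (Z `|` ~` Omega P); split.
  - by apply: measurableU => //; exact: measurableC.
  - apply: null_set_setU => //; first exact: measurableC.
    by rewrite /leb /= /mrestr setICl measure0.
  - move=> x /= nx; have [Ox|] := pselect (Omega P x); last by right.
    left; have [k kx] := cell_cover cubes Ox.
    rewrite /Z -bigcup_seq; exists k; rewrite /= ?mem_index_enum//; split=> // ox.
    apply: nx; rewrite (Fo k x ox) /Ph (step_cell cubes _ kx) mxE//.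
pose L := [seq (a k, b k) | k <- enum 'I_N].
have LP B : B \in L -> exists k, B = (a k, b k).
  by move=> /mapP[k _ ->]; exists k.
have wk k j : width (a k, b k) j = s k by rewrite /width /= !mxE; ring.
apply: (@L1_oscillation_le _ _ mu (Omega P) w F _ _ wi Fi TVfin L) => //.
- exact: leb_null.
- by move=> X; exact: leb_sub.
- exact: mesh_gt0 cubes.
- move=> B /LP[k ->]; have [/andP[s0 _] _ QO ok _] := cellP k; split=> /=.
  + by move=> j; rewrite wk.
  + exact: subset_trans ok QO.
  + by exists (avg P D w k) => x; exact: Fo.
- by move=> B j /LP[k ->]; rewrite wk; have [/andP[]] := cellP k.
- move=> x; rewrite /L big_map big_enum /=.
  have [[k kx]|nx] := pselect (exists k, H k x); last first.
    rewrite big1// => k _; rewrite indicE memNset// => kx; apply: nx; by exists k.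
  rewrite (bigD1 k)//= indicE mem_set// big1 ?addr0// => l lk.
  by rewrite indicE memNset// => lx; move/eqP: lk; apply; exact: H_inj lx kx.
- move=> x; rewrite /F mulf_eq0 negb_or => /andP[_].
  rewrite indicE pnatr_eq0 eqb0 negbK => /set_mem[k _ kx].
  by exists (a k, b k) => //; apply/mapP; exists k => //; rewrite mem_enum.
- move=> B /LP[k ->] /=; have [_ _ QO ok Qc] := cellP k.
  have wQi (r : R) : mu.-integrable setT (EFin \o (fun x => w x - r)).
    by apply: integrableB_EFin => //; exact: integrable_cst_leb.
  rewrite (@Rintegral_box_eq _ _ mu (a k) (b k) _ (obox (a k) (b k)))//.
  + rewrite (@eq_Rintegral _ _ _ _ _ (fun x => w x - avg P D w k)); last first.
      by move=> x /set_mem; exact: Fo.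
    rewrite (@Rintegral_box_eq _ _ mu (a k) (b k) _ (Q k))//.
    * rewrite RintegralB//; [|exact: integrableST|exact: integrable_cst_leb].
      rewrite Rintegral_cst// /avg mulrAC mulVf ?mul1r ?subrr// gt_eqF//.
      exact: cell_measure_gt0.
    * exact: leb_null.
    * exact: measurable_obox.
    * by apply: integrableST => //; exact: measurable_cbox.
    * exact: sub_obox_cbox.
  + exact: leb_null.
  + exact: measurable_hbox.
  + exact: measurable_obox.
  + by apply: integrableST => //; exact: measurable_cbox.
  + exact: sub_obox_hbox.
  + exact: sub_hbox_cbox.
  + exact: sub_obox_cbox.
Qed.

Lemma L2normE g : g \in Lfun mu 2%:E -> L2norm mu g = Num.sqrt (\int[mu]_x (g x ^+ 2)).
Proof.
move=> g2; rewrite /L2norm unlock.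
have i2 : (\int[mu]_x (`|(EFin \o g) x| `^ 2) = \int[mu]_x (g x ^+ 2)%:E)%E.
  by apply: eq_integral => x _ /=; rewrite powR_mulrn ?normr_ge0// real_normK ?num_real.
have gi := Lfun2_integrable_sqr g2.
have fin : (\int[mu]_x (g x ^+ 2)%:E)%E \is a fin_num.
  by apply: (integrable_fin_num measurableT gi).
rewrite i2 -(fineK fin) /= powR12_sqrt//.
by apply: Rintegral_ge0 => x _; exact: sqr_ge0.
Qed.

(** Interpolation between the essential bound [M] and the [L^1] estimate. *)
Lemma projection_L2_le w (M : R) : (0 < d)%N -> w \in Lfun mu 2%:E ->
  (TV mu (Omega P) w < +oo)%E -> 0 <= M ->
  (\forall x \ae mu, `|w x - Ph P D w x| <= M) ->
  L2norm mu (w \- Ph P D w) <=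
  Num.sqrt (M * (mesh_size D * (Num.sqrt d%:R * fine (TV mu (Omega P) w)))).
Proof.
move=> d0 w2 TVfin M0 wM.
have p2 : Ph P D w \in Lfun mu 2%:E by exact: step_Lfun2.
have g2 : w \- Ph P D w \in Lfun mu 2%:E.
  exact: Lfun2B.
rewrite L2normE//; apply: ler_wsqrtr.
have wi : mu.-integrable setT (EFin \o w) by exact: Lfun2_integrable.
have gi : mu.-integrable setT (EFin \o (w \- Ph P D w)) by exact: Lfun2_integrable.
have ngi := integrable_norm gi.
apply: (@le_trans _ _ (\int[mu]_x (M * `|w x - Ph P D w x|))).
  apply: ae_ge0_le_Rintegral.
  - exact: Lfun2_integrable_sqr g2.
  - exact: integrableZl_EFin.
  - by move=> x; exact: sqr_ge0.
  - apply: filterS wM => x /= xM.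
    by rewrite -real_normK ?num_real// expr2 ler_wpM2r.
rewrite RintegralZl// ler_wpM2l//; apply: projection_L1_le => //.
exact/Lfun1_integrable.
Qed.

End projection.

(** * Transfer between the relaxations and error estimates *)

Section transfer.
Context {R : realType} {d : nat} (hd : (0 < d)%N) {U : completeNormedModType R}.
Context (P : ocp d U) (hP : setting P) (D : discretization R d).
Hypothesis hD : discrete_setting P D.
Hypothesis hPh : forall w, admissible P w -> admissible P (Ph P D w).
Local Notation mu := (leb P).
Local Notation C := (admissible P).
Local Notation N := (ncells D).
Local Notation TVw := (TV mu (Omega P)).
Implicit Types (u : U) (w : 'rV[R]_d -> R) (c z : 'rV[R]_N).

Lemma Omega_bounded : bounded_set (Omega P).
Proof. by have [_ _] := Omega_domain hP. Qed.

Let cubes := cells_partition hD.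

Lemma control_bounds_BV w : C w -> BV mu (Omega P) w -> control_bounds P w.
Proof.
move=> Cw BVw; have [u [uw _]] := state_unique hP Cw BVw.
by have [] := state_control_bounds hP BVw Cw uw.
Qed.

(** The average of an admissible control has bounded variation, so that the bounds
for solutions of the state equation apply to it. *)
Lemma control_bounds_Ph w : C w -> control_bounds P (Ph P D w).
Proof.
move=> Cw; apply: control_bounds_BV; first exact: hPh.
exact: BV_step Omega_bounded cubes _.
Qed.

(** Each McCormick inequality expresses that a product of distances to two of the
bounds is nonnegative. *)
Lemma mccormick_product u c z : (forall i, cell_u_lo i <= avg P D (emb P u) i <= cell_u_up i) ->
  (forall i, cell_w_lo i <= c 0 i <= cell_w_up i) ->
  (forall i, z 0 i = avg P D (emb P u) i * c 0 i) -> mccormick P D u c z.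
Proof.
move=> ub wb zE i; rewrite zE; have /andP[ul uu] := ub i; have /andP[wl wu] := wb i.
split; last by rewrite ul uu.
- have : 0 <= (avg P D (emb P u) i - cell_u_lo i) * (c 0 i - cell_w_lo i).
    by rewrite mulr_ge0 ?subr_ge0.
  by move=> ?; lra.
- have : 0 <= (cell_u_up i - avg P D (emb P u) i) * (cell_w_up i - c 0 i).
    by rewrite mulr_ge0 ?subr_ge0.
  by move=> ?; lra.
- have : 0 <= (cell_u_up i - avg P D (emb P u) i) * (c 0 i - cell_w_lo i).
    by rewrite mulr_ge0 ?subr_ge0.
  by move=> ?; lra.
- have : 0 <= (avg P D (emb P u) i - cell_u_lo i) * (cell_w_up i - c 0 i).
    by rewrite mulr_ge0 ?subr_ge0.
  by move=> ?; lra.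
Qed.

(** The averaged state equation is the relaxed one with [z] the product of the
averages. *)
Lemma averaged_feasible u w : C w -> control_bounds P w -> averaged_state_eq P D u w ->
  McChh_feasible P D (u, \row_i avg P D w i,
    \row_i (avg P D (emb P u) i * avg P D w i)).
Proof.
move=> Cw bw uw; have bds := averaged_bounds hD Cw bw uw.
split; [exact: hPh|exact: control_bounds_Ph| |].
  have zE : \row_i (avg P D (emb P u) i * avg P D w i) =
      \row_k ((\row_i avg P D (emb P u) i) 0 k * (\row_i avg P D w i) 0 k).
    by apply/rowP => k; rewrite !mxE.
  by move=> v; rewrite zE -(stepM cubes); exact: uw.
apply: mccormick_product => i; rewrite ?mxE//; have [? ?] := bds i => //.
Qed.

Lemma McChh_McCh u c z : McChh_feasible P D (u, c, z) ->
  McCh_feasible P D (u, step D c, z).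
Proof. by move=> [Cc bc sc mc]; split=> //; rewrite row_avg_step//; exact: Omega_bounded. Qed.

Lemma McCh_McChh u w z : McCh_feasible P D (u, w, z) ->
  McChh_feasible P D (u, \row_i avg P D w i, z).
Proof. by move=> [Cw bw sw mw]; split=> //; [exact: hPh|exact: control_bounds_Ph]. Qed.

Lemma TV_ge0 w : (0 <= TVw w)%E.
Proof.
have t0 : TV_test (Omega P) (cst 0 : 'rV[R]_d -> 'rV[R]_d).
  split=> [x|v||x].
  - exact: differentiable_cst.
  - have -> : 'D_v (cst 0 : 'rV[R]_d -> 'rV[R]_d) = cst 0.
      by apply/funext => y; rewrite derive_cst.
    exact: cst_continuous.
  - by exists set0; split=> //; exact: compact0.
  - by rewrite big1// => i _; rewrite mxE expr0n.
apply: ereal_sup_ubound; exists (cst 0) => //.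
rewrite (_ : (fun x => _) = cst 0) ?Rintegral_cst ?mul0r//.
apply/funext => x; rewrite /divergence big1 ?mulr0// => i _.
by rewrite derive_cst mxE.
Qed.

Lemma leb_setT_gt0 : (0 < mu setT)%E.
Proof.
have [_ _ [s [_ _ [k _]]]] := cubes.
have mk := measurable_cell cubes k.
apply: (@lt_le_trans _ _ (mu (cell k))); last by apply: le_measure; rewrite ?inE.
have := cell_measure_gt0 Omega_bounded cubes k.
by rewrite -lte_fin fineK//; exact: (leb_fin_num Omega_bounded).
Qed.

Lemma admissible_L2 w : C w -> w \in Lfun mu 2%:E.
Proof. by have [_ + _ _ _] := C_admissible hP; exact. Qed.

Lemma admissible_L1 w : C w -> w \in Lfun mu 1.
Proof.
move=> /admissible_L2; apply: Lfun_subset12.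
exact: (leb_fin_num Omega_bounded).
Qed.

(** The width of the control bounds dominates the projection error pointwise,
since [w] and its average both satisfy these bounds. *)
Lemma projection_error_bound w t : C w -> control_bounds P w -> TVw w = t%:E ->
  exists2 r : R, projection_error P (mesh_size D) w = r%:E &
    L2norm mu (w \- Ph P D w) <= r.
Proof.
move=> Cw bw wt.
have [_ _ lo up] := bounds_spaces hP.
have t0 : 0 <= t by rewrite -lee_fin -wt TV_ge0.
have h0 := mesh_gt0 cubes.
set X := ('N[mu]_+oo[EFin \o (w_up P \- w_lo P)%R])%E.
have muT := leb_setT_gt0.
have wd : w_up P \- w_lo P \in Lfun mu +oo%E.
  have p1 : (1 <= +oo :> \bar R)%E by rewrite leey.
  have [_ DD] := Lfun_addr_closed mu p1.
  exact: (DD _ _ up (Lfun_oppr_closed lo)).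
have X0 : (0 <= X)%E by exact: Lnorm_ge0.
have Xfin : (X < +oo)%E by move: wd; rewrite inE => /andP[_]; rewrite inE.
have wX : \forall x \ae mu, (`|(w_up P \- w_lo P)%R x|%R%:E <= X)%E.
  by rewrite /X unlock muT; exact: ess_sup_inf.ess_sup_ge.
have Xf : X \is a fin_num by rewrite ge0_fin_numE.
pose M := fine X; have M0 : 0 <= M by exact: fine_ge0.
have XM : X = M%:E by rewrite fineK.
have bPw := control_bounds_Ph Cw.
have wM : \forall x \ae mu, `|w x - Ph P D w x| <= M.
  apply: filterS3 wX bw bPw => x; rewrite XM lee_fin /= => xM /andP[? ?] /andP[? ?].
  apply: le_trans xM; apply: le_trans (ler_norm _).
  by rewrite ler_norml; apply/andP; split; lra.
exists (Num.sqrt (M * (mesh_size D * (Num.sqrt d%:R * fine (TVw w))))); last first.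
  apply: projection_L2_le => //; [exact: Omega_bounded|exact: admissible_L2|].
  by rewrite wt ltry.
rewrite /projection_error -/X XM wt !poweR_EFin -!EFinM !powR12_sqrt//=.
rewrite !sqrtrM ?mulr_ge0 ?sqrtr_ge0 ?(ltW h0)//.
by congr EFin; ring.
Qed.

(** The point of [averaged_feasible] has the same state as [(u, w)] and a total
variation that is not larger; its cost differs by the Lipschitz constant times
the projection error. If the total variation of [w] is infinite, then so is the
right-hand side. *)
Lemma value_le_objective u w Lw : C w -> control_bounds P w ->
  averaged_state_eq P D u w -> lipschitz_snd P (McChh_states P D) C Lw ->
  (optimal_value (McChh_feasible P D) (McChh_objective P D) -
   Lw%:E * projection_error P (mesh_size D) w <= OCP_objective P (u, w))%E.
Proof.
move=> Cw bw uw [Lw0 Lip].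
have a0 := alpha_gt0 hP.
have TVw0 := TV_ge0 w.
rewrite /OCP_objective /=.
case Ew : (TVw w) => [t| |]; last by rewrite Ew in TVw0.
  have [r -> wr] := projection_error_bound Cw bw Ew.
  have F := averaged_feasible Cw bw uw.
  rewrite -EFinM leeBlDr// -EFinM -EFinD.
  apply: le_trans (ereal_inf_lbound _) _.
    by eexists; [exact: F|reflexivity].
  rewrite /McChh_objective.
  have Su : McChh_states P D u by exists (\row_i avg P D w i); eexists; exact: F.
  have CPw : C (Ph P D w) by exact: hPh.
  have cost_le : cost P u (Ph P D w) <= cost P u w + Lw * r.
    have := Lip u _ _ Su Cw CPw; rewrite ler_norml => /andP[_] h.
    have : Lw * L2norm mu (w \- Ph P D w) <= Lw * r by rewrite ler_wpM2l.
    have := Lip u _ _ Su Cw CPw; rewrite ler_norml => /andP[? ?] ?; lra.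
  have [_ _ TVhle _] := TVh_approx hD.
  have TVh_t : (TVh D (Ph P D w) <= t%:E)%E.
    by rewrite -Ew; apply: TVhle; exact: admissible_L1.
  apply: (@le_trans _ _ ((cost P u w + Lw * r)%:E + (alpha P)%:E * t%:E)%E).
    by apply: leeD; [rewrite lee_fin|rewrite lee_pmul2l// lte_fin].
  by rewrite -EFinM -EFinD lee_fin; lra.
by rewrite gt0_muley ?lte_fin// addey// leey.
Qed.

(** Replacing the state costs the Lipschitz constant in the first argument. *)
Lemma value_le_objective_state u u' w Lu Lw : C w -> control_bounds P w ->
  averaged_state_eq P D u' w -> lipschitz_snd P (McChh_states P D) C Lw ->
  lipschitz_fst P (McChh_states P D `|` [set u]) C Lu ->
  (optimal_value (McChh_feasible P D) (McChh_objective P D) -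
   (Lu * `|u - u'|)%:E - Lw%:E * projection_error P (mesh_size D) w
   <= OCP_objective P (u, w))%E.
Proof.
move=> Cw bw uw Lips [Lu0 Lipf].
have := value_le_objective Cw bw uw Lips.
set V := optimal_value _ _; set e := (_ * projection_error _ _ _)%E => Ve.
have Su' : McChh_states P D u'.
  by exists (\row_i avg P D w i); eexists; exact: averaged_feasible Cw bw uw.
have := Lipf u u' w (or_intror erefl) (or_introl Su') Cw.
rewrite ler_norml => /andP[cost_le _].
rewrite addeAC leeBlDr//; apply: le_trans Ve _.
rewrite /OCP_objective /= addeAC -EFinD; apply: leeD => //.
by rewrite lee_fin; lra.
Qed.

End transfer.

(** * The state space and its averages *)

Section L2_norms.
Context {R : realType} {d : nat} {U : completeNormedModType R} (P : ocp d U).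
Hypothesis Obd : bounded_set (Omega P).
Local Notation mu := (leb P).
Implicit Types (f g : 'rV[R]_d -> R).

Lemma L2norm_ge0 f : 0 <= L2norm mu f.
Proof. by apply: fine_ge0; exact: Lnorm_ge0. Qed.

Lemma Lnorm2_fin_num f : f \in Lfun mu 2%:E -> 'N[mu]_2%:E[EFin \o f]%E \is a fin_num.
Proof.
by move=> f2; rewrite ge0_fin_numE ?Lnorm_ge0//; move: f2; rewrite inE => /andP[_]; rewrite inE.
Qed.

Lemma ae_eq_L2norm f g : f \in Lfun mu 2%:E -> g \in Lfun mu 2%:E ->
  (\forall x \ae mu, f x = g x) -> L2norm mu f = L2norm mu g.
Proof.
move=> f2 g2 fg; rewrite !L2normE//; congr Num.sqrt.
have mf := measurable_Lfun f2; have mg := measurable_Lfun g2.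
apply: ae_eq_Rintegral => //; [exact: measurable_funX|exact: measurable_funX|].
by apply: filterS fg => x ->.
Qed.

Lemma L2normD f g : f \in Lfun mu 2%:E -> g \in Lfun mu 2%:E ->
  L2norm mu (f \+ g) <= L2norm mu f + L2norm mu g.
Proof.
move=> f2 g2; have mf := measurable_Lfun f2; have mg := measurable_Lfun g2.
have p1 : (1 <= 2%:E :> \bar R)%E by rewrite lee_fin ler1n.
have fg2 : f \+ g \in Lfun mu 2%:E by have [_ /(_ f g f2 g2)] := Lfun_addr_closed mu p1.
have := @minkowski_EFin _ _ _ mu f g 2 mf mg; rewrite ler1n => /(_ isT).
rewrite -(fineK (Lnorm2_fin_num f2)) -(fineK (Lnorm2_fin_num g2)).
by rewrite -(fineK (Lnorm2_fin_num fg2)) -[leRHS]EFinD lee_fin.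
Qed.

Lemma L2normZ f (r : R) : f \in Lfun mu 2%:E ->
  L2norm mu (fun x => r * f x) = `|r| * L2norm mu f.
Proof.
move=> f2; have rf2 : (fun x => r * f x) \in Lfun mu 2%:E.
  rewrite (_ : (fun x => _) = r \o* f); last by apply/funext => x /=; rewrite mulrC.
  by apply: Lfun_scale => //; rewrite ler1n.
rewrite !L2normE// -sqrtr_sqr -sqrtrM ?sqr_ge0//; congr Num.sqrt.
rewrite -RintegralZl//; last exact: Lfun2_integrable_sqr.
by apply: eq_Rintegral => x _; rewrite exprMn.
Qed.

(** Cauchy-Schwarz against the constant function one. *)
Lemma L1_le_L2 f : f \in Lfun mu 2%:E ->
  \int[mu]_x `|f x| <= L2norm mu (cst 1) * L2norm mu f.
Proof.
move=> f2; have mf := measurable_Lfun f2.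
have c2 : cst 1 \in Lfun mu 2%:E.
  by apply: (bounded_Lfun2 Obd) => // x; rewrite normr1.
have fi := Lfun2_integrable Obd f2.
have := @hoelder _ _ _ mu (cst 1) f 2 2 (measurable_cst _) mf.
rewrite !ltr0n => /(_ isT isT); rewrite -div1r -splitr => /(_ erefl).
rewrite Lnorm1 -(fineK (Lnorm2_fin_num c2)) -(fineK (Lnorm2_fin_num f2)) -[leRHS]EFinM.
have fin : (\int[mu]_x (`|f x|%R)%:E)%E \is a fin_num.
  by apply: (integrable_fin_num measurableT); exact: (integrable_norm fi).
have -> : (\int[mu]_x `|(EFin \o (cst 1 \* f)%R) x| = \int[mu]_x (`|f x|%R)%:E)%E.
  by apply: eq_integral => x _ /=; rewrite mul1r.
by rewrite -(fineK fin) lee_fin.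
Qed.

End L2_norms.

Section states.
Context {R : realType} {d : nat} {U : completeNormedModType R} (P : ocp d U).
Hypothesis Obd : bounded_set (Omega P).
Hypothesis cemb : compact_embedding P.
Context (D : discretization R d).
Hypothesis cubes : cube_partition P D.
Local Notation mu := (leb P).
Local Notation Q := (@cell R d D).
Local Notation N := (ncells D).
Implicit Types (u v : U) (c z : 'rV[R]_N) (i : 'I_N).

Lemma emb_L2 u : emb P u \in Lfun mu 2%:E.
Proof. by have [+ _ _ _ _] := cemb; exact. Qed.

Lemma emb_integrable u : mu.-integrable setT (EFin \o emb P u).
Proof. exact: (Lfun2_integrable Obd (emb_L2 u)). Qed.

Lemma emb0 : \forall x \ae mu, emb P 0 x = 0.
Proof.
have [_ lin _ _ _] := cemb; apply: filterS (lin 1 0 0) => x.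
rewrite scaler0 addr0 mul1r => /eqP; rewrite -[X in X == _]addr0 => /eqP/addrI.
by move=> /esym.
Qed.

Lemma embZ (a : R) u : \forall x \ae mu, emb P (a *: u) x = a * emb P u x.
Proof.
have [_ lin _ _ _] := cemb; apply: filterS2 (lin a u 0) emb0 => x.
by rewrite addr0 => -> ->; rewrite addr0.
Qed.

Lemma L2norm_embZ (a : R) u :
  L2norm mu (emb P (a *: u)) = `|a| * L2norm mu (emb P u).
Proof.
rewrite -L2normZ; last exact: emb_L2.
apply: ae_eq_L2norm; [exact: emb_L2| |exact: embZ].
rewrite (_ : (fun x => _) = a \o* emb P u); last by apply/funext => x /=; rewrite mulrC.
by apply: Lfun_scale; [rewrite ler1n|exact: emb_L2].
Qed.

(** A compact embedding is bounded: otherwise some normalized sequence would have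
images of unbounded norm and no convergent subsequence. *)
Lemma emb_bounded : exists2 K : R, 0 <= K & forall u, L2norm mu (emb P u) <= K * `|u|.
Proof.
apply: contrapT => nK.
have /choice[v vP] n : exists v, `|v| = 1 /\ n%:R < L2norm mu (emb P v).
  apply: contrapT => nv; apply: nK; exists n%:R => // u.
  have [->|u0] := eqVneq u 0.
    rewrite normr0 mulr0 -[X in emb P X](scale0r 0) L2norm_embZ normr0 mul0r//.
  rewrite leNgt; apply/negP => nu; apply: nv; exists (`|u|^-1 *: u).
  have nu0 : 0 < `|u| by rewrite normr_gt0.
  rewrite normrZ normfV normr_id mulVf ?normr_eq0//; split=> //.
  by rewrite L2norm_embZ normfV normr_id ltr_pdivlMl// mulrC.
have [_ _ _ cpt _] := cemb.
have [|s [g [smono g2 cvg0]]] := cpt v.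
  by exists 1 => n; have [-> _] := vP n.
have sn n : (n <= s n)%N.
  by elim: n => // n IH; apply: leq_ltn_trans IH _; exact: smono.
have [M _ Mlt] : \forall n \near \oo, L2norm mu (emb P (v (s n)) \- g) < 1.
  exact: (cvgr_lt _ cvg0 _ ltr01).
pose n := maxn M (Num.bound (1 + L2norm mu g)).
have := Mlt n (leq_maxl _ _); apply/negP; rewrite -leNgt.
have [_ lt_n] := vP (s n).
have bn : 1 + L2norm mu g < n%:R.
  apply: lt_le_trans (_ : (Num.bound (1 + L2norm mu g))%:R <= _).
    by apply: archi_boundP; rewrite addr_ge0 ?L2norm_ge0.
  by rewrite ler_nat leq_maxr.
have nsn : n%:R <= (s n)%:R :> R by rewrite ler_nat.
have tri : L2norm mu (emb P (v (s n))) <= L2norm mu (emb P (v (s n)) \- g) + L2norm mu g.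
  rewrite [X in L2norm mu X <= _](_ : _ = (emb P (v (s n)) \- g) \+ g).
    by apply: L2normD => //; apply: Lfun2B => //; exact: emb_L2.
  by apply/funext => x /=; rewrite subrK.
lra.
Qed.

Lemma cell_integral_le f i : f \in Lfun mu 2%:E ->
  `|\int[mu]_(x in Q i) f x| <= L2norm mu (cst 1) * L2norm mu f.
Proof.
move=> f2; have mQ := measurable_cell cubes i.
have fi := Lfun2_integrable Obd f2.
apply: le_trans (le_normr_Rintegral mQ _) _; first exact: integrableST.
apply: le_trans (L1_le_L2 Obd f2).
rewrite -(Rintegral_indicM mu (fun x => `|f x|) mQ).
have nfi : mu.-integrable setT (EFin \o (fun x => `|f x|)) := integrable_norm fi.
apply: le_Rintegral => //; first by apply: integrable_mul_indic => //; exact: integrableST.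
by move=> x _; rewrite indicE; case: (_ \in _); rewrite /= ?mulr1 ?mulr0.
Qed.

Lemma avg_lin (a : R) u v i :
  avg P D (emb P (a *: u + v)) i = a * avg P D (emb P u) i + avg P D (emb P v) i.
Proof.
have mQ := measurable_cell cubes i; have [_ lin _ _ _] := cemb.
have mu_ w := measurable_Lfun (emb_L2 w).
have iu w : mu.-integrable (Q i) (EFin \o emb P w).
  by apply: integrableST => //; exact: emb_integrable.
rewrite /avg (@ae_eq_Rintegral _ _ _ mu (Q i) _ (fun x => a * emb P u x + emb P v x))//.
  rewrite RintegralD//; last exact: integrableZl_EFin.
  by rewrite RintegralZl// mulrDr mulrCA.
by apply: measurable_funD => //; apply: measurable_funM.
Qed.

Lemma avg_bounded : exists2 K : R, 0 <= K & forall u i, `|avg P D (emb P u) i| <= K * `|u|.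
Proof.
have [K K0 embK] := emb_bounded.
pose m i := fine (mu (Q i)).
have m0 i : 0 < m i by exact: cell_measure_gt0.
pose S := \sum_i (m i)^-1 * (L2norm mu (cst 1) * K).
have term0 i : 0 <= (m i)^-1 * (L2norm mu (cst 1) * K).
  by rewrite !mulr_ge0 ?invr_ge0 ?L2norm_ge0// ltW.
exists S; first exact: sumr_ge0.
move=> u i; apply: (@le_trans _ _ ((m i)^-1 * (L2norm mu (cst 1) * K) * `|u|)).
  rewrite /avg normrM ger0_norm ?invr_ge0 ?(ltW (m0 i))// -mulrA ler_pM2l ?invr_gt0//.
  rewrite (le_trans (cell_integral_le i (emb_L2 u)))// -mulrA ler_wpM2l ?L2norm_ge0//.
  exact: m0.
by rewrite ler_wpM2r// /S (bigD1 i)//= lerDl sumr_ge0.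
Qed.

Lemma pairing_step z v :
  pairing P (step D z) v = \sum_i z 0 i * (fine (mu (Q i)) * avg P D (emb P v) i).
Proof.
have mQ i := measurable_cell cubes i.
have vi := emb_integrable v.
rewrite /pairing (@eq_Rintegral _ _ _ _ _ (fun x => \sum_i z 0 i * (emb P v x * \1_(Q i) x))).
  rewrite Rintegral_sum//; last first.
    move=> i; apply: integrableZl_EFin => //; apply: integrable_mul_indic => //.
    exact: integrableST.
  apply: eq_bigr => i _; rewrite RintegralZl//; last first.
    by apply: integrable_mul_indic => //; exact: integrableST.
  rewrite Rintegral_indicM//; congr (_ * _); rewrite /avg mulVKf// gt_eqF//.
  exact: cell_measure_gt0.
by move=> x _; rewrite /step mulr_suml; apply: eq_bigr => i _; ring.
Qed.

Lemma pairing_step_linl z1 z2 (t1 t2 : R) v :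
  pairing P (step D (t1 *: z1 + t2 *: z2)) v =
  t1 * pairing P (step D z1) v + t2 * pairing P (step D z2) v.
Proof.
rewrite !pairing_step !mulr_sumr -big_split /=; apply: eq_bigr => i _.
by rewrite !mxE; ring.
Qed.

Lemma pairing_step_linr z (a : R) u v :
  pairing P (step D z) (a *: u + v) = a * pairing P (step D z) u + pairing P (step D z) v.
Proof.
rewrite !pairing_step mulr_sumr -big_split /=; apply: eq_bigr => i _.
by rewrite avg_lin; ring.
Qed.

Lemma pairing_step_bounded : exists2 K : R, 0 <= K &
  forall z v, `|pairing P (step D z) v| <= K * `|z| * `|v|.
Proof.
have [K K0 avgK] := avg_bounded.
pose m i := fine (mu (Q i)).
have m0 i : 0 < m i by exact: cell_measure_gt0.
exists (\sum_i m i * K); first by apply: sumr_ge0 => i _; rewrite mulr_ge0// ltW.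
move=> z v; rewrite pairing_step (le_trans (ler_norm_sum _ _ _))// !mulr_suml.
apply: ler_sum => i _; rewrite !normrM (ger0_norm (ltW (m0 i))).
rewrite -/(m i) [leRHS](_ : _ = `|z| * (m i * (K * `|v|))); last by ring.
apply: ler_pM => //; first by rewrite mulr_ge0// ltW.
  exact: coord_le_norm.
by rewrite ler_wpM2l ?(ltW (m0 i))// -normrM; exact: avgK.
Qed.

End states.

(** * The feasible set of the relaxation *)

Section feasible_set.
Context {R : realType} {d : nat} {U : completeNormedModType R}.
Context (P : ocp d U) (hP : setting P) (D : discretization R d).
Hypothesis hD : discrete_setting P D.
Local Notation mu := (leb P).
Local Notation C := (admissible P).
Local Notation N := (ncells D).
Local Notation A := (stateop P).
Implicit Types (u v : U) (w : 'rV[R]_d -> R) (c z : 'rV[R]_N) (i : 'I_N).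

Let Obd := Omega_bounded hP.
Let cubes := cells_partition hD.
Let cemb := U_embedding hP.

Lemma rV_norm_le n (x : 'rV[R]_n) (B : R) : 0 <= B ->
  (forall j : 'I_n, `|x 0 j| <= B) -> `|x| <= B.
Proof.
move=> B0 xB; change (mx_norm x <= B); rewrite mx_normrE.
by apply: bigmax_le => // -[j i] _; rewrite ord1.
Qed.

Lemma dual_norm_le (phi : U -> R) (K : R) : 0 <= K -> dual_space phi ->
  (forall v, `|phi v| <= K * `|v|) -> 0 <= dual_norm phi <= K.
Proof.
move=> K0 [lin _] phiK.
have phi0 : phi 0 = 0.
  have := lin 1 0 0; rewrite scaler0 addr0 mul1r => /eqP.
  by rewrite -[X in X == _]addr0 => /eqP/addrI/esym.
have ubK : ubound [set `|phi v| | v in [set v : U | `|v| <= 1]] K.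
  by move=> _ [v /= v1 <-]; rewrite (le_trans (phiK v))// ler_piMr.
have mem0 : [set `|phi v| | v in [set v : U | `|v| <= 1]] 0.
  by exists 0; rewrite /= ?normr0 ?ler01// phi0 normr0.
apply/andP; split; first by apply: ub_le_sup => //; exists K.
by apply: ge_sup => //; exists 0.
Qed.

(** In the relaxed state equation the product is replaced by the vector [z], so that
the inverse of [A] expresses the state explicitly in terms of [z]. *)
Lemma relaxed_solution : exists G : 'rV[R]_N -> U, exists2 L : R, 0 <= L &
  (forall u z, relaxed_state_eq P D u z <-> u = G z) /\
  (forall z1 z2, `|G z1 - G z2| <= L * `|z1 - z2|).
Proof.
have [linA dualA _ bijA [M invA]] := A_isomorphism hP.
have [K K0 pK] := pairing_step_bounded Obd cemb cubes.
have [linf [Mf fM]] := f_dual hP.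
pose phi z v := rhs P v - pairing P (step D z) v.
have dual_pair z : dual_space (pairing P (step D z)).
  split; last by exists (K * `|z|).
  by move=> a u v; exact: pairing_step_linr.
have dual_phi z : dual_space (phi z).
  split.
    by move=> a u v; rewrite /phi linf pairing_step_linr//; ring.
  exists (Mf + K * `|z|) => v; rewrite /phi mulrDl (le_trans (ler_normB _ _))// lerD//.
have /choice[G GP] z : exists u, A u = phi z /\ forall u', A u' = phi z -> u = u'.
  by have [u [? ?]] := bijA _ (dual_phi z); exists u.
exists G, (`|M| * K); first exact: mulr_ge0.
split=> [u z|z1 z2].
  split=> [uz|->]; last first.
    by move=> v; have [-> _] := GP z; rewrite /phi subrK.
  apply/esym; apply: (GP z).2; apply/funext => v.
  by rewrite /phi -(uz v) addrK.
have AG : A (G z1 - G z2) = pairing P (step D (z2 - z1)).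
  rewrite -(scaleN1r (G z2)) addrC linA; apply/funext => v.
  rewrite (GP z1).1 (GP z2).1 /phi.
  rewrite -[z2]scale1r -[in RHS](scaleN1r z1) pairing_step_linl// !scale1r; ring.
apply: le_trans (invA _) _; rewrite AG.
have /andP[n0 nK] : 0 <= dual_norm (pairing P (step D (z2 - z1))) <= K * `|z1 - z2|.
  by apply: dual_norm_le => // [|v]; [rewrite mulr_ge0|rewrite (distrC z1) pK].
rewrite (le_trans (ler_wpM2r n0 (ler_norm M)))// -mulrA ler_wpM2l//.
Qed.

Lemma L2norm_step_le c : L2norm mu (step D c) <= L2norm mu (cst 1) * `|c|.
Proof.
have c2 : (cst 1 : 'rV[R]_d -> R) \in Lfun mu 2%:E.
  by apply: (bounded_Lfun2 Obd) => // x; rewrite normr1.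
have s2 : step D c \in Lfun mu 2%:E by exact: step_Lfun2.
rewrite mulrC -[`|c|]normr_id -L2normZ// !L2normE//; last first.
  rewrite (_ : (fun x => _) = `|c| \o* cst 1); last by apply/funext => x /=; rewrite mulrC.
  by apply: Lfun_scale => //; rewrite ler1n.
apply: ler_wsqrtr; apply: le_Rintegral => //.
- exact: Lfun2_integrable_sqr s2.
- exact: (integrable_cst_leb Obd ((`|c| * 1) ^+ 2) measurableT).
- move=> x _ /=; rewrite -[leLHS]real_normK ?num_real// mulr1.
  by rewrite ler_pXn2r ?nnegrE//; exact: (normr_step_le cubes).
Qed.

(** The values of a step function are its averages over the cells, which are
controlled by its norm in [L^2], and [C] is bounded there. *)
Lemma control_values_bounded : exists2 B : R, 0 <= B &
  forall c, C (step D c) -> `|c| <= B.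
Proof.
have [_ _ [M CM] _ _] := C_admissible hP.
pose m i := fine (mu (cell i)).
have m0 i : 0 < m i by exact: cell_measure_gt0.
pose t i := (m i)^-1 * (L2norm mu (cst 1) * `|M|).
have t0 i : 0 <= t i by rewrite !mulr_ge0 ?invr_ge0 ?L2norm_ge0// ltW.
exists (\sum_i t i); first exact: sumr_ge0.
move=> c Cc; apply: rV_norm_le => [|i]; first exact: sumr_ge0.
apply: (@le_trans _ _ (t i)); last by rewrite (bigD1 i)//= lerDl sumr_ge0.
have s2 : step D c \in Lfun mu 2%:E by exact: step_Lfun2.
rewrite -(avg_step Obd cubes c i) /avg normrM ger0_norm ?invr_ge0 ?(ltW (m0 i))//.
rewrite ler_pM2l ?invr_gt0; last exact: m0.
rewrite (le_trans (cell_integral_le Obd cubes i s2))// ler_wpM2l ?L2norm_ge0//.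
exact: le_trans (CM _ Cc) (ler_norm M).
Qed.

(** The first and the third McCormick inequality enclose [z 0 i] between
expressions in the control value and the average of the state, and the latter is
bounded by the last McCormick inequality. *)
Lemma mccormick_bounded (B : R) : 0 <= B -> exists2 B' : R, 0 <= B' &
  forall u c z, `|c| <= B -> mccormick P D u c z -> `|z| <= B'.
Proof.
move=> B0.
pose t i : R := (`|@cell_u_lo _ _ D i| + `|@cell_u_up _ _ D i|) * (B + 2 * `|@cell_w_lo _ _ D i|).
have t0 i : 0 <= t i by rewrite mulr_ge0 ?addr_ge0// mulr_ge0.
exists (\sum_i t i); first exact: sumr_ge0.
move=> u c z cB mc; apply: rV_norm_le => [|i]; first exact: sumr_ge0.
apply: (@le_trans _ _ (t i)); last by rewrite (bigD1 i)//= lerDl sumr_ge0.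
have [h1 _ h3 _ /andP[ul uu]] := mc i.
have ci : `|c 0 i| <= B by exact: le_trans (coord_le_norm c i) cB.
move: h1 h3 ul uu ci; rewrite /t.
set a := avg _ _ _ _; set ulo := cell_u_lo i; set uup := cell_u_up i.
set wlo := cell_w_lo i; move: (c 0 i) (z 0 i) => ci zi h1 h3 ul uu cB'.
have mulb (x y X Y : R) : `|x| <= X -> `|y| <= Y -> - (X * Y) <= x * y <= X * Y.
  by move=> xX yY; rewrite -ler_norml normrM ler_pM.
have aB : `|a| <= `|ulo| + `|uup|.
  have := ler_norm uup; have := ler_norm (- ulo); rewrite normrN.
  have := normr_ge0 uup; have := normr_ge0 ulo.
  by rewrite ler_norml => ? ? ? ?; apply/andP; split; lra.
have /andP[a1 a2] := mulb _ _ _ _ aB (lexx `|wlo|).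
have /andP[b1 b2] := mulb _ _ _ _ (lexx `|ulo|) cB'.
have /andP[b3 b4] := mulb _ _ _ _ (lexx `|uup|) cB'.
have /andP[d1 d2] := mulb _ _ _ _ (lexx `|ulo|) (lexx `|wlo|).
have /andP[d3 d4] := mulb _ _ _ _ (lexx `|uup|) (lexx `|wlo|).
have p1 : 0 <= `|ulo| * B by rewrite mulr_ge0.
have p2 : 0 <= `|uup| * B by rewrite mulr_ge0.
have p3 : 0 <= `|ulo| * `|wlo| by rewrite mulr_ge0.
have p4 : 0 <= `|uup| * `|wlo| by rewrite mulr_ge0.
by rewrite ler_norml; apply/andP; split; lra.
Qed.

Lemma feasible_bounded : exists B : R, 0 <= B /\ forall u c z,
  McChh_feasible P D (u, c, z) -> [/\ `|u| <= B, `|c| <= B & `|z| <= B].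
Proof.
have [Bc Bc0 cB] := control_values_bounded.
have [Bz Bz0 zB] := mccormick_bounded Bc0.
have [G [L L0 [GP GL]]] := relaxed_solution.
exists (`|G 0| + L * Bz + Bc + Bz); split; first by rewrite !addr_ge0// mulr_ge0.
move=> u c z [Cc _ /GP uG mc].
have cb := cB _ Cc; have zb := zB _ _ _ cb mc.
have LB : 0 <= L * Bz by rewrite mulr_ge0.
have G0 := normr_ge0 (G 0).
have ub : `|u| <= `|G 0| + L * Bz.
  rewrite uG -[G z](subrK (G 0)) addrC (le_trans (ler_normD _ _))// lerD2l.
  by rewrite (le_trans (GL _ _))// subr0 ler_wpM2l.
by split; lra.
Qed.

Lemma McChh_bounded : bounded_set (McChh_feasible P D).
Proof.
have [B [B0 FB]] := feasible_bounded.
exists B; split; first exact: num_real.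
move=> r Br [[u c] z] /FB[uB cB zB] /=.
rewrite [leLHS]prod_normE /= ge_max [`|(u, c)|]prod_normE ge_max.
by rewrite !(le_trans _ (ltW Br)).
Qed.

Lemma McChh_convex :
  @convex_set R (U * 'rV[R]_N * 'rV[R]_N)%type (McChh_feasible P D).
Proof.
move=> [[u1 c1] z1] [[u2 c2] z2] l /set_mem[C1 b1 s1 m1] /set_mem[C2 b2 s2 m2].
apply/mem_set.
have [_ _ _ _ convC] := C_admissible hP.
set t : R := l%:num.
have t01 : 0 <= t <= 1 by rewrite /t ge0 le1.
have /andP[t0 t1] := t01.
change (McChh_feasible P D (t *: u1 + (1 - t) *: u2, t *: c1 + (1 - t) *: c2,
   t *: z1 + (1 - t) *: z2)).
have [linA _ _ _ _] := A_isomorphism hP.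
split.
- by rewrite stepD; exact: convC.
- apply: filterS2 b1 b2 => x /andP[? ?] /andP[? ?]; rewrite stepD.
  by apply/andP; split; nra.
- move=> v; have AZ (a : R) u : A (a *: u) v = a * A u v.
    have A00 : A 0 v = 0.
      have := congr1 (fun g => g v) (linA 1 0 0); rewrite scaler0 addr0 mul1r => /eqP.
      by rewrite -[X in X == _]addr0 => /eqP/addrI/esym.
    by have := congr1 (fun g => g v) (linA a u 0); rewrite addr0 A00 addr0.
  rewrite linA AZ pairing_step_linl//.
  have -> : A u1 v = rhs P v - pairing P (step D z1) v by rewrite -(s1 v) addrK.
  have -> : A u2 v = rhs P v - pairing P (step D z2) v by rewrite -(s2 v) addrK.
  ring.
- move=> i; have [h1 h2 h3 h4 /andP[h5 h6]] := m1 i; have [k1 k2 k3 k4 /andP[k5 k6]] := m2 i.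
  have -> : avg P D (emb P (t *: u1 + (1 - t) *: u2)) i =
      t * avg P D (emb P u1) i + (1 - t) * avg P D (emb P u2) i.
    rewrite avg_lin//; congr (_ + _); rewrite -[(1 - t) *: u2]addr0 avg_lin//.
    have -> : avg P D (emb P 0) i = 0.
      have := avg_lin Obd cemb cubes 1 0 0 i; rewrite scaler0 addr0 mul1r => /eqP.
      by rewrite -[X in X == _]addr0 => /eqP/addrI/esym.
    by rewrite addr0.
  rewrite !mxE; move: h1 h2 h3 h4 h5 h6 k1 k2 k3 k4 k5 k6.
  move: (avg _ _ _ _) (avg _ _ _ _) (c1 0 i) (c2 0 i) (z1 0 i) (z2 0 i).
  move=> a1 a2 x1 x2 y1 y2 h1 h2 h3 h4 h5 h6 k1 k2 k3 k4 k5 k6.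
  have t1' : 0 <= 1 - t by rewrite subr_ge0.
  have cmb (p q r s : R) : p <= q -> r <= s -> t * p + (1 - t) * r <= t * q + (1 - t) * s.
    by move=> pq rs; rewrite lerD// ler_wpM2l.
  split.
  + by have := cmb _ _ _ _ h1 k1; lra.
  + by have := cmb _ _ _ _ h2 k2; lra.
  + by have := cmb _ _ _ _ h3 k3; lra.
  + by have := cmb _ _ _ _ h4 k4; lra.
  + apply/andP; split; first by have := cmb _ _ _ _ h5 k5; lra.
    by have := cmb _ _ _ _ h6 k6; lra.
Qed.

End feasible_set.

(** * Existence of minimizers *)

Section existence.
Context {R : realType} {d : nat} {U : completeNormedModType R}.
Context (P : ocp d U) (hP : setting P) (D : discretization R d).
Hypothesis hD : discrete_setting P D.
Hypothesis hPh : forall w, admissible P w -> admissible P (Ph P D w).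
Local Notation mu := (leb P).
Local Notation C := (admissible P).
Local Notation N := (ncells D).
Implicit Types (u v : U) (w : 'rV[R]_d -> R) (c z : 'rV[R]_N) (i : 'I_N).

Let Obd := Omega_bounded hP.
Let cubes := cells_partition hD.
Let cemb := U_embedding hP.

Lemma McChh_nonempty : exists x, McChh_feasible P D x.
Proof.
have [[w0 Cw0] _ _ _ _] := C_admissible hP.
have Cw := hPh Cw0; have bw := control_bounds_Ph hP hD hPh Cw0.
have [u [uw _]] := averaged_state_unique hD (BV_step Obd cubes _) bw.
by eexists; exact: (averaged_feasible hP hD hPh Cw bw uw).
Qed.

(** The indices come from a cluster point of the sequence. They need not increase,
but dominating the identity is enough for a minimizing sequence. *)
Lemma bounded_subsequence n (x : nat -> 'rV[R]_n) (B : R) : (forall k, `|x k| <= B) ->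
  exists l, exists s : nat -> nat, (forall k, (k <= s k)%N) /\
    forall k, `|x (s k) - l| < k.+1%:R^-1.
Proof.
move=> xB; pose K := cbox (const_mx (- B) : 'rV[R]_n) (const_mx B).
have xK k : K (x k).
  by move=> i; rewrite !mxE -ler_norml (le_trans (coord_le_norm _ _)).
have cK : compact K by exact: compact_cbox.
have PF : ProperFilter (x @ \oo) by exact: fmap_proper_filter.
have [|l [_ cl]] := cK (x @ \oo) PF; first by exists 0%N => // k _ /=; exact: xK.
exists l; have /choice[s sP] k : exists m, (k <= m)%N /\ `|x m - l| < k.+1%:R^-1.
  have FA : (x @ \oo) (x @` [set m | (k <= m)%N]) by exists k => // m /= km; exists m.
  have lB : nbhs l (ball l k.+1%:R^-1) by apply: nbhsx_ballx; rewrite invr_gt0.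
  have [_ [[m /= km <-] yl]] := cl _ _ FA lB.
  by exists m; split=> //; rewrite distrC; move: yl; rewrite -ball_normE.
by exists s; split=> k; have [] := sP k.
Qed.

Lemma limn_einf_le (v : nat -> \bar R) (y : \bar R) :
  (forall n, exists2 k, (n <= k)%N & (v k <= y)%E) -> (limn_einf v <= y)%E.
Proof.
move=> vy; rewrite limn_einf_lim; apply: lime_le; first exact: is_cvg_einfs.
apply: nearW => n; have [k nk vk] := vy n.
by apply: le_trans vk; apply: ereal_inf_lbound; exists k.
Qed.

Lemma cvg_of_rate (x : nat -> R) (l L : R) :
  (forall k, `|x k - l| <= L * k.+1%:R^-1) -> x k @[k --> \oo] --> l.
Proof.
move=> xl; apply/cvgrPdist_le => e e0.
have cv : L * k.+1%:R^-1 @[k --> \oo] --> (0 : R).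
  by rewrite -(mulr0 L); apply: cvgMr; exact: cvg_harmonic.
have ev : \forall k \near \oo, L * k.+1%:R^-1 <= e by exact: (cvgr_le _ cv).
apply: filterS ev => k ke.
by rewrite distrC (le_trans (xl k)).
Qed.

(** Every constraint passes to the limit: [C] is closed in [L^2], the control bounds
hold simultaneously for all [k] almost everywhere, and averages depend
continuously on the state. *)
Lemma feasible_limit (u_ : nat -> U) (c_ z_ : nat -> 'rV[R]_N) u c z (L : R) :
  (forall k, McChh_feasible P D (u_ k, c_ k, z_ k)) -> relaxed_state_eq P D u z ->
  (forall k, `|u_ k - u| <= L * k.+1%:R^-1) ->
  (forall k, `|c_ k - c| <= L * k.+1%:R^-1) ->
  (forall k, `|z_ k - z| <= L * k.+1%:R^-1) ->
  McChh_feasible P D (u, c, z).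
Proof.
move=> Fk uz ul cl zl.
have rowcv (x_ : nat -> 'rV[R]_N) x i : (forall k, `|x_ k - x| <= L * k.+1%:R^-1) ->
    x_ k 0 i @[k --> \oo] --> x 0 i.
  move=> xl; apply: (@cvg_of_rate _ _ L) => k; apply: le_trans (xl k).
  by have := coord_le_norm (x_ k - x) i; rewrite !mxE.
have [_ _ _ Cclosed _] := C_admissible hP.
split=> //.
- apply: (Cclosed (fun k => step D (c_ k))).
  + by move=> k; have [] := Fk k.
  + exact: step_Lfun2.
  + apply: (@cvg_of_rate _ _ (L2norm mu (cst 1) * L)) => k.
    rewrite subr0 stepB ger0_norm ?L2norm_ge0// -mulrA.
    rewrite (le_trans (L2norm_step_le hP hD _))// ler_wpM2l ?L2norm_ge0//.
- have : \forall x \ae mu, forall k, w_lo P x <= step D (c_ k) x <= w_up P x.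
    by apply: ae_foralln => k; have [] := Fk k.
  apply: filterS => x xk.
  have cv : step D (c_ k) x @[k --> \oo] --> step D c x.
    apply: (@cvg_of_rate _ _ L) => k; apply: le_trans (cl k).
    have -> : step D (c_ k) x - step D c x = step D (c_ k - c) x by rewrite -stepB.
    exact: (normr_step_le cubes).
  apply/andP; split.
    by apply: (cvgr_to_ge cv); apply: nearW => k; have /andP[] := xk k.
  by apply: (cvgr_to_le cv); apply: nearW => k; have /andP[] := xk k.
- have [K K0 avgK] := avg_bounded Obd cemb cubes.
  move=> i /=; have ccv := rowcv c_ c i cl; have zcv := rowcv z_ z i zl.
  have acv : avg P D (emb P (u_ k)) i @[k --> \oo] --> avg P D (emb P u) i.
    apply: (@cvg_of_rate _ _ (K * L)) => k.
    have -> : avg P D (emb P (u_ k)) i - avg P D (emb P u) i =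
        avg P D (emb P (-1 *: u + u_ k)) i.
      by rewrite avg_lin// mulN1r addrC.
    by rewrite (le_trans (avgK _ _))// -mulrA ler_wpM2l// scaleN1r addrC.
  have affcv (a1 b1 a2 : R) :
      a1 * c_ k 0 i + avg P D (emb P (u_ k)) i * a2 - b1 @[k --> \oo] -->
      a1 * c 0 i + avg P D (emb P u) i * a2 - b1.
    apply: cvgB; last exact: cvg_cst.
    by apply: cvgD; [exact: cvgMr|exact: cvgMl].
  have mk k : mccormick P D (u_ k) (c_ k) (z_ k) by have [] := Fk k.
  split.
  + by apply: (ler_cvg_to (affcv _ _ _) zcv); apply: nearW => k; have [] := mk k i.
  + by apply: (ler_cvg_to (affcv _ _ _) zcv); apply: nearW => k; have [] := mk k i.
  + by apply: (ler_cvg_to zcv (affcv _ _ _)); apply: nearW => k; have [] := mk k i.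
  + by apply: (ler_cvg_to zcv (affcv _ _ _)); apply: nearW => k; have [] := mk k i.
  + apply/andP; split.
      by apply: (cvgr_to_ge acv); apply: nearW => k; have [_ _ _ _ /andP[]] := mk k i.
    by apply: (cvgr_to_le acv); apply: nearW => k; have [_ _ _ _ /andP[]] := mk k i.
Qed.

(** One Lipschitz constant of the cost on a bounded set serves all feasible points,
as these form a bounded set. *)
Lemma cost_feasible_lipschitz : exists L : R, 0 <= L /\
  forall u1 c1 z1 u2 c2 z2, McChh_feasible P D (u1, c1, z1) ->
    McChh_feasible P D (u2, c2, z2) ->
    `|cost P u1 (step D c1) - cost P u2 (step D c2)| <= L * (`|u1 - u2| + `|c1 - c2|).
Proof.
have [B [B0 FB]] := feasible_bounded hP hD.
set n1 := L2norm mu (cst 1); have n10 : 0 <= n1 by exact: L2norm_ge0.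
have [L Lip] := cost_lipschitz hP (B + n1 * B).
exists (`|L| * (1 + n1)); split; first by rewrite mulr_ge0// addr_ge0.
move=> u1 c1 z1 u2 c2 z2 /FB[u1B c1B _] /FB[u2B c2B _].
have nB : 0 <= n1 * B by rewrite mulr_ge0.
have sB c : `|c| <= B -> L2norm mu (step D c) <= B + n1 * B.
  by move=> cB; rewrite (le_trans (L2norm_step_le hP hD c))// -/n1 ler_wpDl// ler_wpM2l.
apply: le_trans (Lip u1 u2 _ _ (step_Lfun2 Obd cubes c1) (step_Lfun2 Obd cubes c2) _ _ (sB _ c1B) (sB _ c2B)) _.
- by rewrite (le_trans u1B)// lerDl.
- by rewrite (le_trans u2B)// lerDl.
have s12 := L2norm_step_le hP hD (c1 - c2); rewrite -stepB in s12.
have s0 : 0 <= L2norm mu (step D c1 \- step D c2) by exact: L2norm_ge0.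
apply: le_trans (ler_wpM2r _ (ler_norm L)) _; first by rewrite addr_ge0.
rewrite -mulrA ler_wpM2l//; have := normr_ge0 (u1 - u2); have := normr_ge0 (c1 - c2).
by rewrite -/n1 in s12; move: `|u1 - u2| `|c1 - c2| s12 => x y h y0 x0; nra.
Qed.

Lemma TVh_step_ge0 c : (0 <= TVh D (step D c))%E.
Proof. by have [+ _ _ _] := TVh_approx hD; apply; exact: step_Lfun1. Qed.

(** A minimizing sequence has feasible vectors [(c, z)] in a bounded set of a
finite-dimensional space, and the states follow [z]. Along a convergent
subsequence the cost converges, and the lower semicontinuity of [TVh] does the
rest. If the optimal value is infinite, then every feasible point is a
minimizer. *)
Lemma McChh_minimizer :
  exists x, minimizer (McChh_feasible P D) (McChh_objective P D) x.
Proof.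
have [[[u0 c0] z0] F0] := McChh_nonempty.
have a0 := alpha_gt0 hP.
have [B [B0 FB]] := feasible_bounded hP hD.
have [Lc [Lc0 costL]] := cost_feasible_lipschitz.
have [G [L [L0 [GP GL]]]] : exists G : 'rV[R]_N -> U, exists L, 0 <= L /\
    ((forall u z, relaxed_state_eq P D u z <-> u = G z) /\
     (forall z1 z2, `|G z1 - G z2| <= L * `|z1 - z2|)).
  by have [G [L L0 h]] := relaxed_solution hP hD; exists G, L.
set F := McChh_feasible P D; set J := McChh_objective P D.
pose V := ereal_inf (J @` F).
have [VE|Vlt] := eqVneq V +oo%E.
  exists (u0, c0, z0); split=> // y Fy.
  have := ereal_inf_lbound (ex_intro2 _ _ y Fy erefl : (J @` F) (J y)).
  by rewrite -/V VE leye_eq => /eqP ->; rewrite leey.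
have Vge : ((cost P u0 (step D c0) - Lc * (4 * B))%:E <= V)%E.
  apply: le_ereal_inf_tmp => _ [[[u c] z] Fx <-] /=.
  have := costL _ _ _ _ _ _ F0 Fx; rewrite ler_norml => /andP[_ cl].
  have [u0B c0B _] := FB _ _ _ F0; have [uB cB _] := FB _ _ _ Fx.
  (* all feasible vectors have norm at most [B] *)
  have dist : `|u0 - u| + `|c0 - c| <= 4 * B.
    by have := ler_normB u0 u; have := ler_normB c0 c; lra.
  have cL : cost P u0 (step D c0) - Lc * (4 * B) <= cost P u (step D c).
    by have := ler_wpM2l Lc0 dist; lra.
  apply: (@le_trans _ _ (cost P u (step D c))%:E); first by rewrite lee_fin.
  by rewrite leeDl// mule_ge0 ?lee_fin ?(ltW a0)//; exact: TVh_step_ge0.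
have [m Vm] : exists m : R, V = m%:E.
  move: Vge Vlt; case: (V) => [m| |] //; by exists m.
have /choice[x xP] k : exists x, F x /\ (J x <= (m + k.+1%:R^-1)%:E)%E.
  have : (V < (m + k.+1%:R^-1)%:E)%E by rewrite Vm lte_fin ltrDl invr_gt0.
  by move=> /ereal_inf_lt[_ [y Fy <-] Jy]; exists y; split=> //; exact: ltW.
have xB k : `|row_mx (x k).1.2 (x k).2| <= B.
  have [Fx _] := xP k; move: Fx; case: (x k) => [[u c] z] Fx /=; have [_ cB zB] := FB _ _ _ Fx.
  apply: rV_norm_le => // j; rewrite mxE; case: (fintype.split j) => i /=.
    exact: le_trans (coord_le_norm c i) cB.
  exact: le_trans (coord_le_norm z i) zB.
have [l [s [sk sl]]] := bounded_subsequence xB.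
pose c := lsubmx l; pose z := rsubmx l; pose u := G z.
pose c_ k := (x (s k)).1.2; pose z_ k := (x (s k)).2; pose u_ k := (x (s k)).1.1.
have xE k : x (s k) = (u_ k, c_ k, z_ k).
  by rewrite /u_ /c_ /z_; case: (x (s k)) => [[? ?] ?].
have Fk k : F (u_ k, c_ k, z_ k) by rewrite -xE; have [] := xP (s k).
pose M := 1 + L.
have M1 : 1 <= M by rewrite lerDl.
have k0 k : 0 <= k.+1%:R^-1 :> R by rewrite invr_ge0.
have cl k : `|c_ k - c| <= k.+1%:R^-1.
  apply: rV_norm_le => // i; apply: le_trans (ltW (sl k)).
  have -> : (c_ k - c) 0 i = (row_mx (c_ k) (z_ k) - l) 0 (lshift _ i).
    by rewrite mxE [RHS]mxE row_mxEl !mxE.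
  exact: coord_le_norm.
have zl k : `|z_ k - z| <= k.+1%:R^-1.
  apply: rV_norm_le => // i; apply: le_trans (ltW (sl k)).
  have -> : (z_ k - z) 0 i = (row_mx (c_ k) (z_ k) - l) 0 (rshift _ i).
    by rewrite mxE [RHS]mxE row_mxEr !mxE.
  exact: coord_le_norm.
have ul k : `|u_ k - u| <= L * k.+1%:R^-1.
  have [_ _ /GP -> _] := Fk k.
  by rewrite (le_trans (GL _ _))// ler_wpM2l.
have scaleM (y : R) k : y <= k.+1%:R^-1 -> y <= M * k.+1%:R^-1.
  by move=> yk; rewrite (le_trans yk)// ler_peMl.
have Fl : F (u, c, z).
  apply: (@feasible_limit u_ c_ z_ _ _ _ M) => // [|k|k|k].
  - exact/GP.
  - by rewrite (le_trans (ul k))// ler_wpM2r// /M lerDr.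
  - exact/scaleM/cl.
  - exact/scaleM/zl.
exists (u, c, z); split=> // y Fy.
apply: (@le_trans _ _ V); last first.
  by apply: ereal_inf_lbound; exists y.
pose j := cost P u (step D c).
have costcv k : cost P (u_ k) (step D (c_ k)) >= j - Lc * (L + 1) * k.+1%:R^-1.
  have := costL _ _ _ _ _ _ Fl (Fk k); rewrite ler_norml => /andP[_ h].
  have := ul k; have := cl k; rewrite distrC [X in _ -> X <= _ -> _]distrC => ck uk.
  have := ler_wpM2l Lc0 (lerD uk ck); rewrite -/j in h *.
  rewrite (_ : L * _ + _ = (L + 1) * k.+1%:R^-1); last by rewrite mulrDl mul1r.
  by rewrite mulrA => /(le_trans h); rewrite lerBlDr -lerBlDl.
have [_ lsc _ _] := TVh_approx hD.
have TVle : (TVh D (step D c) <= ((m - j) / alpha P)%:E)%E.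
  apply: le_trans (lsc (fun k => step D (c_ k)) _ _ _ _) _.
  - by move=> k; exact: step_Lfun1.
  - exact: step_Lfun1.
  - apply: (@cvg_of_rate _ _ (L2norm mu (cst 1) * L2norm mu (cst 1))) => k.
    rewrite subr0 stepB.
    have s2 := step_Lfun2 Obd cubes (c_ k - c).
    have -> : L1norm mu (step D (c_ k - c)) = \int[mu]_x `|step D (c_ k - c) x|.
      by rewrite /L1norm Lnorm1.
    rewrite ger0_norm; last by apply: Rintegral_ge0.
    rewrite (le_trans (L1_le_L2 Obd s2))// -mulrA ler_wpM2l ?L2norm_ge0//.
    by rewrite (le_trans (L2norm_step_le hP hD _))// ler_wpM2l ?L2norm_ge0.
  - apply/lee_addgt0Pr => e e0; apply: limn_einf_le => n.
    (* beyond the index [T] the value of [J] exceeds the infimum, and the cost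
       deviates from its limit, by less than [alpha P * e] altogether *)
    pose T : R := (1 + Lc * (L + 1)) / (alpha P * e).
    exists (maxn n (Num.bound T)); first exact: leq_maxl.
    set k := maxn _ _.
    have T0 : 0 <= T by rewrite divr_ge0 ?addr_ge0 ?mulr_ge0 ?addr_ge0// ltW.
    have Tk : T <= k.+1%:R.
      apply: le_trans (ltW (archi_boundP T0)) _; rewrite ler_nat.
      by rewrite (leq_trans (leq_maxr n _)).
    have Jk : (J (x (s k)) <= (m + k.+1%:R^-1)%:E)%E.
      have [_ Jx] := xP (s k); apply: le_trans Jx _.
      by rewrite lee_fin lerD2l lef_pV2 ?posrE// ler_nat ltnS sk.
    have TV0 := TVh_step_ge0 (c_ k).
    move: Jk; rewrite xE /J /=.
    case E : (TVh D (step D (c_ k))) => [t| |]; last by rewrite E in TV0.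
      rewrite -EFinM -EFinD !lee_fin => Jk.
      have := costcv k; move: Tk; rewrite ler_pdivrMr ?mulr_gt0// => Tk cc.
      have kp : 0 < k.+1%:R :> R by [].
      have small : (1 + Lc * (L + 1)) * k.+1%:R^-1 <= alpha P * e.
        by rewrite ler_pdivrMr // [leRHS]mulrC.
      rewrite -(ler_pM2l a0) mulrDr mulrCA mulfV ?gt_eqF// mulr1.
      move: Jk cc small; set r := k.+1%:R^-1; move: r => r.
      by lra.
    by rewrite gt0_muley ?lte_fin// addey// leye_eq.
rewrite Vm /J /=.
apply: (@le_trans _ _ (j%:E + (alpha P)%:E * ((m - j) / alpha P)%:E)%E).
  by rewrite leeD2l// lee_pmul2l// lte_fin.
by rewrite -EFinM -EFinD lee_fin mulrCA mulfV ?gt_eqF// mulr1 addrC subrK.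
Qed.

End existence.

Theorem theorem2p11 (R : realType) (d : nat) (hd : (0 < d)%N)
    (U : completeNormedModType R) (P : ocp d U) (hP : setting P)
    (D : discretization R d) (hD : discrete_setting P D)
    (hPh : forall w, admissible P w -> admissible P (Ph P D w)) :
  [/\ [/\ @convex_set R (U * 'rV[R]_(ncells D) * 'rV[R]_(ncells D))%type (McChh_feasible P D),
          bounded_set (McChh_feasible P D) &
          exists x, minimizer (McChh_feasible P D) (McChh_objective P D) x],
      (forall u c z, McChh_feasible P D (u, c, z) ->
        McCh_feasible P D (u, step D c, z) /\ BV (leb P) (Omega P) (step D c)),
      (forall u w z, McCh_feasible P D (u, w, z) ->
        McChh_feasible P D (u, \row_i avg P D w i, z)),
      (forall (u' ubar : U) wbar z (Lw : R),
        minimizer (McCh_feasible P D) (McCh_objective P D) (u', wbar, z) ->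
        averaged_state_eq P D ubar wbar ->
        lipschitz_snd P (McChh_states P D) (admissible P) Lw ->
        (OCP_objective P (ubar, wbar) >=
          optimal_value (McChh_feasible P D) (McChh_objective P D) -
          Lw%:E * projection_error P (mesh_size D) wbar)%E) &
      (forall (ubar ubarh : U) wbar (Lu Lw : R),
        minimizer (OCP_feasible P) (OCP_objective P) (ubar, wbar) ->
        averaged_state_eq P D ubarh wbar ->
        lipschitz_fst P (McChh_states P D `|` [set ubar]) (admissible P) Lu ->
        lipschitz_snd P (McChh_states P D) (admissible P) Lw ->
        (optimal_value (OCP_feasible P) (OCP_objective P) >=
          optimal_value (McChh_feasible P D) (McChh_objective P D) -
          (Lu * `|ubar - ubarh|)%:E -
          Lw%:E * projection_error P (mesh_size D) wbar)%E)].
Proof.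
split.
- by split; [exact: McChh_convex|exact: McChh_bounded|
    exact: McChh_minimizer].
- move=> u c z F; split; first exact: McChh_McCh.
  exact: BV_step (Omega_bounded hP) (cells_partition hD) c.
- by move=> u w z; exact: McCh_McChh.
- move=> u' ubar wbar z Lw [[Cw bw _ _] _] uw Lip.
  exact: value_le_objective Cw bw uw Lip.
- move=> ubar ubarh wbar Lu Lw [[/= BVw Cw uw] opt] uhw Lipu Lipw.
  have [_ bw] := state_control_bounds hP BVw Cw uw.
  apply: (@le_trans _ _ (OCP_objective P (ubar, wbar))).
    exact: value_le_objective_state Cw bw uhw Lipw Lipu.
  by apply: le_ereal_inf_tmp => _ [y Fy <-]; exact: opt.
Qed.
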